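(* Let $\ell\ge2$ and $\mu>0$. Suppose that $p=\omega(n^{-1/\ell})$. Let $G$ be an $n$-vertex graph with $\delta_1(G)\ge(\delta_1(\mathsf{PowHam}^\ell)+\mu)n$. Then $G_p$ contains the $\ell$th power of a Hamilton cycle with high probability.
   Context: Graphs are finite simple graphs; $\delta_1(G)$ is the minimum degree. $G_p$ is the random subgraph of $G$ on $V(G)$ obtained by keeping each edge independently with probability $p\in[0,1]$. ''With high probability'': for every $\varepsilon>0$ and every function $p=p(n)$ as in the hypothesis there is $n_0$ such that for all $n\ge n_0$ and every $n$-vertex $G$ satisfying the hypotheses, the event has probability at least $1-\varepsilon$. A graph $C$ is the $\ell$th power of a cycle if its vertices have a cyclic ordering such that every $\ell+1$ consecutive vertices form a clique; it is an $\ell$th power of a Hamilton cycle in $G$ if $C\subseteq G$ and it spans all vertices of $G$. The threshold $\delta_1(\mathsf{PowHam}^\ell)$ is the infimum over all $\delta\in[0,1]$ such that for all $\mu>0$ and $n$ large enough, every $n$-vertex graph $G$ with $\delta_1(G)\ge(\delta+\mu)n$ contains the $\ell$th power of a Hamilton cycle. *)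

(* Defs.v *)
From mathcomp Require Import all_boot all_order all_algebra.
From mathcomp Require Import all_classical all_reals all_analysis.

Set Implicit Arguments.
Unset Strict Implicit.
Unset Printing Implicit Defensive.

Import Order.TTheory GRing.Theory Num.Theory.
Import numFieldNormedType.Exports.

Local Open Scope classical_set_scope.
Local Open Scope ring_scope.

(* A finite simple graph on T, given by its set of edges. *)
Definition sgraph (T : finType) :=
  {E : {set {set T}} | [forall e in E, #|e| == 2]}.

Definition edges (T : finType) (G : sgraph T) : {set {set T}} := val G.

Definition adj (T : finType) (G : sgraph T) : rel T :=
  fun x y => [set x; y]%SET \in edges G.

Definition degree (T : finType) (G : sgraph T) (x : T) : nat :=
  #|[set y | adj G x y]%SET|.

(* Every degree is smaller than #|T|, so the default value #|T| plays no role
   unless T is empty. *)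
Definition min_degree (T : finType) (G : sgraph T) : nat :=
  \big[minn/#|T|]_(x : T) degree G x.

Definition clique (T : finType) (G : sgraph T) (s : seq T) : Prop :=
  {in s &, forall x y, x != y -> adj G x y}.

(* The sequence c lists all vertices in a cyclic ordering; the windows
   take l.+1 (rot i c) are its runs of l + 1 cyclically consecutive vertices
   (all of the vertices if there are fewer than l + 1 of them). *)
Definition is_cycle_power (T : finType) (l : nat) (C : sgraph T) : Prop :=
  exists c : seq T, [/\ uniq c, (forall x : T, x \in c) &
    forall i : nat, clique C (take l.+1 (rot i c))].

(* Graphs of type sgraph T have the whole of T as vertex set, so a subgraph
   C : sgraph T of G is spanning. *)
Definition has_ham_power (T : finType) (l : nat) (G : sgraph T) : Prop :=
  exists2 C : sgraph T, edges C \subset edges G & is_cycle_power l C.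

Definition ham_power_threshold (R : realType) (l : nat) : R :=
  inf [set d : R | 0 <= d <= 1 /\
    forall mu : R, 0 < mu ->
      \forall n \near \oo, forall T : finType, #|T| = n ->
        forall G : sgraph T, (d + mu) * n%:R <= (min_degree G)%:R ->
          has_ham_power l G].

(* The probability that G_p has the property A: each edge of G is kept with
   probability p, independently of the others, so that a given subgraph H
   arises with the probability displayed as a product. *)
Definition prob_random_subgraph (R : realType) (T : finType) (G : sgraph T)
    (p : R) (A : sgraph T -> Prop) : R :=
  \sum_(H : sgraph T | (edges H \subset edges G) && `[< A H >])
    \prod_(e in edges G) (if e \in edges H then p else 1 - p).

(* Main.v *)
(* The threshold is at least l/(l+1), so at the given minimum degree any l + 1
   vertices have linearly many common neighbours. Hence cliques can be connected
   and vertices absorbed robustly, and large sets of high minimum degree have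
   spanning power paths with prescribed ends. Splitting the vertex set at
   random into halves, again and again until the parts have bounded size, gives
   a random power Hamilton cycle for which any m prescribed vertices occupy m
   prescribed positions with probability at most (K/n)^m.

   A set of v > 1 vertices with l v < n spans at most l(v - 2) + 1 edges of a
   power cycle. Decomposing the edges common to a fixed and to the random
   cycle into connected pieces, this bounds the exponential moment of their
   number, at base z a small multiple of n^(1/l), by exp(t n / sqrt n) with t
   small. Expose G_p in two rounds. By the minimum fragment argument for
   spread families, the first round contains all but about sqrt n edges of one
   of the cycles; on sets A of that size the moment is 1 + O(t), so by the
   second moment method the second round contains the missing edges. *)

Require Import Defs.
From mathcomp Require Import all_boot all_order all_algebra.
From mathcomp Require Import boolp all_reals sequences exp.
From mathcomp Require Import zify ring lra.

Set Implicit Arguments.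
Unset Strict Implicit.
Unset Printing Implicit Defensive.

(** * Power paths *)

(** Two rounds are forced by the size of the moment. The random cycle shares a bounded number of
    edges with a fixed one on average, but a shared edge weighs about [n^(1/l)], so a whole cycle
    only has moment at most exp(t sqrt n), too large for a direct second moment argument. Since
    [n^(1/l) <= sqrt n] for [l >= 2], fragments of k or more edges, k about sqrt n, lose against a
    factor 2^-k, while k edges cover so few vertices that their moment stays within O(t) of 1.
    Absorption yields one spanning path and no control over where a vertex lands. Hence it fills
    parts of bounded size only, where a single path is spread with a constant factor. All randomness
    comes from the splits and the links between halves. About log n levels of splitting must lose
    only a constant in total: the loss allowed at a level is tied to the size of its parts, so that
    both the loss in degree and the loss in spread are geometric series. Cliques are connected by a
    walk that revisits its vertices; blowing up the pattern turns the repetitions into different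
    vertices. *)

Section PowerPath.
Variables (T : eqType) (l : nat) (e : rel T).

Fixpoint ppath (s : seq T) : bool :=
  if s is x :: s' then all (e x) (take l s') && ppath s' else true.

Lemma all_take_cat (p : pred T) k (s1 s2 : seq T) :
  all p (take k (s1 ++ s2)) -> all p (take k s1).
Proof.
rewrite take_cat; case: ltnP => // h.
by rewrite all_cat => /andP[h1 _]; rewrite take_oversize.
Qed.

Lemma ppath_cat (s1 s2 : seq T) : ppath (s1 ++ s2) -> ppath s1 && ppath s2.
Proof.
elim: s1 => [|x s1 IH] //= /andP[h /IH /andP[-> ->]].
by rewrite (all_take_cat h).
Qed.

(** An edge of a power path joins positions at distance at most [l], so none jumps over the overlap
    [g]; each lies in one of the two given paths. *)
Lemma ppath_glue (s1 g s2 : seq T) : l <= size g ->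
  ppath (s1 ++ g) -> ppath (g ++ s2) -> ppath (s1 ++ g ++ s2).
Proof.
move=> hg; elim: s1 => [|x s1 IH] //= /andP[h1 h2] h3.
rewrite IH // andbT catA takel_cat // size_cat; lia.
Qed.

Lemma ppathP (x0 : T) (s : seq T) :
  reflect (forall i j, i < j -> j <= i + l -> j < size s ->
             e (nth x0 s i) (nth x0 s j)) (ppath s).
Proof.
elim: s => [|x s IH] /=; first by apply: ReflectT.
apply: (iffP andP) => [[/(all_nthP x0) h1 /IH h2] [|i] [|j] //=|h].
- move=> _ hj hs; have := h1 j; rewrite size_take_min nth_take; last by lia.
  by apply; lia.
- by move=> *; apply: h2; lia.
split; last by apply/IH => i j *; apply: (h i.+1 j.+1); lia.
apply/(all_nthP x0) => i; rewrite size_take_min => hi.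
rewrite nth_take; last by lia.
by apply: (h 0 i.+1); lia.
Qed.

Lemma all_take_insert (p : pred T) k (s1 s2 : seq T) v :
  p v -> all p (take k (s1 ++ s2)) -> all p (take k (s1 ++ v :: s2)).
Proof.
move=> pv; elim: s1 k => [|x s1 IH] [|k] //=; last by case/andP=> -> /IH.
rewrite pv /=; case: s2 => // y s2; case: k => //= k /andP[-> /=].
by elim: s2 k => [|z s2 IH2] [|k] //= /andP[-> /IH2].
Qed.

(** Insertion only moves the other entries further apart, so the only new adjacencies are those of
    [v]. Absorbing a vertex is such an insertion. *)
Lemma ppath_insert (s1 s2 : seq T) v :
  all (fun x => e x v) s1 -> all (e v) s2 ->
  ppath (s1 ++ s2) -> ppath (s1 ++ v :: s2).
Proof.
move=> + h2; elim: s1 => [|x s1 IH] /=.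
  by move=> _ ->; rewrite andbT; apply/allP => y /mem_take /(allP h2).
case/andP=> hx h1 /andP[h3 h4]; rewrite IH // andbT.
exact: all_take_insert.
Qed.

Lemma ppath_rcons (s : seq T) x :
  ppath s -> all (fun y => e y x) (drop (size s - l) s) -> ppath (rcons s x).
Proof.
elim: s => [|y s IH] //= /andP[h1 h2] h3.
have [hs|hs] := leqP l (size s).
  rewrite IH //; last by move: h3; rewrite subSn.
  by rewrite -cats1 takel_cat // h1.
move: h3; rewrite (eqP (_ : (size s).+1 - l == 0)) /=; last by lia.
case/andP=> h3 h4; rewrite IH //; last first.
  by rewrite (eqP (_ : size s - l == 0)) ?drop0 //; lia.
rewrite andbT take_oversize ?size_rcons // all_rcons h3.
by rewrite take_oversize // in h1; lia.
Qed.

End PowerPath.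

Lemma sub_ppath (T : eqType) l (e e' : rel T) (s : seq T) :
  subrel e e' -> ppath l e s -> ppath l e' s.
Proof.
move=> h; elim: s => [|x s IH] //= /andP[h1 /IH ->]; rewrite andbT.
by apply/allP => y /(allP h1) /h.
Qed.

(** * Power paths selected vertex by vertex from prescribed sets *)

Section Selection.
Variables (T : finType) (l : nat) (e : rel T).

Definition cand (J : {set T}) (z : seq T) : {set T} :=
  [set x in J | (x \notin z) && all (e x) (take l z)].

(** Sequences grow from the last entry to the first: a new vertex goes in front, where it only has
    to see [take l z]. Every admissible sequence is listed once, so a uniform element of the list is
    a uniformly random selection. *)
Fixpoint sel (Js : seq {set T}) : seq (seq T) :=
  if Js is J :: Js' then [seq x :: z | z <- sel Js', x <- enum (cand J z)]
  else [:: [::]].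

Lemma sel_consP (J : {set T}) Js (z : seq T) :
  reflect (exists x z', [/\ z = x :: z', z' \in sel Js & x \in cand J z'])
    (z \in sel (J :: Js)).
Proof.
apply: (iffP allpairsPdep) => [[z' [x [h1 h2 ->]]]|[x [z' [-> h1 h2]]]].
  by exists x, z'; split; rewrite // -mem_enum.
by exists z', x; rewrite mem_enum.
Qed.

Lemma mem_sel Js z : z \in sel Js ->
  [/\ size z = size Js, uniq z, ppath l e z &
      forall x0 i, i < size Js -> nth x0 z i \in nth set0 Js i].
Proof.
elim: Js z => [|J Js IH] z; first by rewrite inE => /eqP->.
case/sel_consP=> x [z' [-> /IH [h1 h2 h3 h4]]].
rewrite inE => /and3P[hx hn ha] /=; rewrite h1 h2 h3 hn ha.
by split=> // x0 [|i] //= hi; apply: h4.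
Qed.

Lemma size_sel (k : {set T} -> nat) (Js : seq {set T}) :
  (forall (J : {set T}) (z : seq T), J \in Js -> size z < size Js -> uniq z ->
     {in z, forall y, exists2 J' : {set T}, J' \in Js & y \in J'} -> k J <= #|cand J z|) ->
  \prod_(J <- Js) k J <= size (sel Js).
Proof.
elim: Js => [|J Js IH] h; first by rewrite big_nil.
rewrite big_cons /= size_allpairs_dep sumnE big_map mulnC.
apply: (@leq_trans (\sum_(z <- sel Js) k J)).
  rewrite big_const_seq count_predT iter_addn_0 mulnC leq_mul2l IH ?orbT // => J' z hJ hz hu hi.
  apply: h => //; first by rewrite inE hJ orbT.
    by rewrite ltnW.
  by move=> y /hi [J'' h1 h2]; exists J''; rewrite // inE h1 orbT.
rewrite !(big_seq_cond predT) /=.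
apply: leq_sum => z /andP[/mem_sel [h1 h2 h3 h4] _].
rewrite -cardE; apply: h => //; rewrite ?inE ?eqxx ?h1 //.
move=> y hy; have := h4 y (index y z); rewrite -h1 index_mem nth_index // => /(_ hy) hh.
exists (nth set0 Js (index y z)); last exact: hh.
by rewrite inE mem_nth ?orbT // -h1 index_mem.
Qed.

(** A position in [D] leaves at most one choice, any other at most its whole set. Divided by the
    lower bound for the number of selections, this gives the spread of a random one. *)
Lemma count_sel x0 (y : nat -> T) (D : pred nat) Js :
  count (fun z => [forall i : 'I_(size Js), D i ==> (nth x0 z i == y i)]) (sel Js)
  <= \prod_(i < size Js | ~~ D i) #|nth set0 Js i|.
Proof.
elim: Js y D => [|J Js IH] y D; first by rewrite big_ord0 (leq_trans (count_size _ _)).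
set P := (X in count X); set P' := fun z : seq T => [forall i : 'I_(size Js), 
  D i.+1 ==> (nth x0 z i == y i.+1)].
have PE x z : P (x :: z) = (D 0 ==> (x == y 0)) && P' z.
  apply/forallP/andP => [h|[h0 /forallP h] [[|i] hi] //=].
    split; first exact: (h ord0).
    by apply/forallP => i; have := h (lift ord0 i).
  by have := h (Ordinal (hi : i < size Js)).
have -> : count P (sel (J :: Js)) =
    \sum_(z <- sel Js | P' z) count (fun x => D 0 ==> (x == y 0)) (enum (cand J z)).
  rewrite /= -sum1_count big_mkcond big_allpairs_dep /=.
  rewrite [RHS]big_mkcond; apply: eq_bigr => z _; rewrite -big_mkcond /=.
  case: ifP => hz; last by rewrite big1 // => x; rewrite PE hz andbF.
  by rewrite -sum1_count; apply: eq_bigl => x; rewrite PE hz andbT.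
rewrite [leqRHS]big_mkcond [leqRHS]big_ord_recl /=.
set c := (if ~~ D 0 then #|J| else 1).
have hc z : count (fun x => D 0 ==> (x == y 0)) (enum (cand J z)) <= c.
  rewrite /c; case: (D 0) => /=.
    rewrite (eq_count (a2 := pred1 (y 0))) // count_uniq_mem ?enum_uniq //.
    by case: (_ \in _).
  rewrite (leq_trans (count_size _ _)) // -cardE subset_leq_card //.
  by apply/subsetP => x; rewrite inE => /andP[].
apply: (@leq_trans (c * count P' (sel Js))).
  rewrite -sum1_count big_distrr /= big_mkcond [leqRHS]big_mkcond /=.
  by apply: leq_sum => z _; case: ifP => // _; rewrite muln1.
rewrite leq_mul2l; apply/orP; right.
apply: leq_trans (IH (fun i => y i.+1) (fun i => D i.+1)) _.
by rewrite big_mkcond.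
Qed.

End Selection.

(** * Connecting cliques *)

Section Pattern.
Variable l : nat.

(* In a graph where any l + 1 vertices have linearly many common neighbours, every
   pattern embeds in which each new vertex has at most l + 1 earlier neighbours.
   It remains to find such a pattern with a power path between two cliques.
   Labels below l stand for the starting clique, labels in [l, 2l) for the
   target clique; label 2l + i is a new vertex whose earlier neighbours are
   listed in entry i of the pattern. *)
Definition back (P : seq (seq nat)) (x : nat) : seq nat :=
  if x < l.*2 then [::] else nth [::] P (x - l.*2).

Definition padj (P : seq (seq nat)) : rel nat := fun x y =>
  (x != y) && [|| (x < l) && (y < l), (l <= x < l.*2) && (l <= y < l.*2),
                  x \in back P y | y \in back P x].

Definition wf_pattern (P : seq (seq nat)) : Prop := forall i, i < size P ->
  size (nth [::] P i) <= l.+1 /\ all (fun x => x < l.*2 + i) (nth [::] P i).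

Definition new_label (P : seq (seq nat)) x := l.*2 <= x < l.*2 + size P.

Lemma padj_sym P : symmetric (padj P).
Proof.
move=> x y; rewrite /padj eq_sym; congr andb.
by rewrite (andbC (x < l)) (andbC (l <= x < _)) (orbC (x \in _)).
Qed.

Lemma padj_ext P Q : subrel (padj P) (padj (P ++ Q)).
Proof.
move=> x y /andP[h1 h2]; rewrite /padj h1 /=.
have hb z t : z \in back P t -> z \in back (P ++ Q) t.
  by rewrite /back; case: ifP => // _; rewrite nth_cat; case: ltnP => // h; rewrite nth_default.
by case/or4P: h2 => [->|->|/hb ->|/hb ->]; rewrite ?orbT.
Qed.

Lemma new_label_ext P Q x : new_label P x -> new_label (P ++ Q) x.
Proof. rewrite /new_label size_cat; lia. Qed.

Lemma wf_pattern_rcons P js : wf_pattern P -> size js <= l.+1 ->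
  all (fun x => x < l.*2 + size P) js -> wf_pattern (rcons P js).
Proof.
move=> hP h1 h2 i; rewrite size_rcons ltnS leq_eqVlt nth_rcons.
by case: ltnP => [hi _|hi]; [apply: hP|rewrite orbF => /eqP ->; rewrite eqxx].
Qed.

Lemma padj_rcons P js x : all (fun x => x < l.*2 + size P) js -> x \in js ->
  padj (rcons P js) x (l.*2 + size P).
Proof.
move=> h hx; have hlt := allP h _ hx; rewrite /padj /back neq_ltn hlt /=.
rewrite [l.*2 + size P < l.*2]ltnNge leq_addr /= addKn nth_rcons ltnn eqxx hx.
by rewrite !orbT.
Qed.

Lemma new_label_rcons P js : new_label (rcons P js) (l.*2 + size P).
Proof. rewrite /new_label size_rcons; lia. Qed.

Lemma ppath_clique P (K : seq nat) i j : ppath l (padj P) K -> size K <= l.+1 ->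
  i < size K -> j < size K -> i != j -> padj P (nth 0 K i) (nth 0 K j).
Proof.
move=> /(ppathP _ _ 0) h hs hi hj; case: ltngtP => // hij _; first by apply: h => //; lia.
by rewrite padj_sym; apply: h => //; lia.
Qed.

(** State of a walk that has left the starting clique and now occupies the clique [K]. Labels may
    recur in [s ++ K]: only adjacency in the pattern counts here, and different vertices for equal
    labels come from the blow-up. *)
Definition reach P s K := [/\ wf_pattern P, size K = l.+1,
  all (new_label P) (s ++ K) & ppath l (padj P) (iota 0 l ++ s ++ K)].

Lemma reach_start P : wf_pattern P -> exists Q K, reach (P ++ Q) [::] K.
Proof.
move=> hP.
have [Q [K [h1 h2 h3 h4]]] : exists Q K, [/\ wf_pattern (P ++ Q), size K = l.+1,
    all (new_label (P ++ Q)) K & ppath l (padj (P ++ Q)) (iota 0 l ++ K)].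
  elim: (l.+1) => [|j [Q [K [h1 h2 h3 h4]]]].
    exists [::], [::]; split; rewrite ?cats0 //.
    apply/(ppathP _ _ 0) => i j ij _; rewrite size_iota => hj.
    by rewrite !nth_iota; [rewrite /padj; lia|lia|lia].
  pose s := iota 0 l ++ K; pose js := drop (size s - l) s.
  have hs : all (fun x => x < l.*2 + size (P ++ Q)) s.
    rewrite all_cat; apply/andP; split.
      by apply/allP => x; rewrite mem_iota; lia.
    by apply/allP => x /(allP h3) /andP[].
  have hjs : all (fun x => x < l.*2 + size (P ++ Q)) js.
    by apply/allP => x /mem_drop; apply: (allP hs).
  exists (rcons Q js), (rcons K (l.*2 + size (P ++ Q))); rewrite -rcons_cat; split.
  - by apply: wf_pattern_rcons => //; rewrite size_drop; lia.
  - by rewrite size_rcons h2.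
  - rewrite all_rcons new_label_rcons /=; apply/allP => x /(allP h3).
    by rewrite -cats1; apply: new_label_ext.
  rewrite -rcons_cat; apply: ppath_rcons.
    by move: h4; apply: sub_ppath; rewrite -cats1; apply: padj_ext.
  by apply/allP => x hx; apply: padj_rcons.
by exists Q, K.
Qed.

(** A label of the target clique stands for one vertex, so the walk cannot run through that clique
    repeatedly. It aims at the new labels [t] in front of it instead; they are built backwards, each
    joined to the [l] entries after it. *)
Lemma target_pattern : exists P t, [/\ wf_pattern P, size t = l,
  all (new_label P) t & ppath l (padj P) (t ++ iota l l)].
Proof.
suff H j : exists P t, [/\ wf_pattern P, size t = j,
    all (new_label P) t & ppath l (padj P) (t ++ iota l l)] by exact: H.
elim: j => [|j [P [t [h1 h2 h3 h4]]]].
  exists [::], [::]; split=> //; apply/(ppathP _ _ 0) => i j ij _.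
  rewrite size_iota => hj; rewrite !nth_iota; [rewrite /padj; lia|lia|lia].
pose s := t ++ iota l l; pose js := take l s.
have hs : all (fun x => x < l.*2 + size P) s.
  rewrite all_cat; apply/andP; split; last by apply/allP => x; rewrite mem_iota; lia.
  by apply/allP => x /(allP h3) /andP[].
have hjs : all (fun x => x < l.*2 + size P) js.
  by apply/allP => x /mem_take; apply: (allP hs).
exists (rcons P js), (l.*2 + size P :: t); split.
- by apply: wf_pattern_rcons => //; rewrite size_take_min; lia.
- by rewrite /= h2.
- rewrite /= new_label_rcons /=; apply/allP => x /(allP h3).
  by rewrite -cats1; apply: new_label_ext.
rewrite /=; apply/andP; split.
  by apply/allP => x hx; rewrite padj_sym; apply: padj_rcons.
by move: h4; apply: sub_ppath; rewrite -cats1; apply: padj_ext.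
Qed.

(* Along a sequence of period l + 1 each entry sees exactly the other l slots,
   so one slot of the clique K may be changed on each turn. *)
Lemma reach_update P s K i y : reach P s K -> i <= l -> new_label P y ->
  (forall m, m <= l -> m != i -> padj P (nth 0 K m) y) ->
  reach P (s ++ K) (set_nth 0 K i y).
Proof.
move=> [h1 h2 h3 h4] hi hy hK.
have hsz : size (set_nth 0 K i y) = l.+1 by rewrite size_set_nth; lia.
split=> //.
  rewrite all_cat h3 /=; apply/(all_nthP 0) => m; rewrite hsz nth_set_nth /= => hm.
  case: eqP => // _; move: h3; rewrite all_cat => /andP[_ /(all_nthP 0)]; apply; lia.
rewrite -catA catA; apply: ppath_glue; rewrite -?catA ?h2 //.
have hKp : ppath l (padj P) K by move: h4; rewrite catA => /ppath_cat /andP[].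
have cl p q : p < l.+1 -> q < l.+1 -> p != q -> padj P (nth 0 K p) (nth 0 K q).
  by move=> ? ? ?; apply: ppath_clique; rewrite ?h2.
apply/(ppathP _ _ 0) => p q pq hq; rewrite size_cat h2 hsz => hq2.
rewrite !nth_cat h2; case: (ltnP q) => hql.
  by rewrite (ltn_trans pq hql); apply: cl => //; lia.
case: (ltnP p) => hpl; rewrite !nth_set_nth /=; last first.
  case: eqP => [ep|np]; case: eqP => [eq|nq]; try lia.
  - by rewrite padj_sym; apply: hK; lia.
  - by apply: hK; lia.
  - by apply: cl; lia.
by case: eqP => [eq|nq]; [apply: hK|apply: cl]; lia.
Qed.

(** The new vertex is joined to [tau] and to the [l] entries of [K] outside slot [i], which exhausts
    the [l.+1] earlier neighbours allowed to a label. *)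
Lemma reach_new P s K i tau : reach P s K -> i <= l -> new_label P tau ->
  exists Q s' n, reach (P ++ Q) s' (set_nth 0 K i n) /\ padj (P ++ Q) tau n.
Proof.
move=> [h1 h2 h3 h4] hi ht.
pose js := tau :: take i K ++ drop i.+1 K.
have hjs : all (fun x => x < l.*2 + size P) js.
  case/andP: (ht) => _ /= ->; move: h3; rewrite all_cat => /andP[_ h3].
  apply/allP => x; rewrite mem_cat => /orP[/mem_take|/mem_drop] /(allP h3) /andP[] //.
exists [:: js], (s ++ K), (l.*2 + size P); rewrite cats1; split.
  apply: reach_update => //.
  - split=> //.
    + apply: wf_pattern_rcons => //=; rewrite size_cat size_takel ?size_drop; lia.
    + by apply/allP => x /(allP h3); rewrite -cats1; apply: new_label_ext.
    + by move: h4; apply: sub_ppath; rewrite -cats1; apply: padj_ext.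
  - exact: new_label_rcons.
  move=> m hm hmi; apply: padj_rcons => //; rewrite inE mem_cat.
  case: (ltnP m i) => hmi2.
    have -> : nth 0 K m \in take i K by rewrite -(nth_take _ hmi2) mem_nth // size_take_min h2; lia.
    by rewrite orbT.
  have -> : nth 0 K m \in drop i.+1 K.
    have hd : m - i.+1 < size (drop i.+1 K) by rewrite size_drop h2; lia.
    by have := mem_nth 0 hd; rewrite nth_drop subnKC //; lia.
  by rewrite !orbT.
by apply: padj_rcons => //; rewrite inE eqxx.
Qed.

(** Prepares slot [j] for [tau]: the slots after [j] are replaced, one at a time, by neighbours of
    [tau], and the slots up to [j] stay. *)
Lemma reach_inner P s K j tau r : reach P s K -> new_label P tau -> r <= l.+1 ->
  exists Q s' K', [/\ reach (P ++ Q) s' K',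
    forall m, m <= j -> nth 0 K' m = nth 0 K m &
    forall m, j < m < r -> padj (P ++ Q) tau (nth 0 K' m)].
Proof.
move=> hR ht; elim: r => [|r IH] hr.
  by exists [::], s, K; rewrite cats0; split=> // m; rewrite ltn0 andbF.
have [Q [s' [K' [h1 h2 h3]]]] := IH (ltnW hr).
have [hrj|hrj] := leqP r j.
  by exists Q, s', K'; split=> // m hm; apply: h3; lia.
have [Q' [s2 [n [h4 h5]]]] := reach_new h1 hr (new_label_ext Q ht).
exists (Q ++ Q'), s2, (set_nth 0 K' r n); rewrite catA; split=> // m hm.
  by rewrite nth_set_nth /=; case: eqP => [?|_]; [lia|apply: h2].
rewrite nth_set_nth /=; case: eqP => // hmr; apply: padj_ext; apply: h3; lia.
Qed.

(** The slots of [K] are overwritten by the entries of [t] in turn. When entry [j] is due, the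
    earlier slots hold entries of the clique [t] already, and [reach_inner] has made the later slots
    adjacent to it. *)
Lemma pattern_walk : exists P w, [/\ wf_pattern P, all (new_label P) w &
  ppath l (padj P) (iota 0 l ++ w ++ iota l l)].
Proof.
have [P0 [t [w0 ht ta tp]]] := target_pattern.
have [P [s [K [hR hK]]]] : exists Q s K, reach (P0 ++ Q) s K /\
    forall m, m < l -> nth 0 K m = nth 0 t m.
  suff H j : j <= l -> exists Q s K, reach (P0 ++ Q) s K /\
      forall m, m < j -> nth 0 K m = nth 0 t m by exact: H.
  elim: j => [_|j IH hj].
    by have [Q [K h]] := reach_start w0; exists Q, [::], K.
  have [Q [s [K [hR hK]]]] := IH (ltnW hj).
  have hn : new_label (P0 ++ Q) (nth 0 t j).
    by apply/new_label_ext/(allP ta)/mem_nth; rewrite ht.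
  have [Q' [s' [K' [h1 h2 h3]]]] := reach_inner j hR hn (leqnn _).
  exists (Q ++ Q'), (s' ++ K'), (set_nth 0 K' j (nth 0 t j)); rewrite catA.
  split.
    apply: reach_update => //; [exact: ltnW|exact: new_label_ext|].
    move=> m hm hmj; have [hmj2|hmj2] := leqP m j; last by rewrite padj_sym; apply: h3; lia.
    rewrite h2 // hK; last by lia.
    rewrite -catA; apply: padj_ext; apply: ppath_clique; rewrite ?ht //; try lia.
    by case/ppath_cat/andP: tp.
  move=> m; rewrite nth_set_nth /= => hm; case: eqP => [->//|hmj].
  by rewrite h2 ?hK //; lia.
have := hR => -[h1 h2 h3 h4].
have ht' : take l K = t.
  apply: (@eq_from_nth _ 0) => [|i]; rewrite size_takel ?ht ?h2 // => hi.
  by rewrite nth_take // hK.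
have hl : new_label (P0 ++ P) (nth 0 K l).
  by move: h3; rewrite all_cat => /andP[_ /allP]; apply; rewrite mem_nth // h2.
(* Writing slot [l] over itself yields one more lap, whose first [l] entries are [t]; its last entry
   is then cut off. *)
have [] := reach_update hR (leqnn l) hl.
  move=> m hm hml; apply: ppath_clique; rewrite ?h2 //.
  by move: h4; rewrite catA => /ppath_cat/andP[].
move=> _ _ _; have -> : set_nth 0 K l (nth 0 K l) = t ++ [:: nth 0 K l].
  apply: (@eq_from_nth _ 0) => [|i]; rewrite size_set_nth h2 maxnn.
    by rewrite size_cat ht addn1.
  rewrite ltnS leq_eqVlt nth_set_nth /= nth_cat ht => /orP[/eqP ->|hi].
    by rewrite eqxx ltnn subnn.
  by rewrite (ltn_eqF hi) hi hK.
rewrite -!catA !catA => /ppath_cat /andP[hp _].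
exists (P0 ++ P), ((s ++ K) ++ t); split=> //.
  rewrite !all_cat; move: h3; rewrite all_cat => /andP[-> ->] /=.
  by apply/allP => x /(allP ta); apply: new_label_ext.
rewrite -catA catA; apply: ppath_glue; rewrite ?ht //.
  by rewrite !catA.
by move: tp; apply: sub_ppath; apply: padj_ext.
Qed.

End Pattern.

Definition common (T : finType) (e : rel T) (W : {set T}) (xs : seq T) : {set T} :=
  [set w in W | all (e w) xs].

(** * Blow-ups of a pattern *)

Section Blowup.
Variable l : nat.

Lemma back_rcons P js x : x < l.*2 + size P -> back l (rcons P js) x = back l P x.
Proof. by move=> hx; rewrite /back; case: ltnP => // h; rewrite nth_rcons ifT //; lia. Qed.

Lemma padj_rcons_old P js x y : x < l.*2 + size P -> y < l.*2 + size P ->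
  padj l (rcons P js) x y -> padj l P x y.
Proof. by move=> hx hy; rewrite /padj !back_rcons. Qed.

Lemma padj_rcons_new P js x : wf_pattern l (rcons P js) -> x < l.*2 + size P ->
  padj l (rcons P js) x (l.*2 + size P) -> x \in js.
Proof.
move=> hP hx /andP[_] /or4P[| |h|]; [lia|lia| |].
  by move: h; rewrite /back ifF ?addKn ?nth_rcons ?ltnn ?eqxx //; lia.
rewrite /back; case: ltnP => // hx2; rewrite nth_rcons ifT; last by lia.
have /hP [_ /allP] : x - l.*2 < size (rcons P js) by rewrite size_rcons; lia.
by rewrite nth_rcons ifT; [move=> h /h; lia|lia].
Qed.

(* Every diagonal copy c of the back-neighbourhood has many common neighbours,
   so many vertices w see at least t of the t' diagonals; by pigeonhole many of
   them see the same ones. *)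
Lemma blowup_step (T : finType) (e : rel T) (W U : {set T}) (u : nat -> nat -> T)
    js t h k : 0 < t -> 0 < h ->
  2 * h * 2 ^ (2 * h * t) * (t + k) < #|W| -> #|U| <= k ->
  (forall c, c < 2 * h * t -> #|W| <= h * #|common e W [seq u j c | j <- js]|) ->
  exists (C : {set 'I_(2 * h * t)}) (V : {set T}), [/\ t <= #|C|, t <= #|V|,
    V \subset W :\: U & forall w c, w \in V -> c \in C -> all (fun j => e w (u j c)) js].
Proof.
set t' := 2 * h * t => t0 h0 hW hU hc.
pose Cw w : {set 'I_t'} := [set c : 'I_t' | all (fun j => e w (u j c)) js].
have [C hC]: exists C : {set 'I_t'}, (t <= #|C|) && (t + k <= #|[set w in W | Cw w == C]|).
  apply/existsP; apply: contraLR hW; rewrite negb_exists -leqNgt => /forallP hn.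
  have h1 : t' * #|W| <= h * \sum_(w in W) #|Cw w|.
    rewrite (eq_bigr (fun w => \sum_(c < t') all (fun j => e w (u j c)) js)); last first.
      by move=> w _; rewrite -sum1dep_card big_mkcond; apply: eq_bigr => c _; case: (all _ _).
    rewrite exchange_big /= big_distrr /= -[t' in leqLHS]card_ord -sum_nat_const.
    apply: leq_sum => c _; apply: leq_trans (hc c (ltn_ord c)) _; rewrite leq_mul2l.
    apply/orP; right; rewrite -sum1_card (eq_bigl (fun w => (w \in W) && all (fun j => e w (u j c)) js)).
      by rewrite big_mkcondr /=; apply: leq_sum => w _; case: (all _ _).
    by move=> w; rewrite inE all_map.
  have h2 : \sum_(w in W) #|Cw w| <= #|W| * t + t' * (2 ^ t' * (t + k)).
    rewrite -sum_nat_const.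
    apply: (@leq_trans (\sum_(w in W) t + \sum_(w in W | t <= #|Cw w|) t')).
      rewrite [X in _ + X]big_mkcondr -big_split /=; apply: leq_sum => w _.
      case: (leqP t #|Cw w|) => hw; last by rewrite addn0 ltnW.
      by rewrite (leq_trans (max_card _)) // card_ord leq_addl.
    rewrite leq_add2l sum_nat_const mulnC leq_mul2l; apply/orP; right.
    have -> : 2 ^ t' = #|powerset [set: 'I_t']| by rewrite card_powerset cardsT card_ord.
    rewrite -sum_nat_const -sum1_card /=.
    rewrite (partition_big Cw (fun C => C \in powerset setT)) /=; last by move=> *; rewrite inE subsetT.
    apply: leq_sum => C _; rewrite sum1_card.
    case: (leqP t #|C|) => hC; last first.
      rewrite eq_card0 // => w; rewrite !inE; apply/negbTE; apply/negP.
      by case/andP=> /andP[_ +] /eqP hCw; rewrite hCw leqNgt hC.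
    have := hn C; rewrite hC /= -ltnNge => /ltnW; apply: leq_trans.
    by apply: subset_leq_card; apply/subsetP => w; rewrite !inE => /andP[/andP[-> _] ->].
  (* With [t' = 2 * h * t], the term [h * #|W| * t] is half of [t' * #|W|]; what remains bounds
     [#|W|] by [2 * h * 2 ^ t' * (t + k)]. *)
  move: h1 h2; rewrite /t'; nia.
case/andP: hC => hC1 hC2.
exists C, ([set w in W | Cw w == C] :\: U); split=> //.
- rewrite cardsD; set A := [set _ in W | _] in hC2 *.
  by have := subset_leq_card (subsetIr A U); lia.
- by apply/subsetP => w; rewrite !inE => /andP[-> /andP[->]].
by move=> w c; rewrite !inE => /andP[_ /andP[_ /eqP <-]]; rewrite inE.
Qed.

(** A label met several times by the walk needs as many vertices, hence [t] copies of each new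
    label, completely joined along the pattern. For the last label, [2 * h * t] copies of the
    earlier ones are taken and [blowup_step] selects the copies to keep; the vertices of the two
    given cliques are not multiplied. *)
Lemma blowup P : wf_pattern l P -> forall t h, 0 < t -> 0 < h -> exists N0,
  forall (T : finType) (e : rel T) (W : {set T}) (a b : seq T) (x0 : T),
  symmetric e -> size a = l -> size b = l -> ppath l e a -> ppath l e b ->
  N0 <= #|W| ->
  (forall xs, size xs <= l.+1 -> {subset xs <= [predU mem W & mem (a ++ b)]} ->
     #|W| <= h * #|common e W xs|) ->
  exists u : nat -> nat -> T, [/\
    forall x c, x < l -> u x c = nth x0 a x,
    forall x c, l <= x < l.*2 -> u x c = nth x0 b (x - l),
    forall x c, new_label l P x -> c < t -> u x c \in W,
    forall x y c d, new_label l P x -> new_label l P y -> c < t -> d < t ->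
      u x c = u y d -> x = y /\ c = d &
    forall x y c d, x < l.*2 + size P -> y < l.*2 + size P -> c < t -> d < t ->
      padj l P x y -> e (u x c) (u y d)].
Proof.
elim/last_ind: P => [|P js IH] hP t h t0 h0.
  exists 0 => T e W a b x0 es sa sb pa pb _ _.
  have cl s x y : size s = l -> ppath l e s -> x < l -> y < l -> x != y ->
      e (nth x0 s x) (nth x0 s y).
    move=> ss /(ppathP _ _ x0) ps hx hy; case: ltngtP => // hxy _; last by rewrite es; apply: ps; lia.
    by apply: ps; lia.
  exists (fun x _ => if x < l then nth x0 a x else nth x0 b (x - l)); split.
  - by move=> x _ ->.
  - by move=> x _ /andP[hx _]; rewrite ltnNge hx.
  - by move=> x c; rewrite /new_label /=; lia.
  - by move=> x y c d; rewrite /new_label /=; lia.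
  move=> x y c d; rewrite addn0 => hx hy _ _ /andP[hxy].
  rewrite /back !hx !hy; case/or4P => // /andP[].
    by move=> h1 h2; rewrite h1 h2; apply: cl.
  move=> /andP[h1 _] /andP[h2 _]; rewrite !ltnNge h1 h2; apply: cl => //; lia.
have hP' : wf_pattern l P.
  move=> i hi; have /hP : i < size (rcons P js) by rewrite size_rcons ltnW.
  by rewrite nth_rcons hi.
have t'0 : 0 < 2 * h * t by rewrite !muln_gt0 h0 t0.
have [N0 hN0] := IH hP' _ h t'0 h0; set t' := 2 * h * t in t'0 hN0 *.
exists (maxn N0 (2 * h * 2 ^ t' * (t + size P * t')).+1).
move=> T e W a b x0 es sa sb pa pb; rewrite geq_max => /andP[hW1 hW2] hcom.
have [u [u1 u2 u3 u4 u5]] := hN0 T e W a b x0 es sa sb pa pb hW1 hcom.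
pose U := [set u (l.*2 + p.1) p.2 | p : 'I_(size P) * 'I_t'].
have hU : #|U| <= size P * t'.
  by rewrite (leq_trans (leq_imset_card _ _)) // card_prod !card_ord.
have [hjs1 hjs2] : size js <= l.+1 /\ all (fun x => x < l.*2 + size P) js.
  have /hP : size P < size (rcons P js) by rewrite size_rcons.
  by rewrite nth_rcons ltnn eqxx.
have uW x c : x < l.*2 + size P -> c < t' -> u x c \in [predU mem W & mem (a ++ b)].
  move=> hx hc; rewrite inE /= mem_cat; case: (ltnP x l) => h1.
    by rewrite u1 // mem_nth ?sa // orbT.
  case: (ltnP x l.*2) => h2; last by rewrite u3 // /new_label h2.
  by rewrite u2 ?h1 // mem_nth ?orbT // sb; lia.
have [|C [V [hC hV hVW hCV]]] := @blowup_step T e W U u js t h (size P * t') t0 h0 hW2 hU.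
  move=> c hc; apply: hcom; first by rewrite size_map.
  by move=> _ /mapP[j hj ->]; apply: uW => //; apply: (allP hjs2).
(* Renumbers the diagonals kept in [C], so that copy [c] of an old label becomes its copy [io c]. *)
pose io c := nth 0 (map val (enum C)) c.
have io_inj c d : c < t -> d < t -> io c = io d -> c = d.
  move=> hc hd /eqP; rewrite nth_uniq ?size_map -?cardE ?(leq_trans hc) ?(leq_trans hd) //.
    by move/eqP.
  by rewrite map_inj_uniq ?enum_uniq //; apply: val_inj.
have ioC c : c < t -> exists2 c' : 'I_t', c' \in C & io c = c'.
  move=> hc; have := mem_nth 0 (_ : c < size (map val (enum C))).
  rewrite size_map -cardE => /(_ (leq_trans hc hC)) /mapP[c' h1 h2].
  by exists c' => //; rewrite -mem_enum.
have iot c : c < t -> io c < t' by move=> /ioC [c' _ ->].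
have Vc c : c < t -> nth x0 (enum V) c \in V.
  by move=> hc; rewrite -mem_enum mem_nth // -cardE (leq_trans hc).
pose n := l.*2 + size P.
have new x : new_label l (rcons P js) x -> x != n -> new_label l P x.
  by rewrite /new_label size_rcons /n; lia.
have uU x c : new_label l P x -> c < t' -> u x c \in U.
  move=> hx hc; have hxP : x - l.*2 < size P by move: hx; rewrite /new_label; lia.
  apply/imsetP; exists (Ordinal hxP, Ordinal hc) => //=.
  by rewrite subnKC //; case/andP: hx.
have uV x c d : new_label l P x -> c < t -> d < t -> u x (io c) <> nth x0 (enum V) d.
  move=> hx hc hd h1; have := subsetP hVW _ (Vc _ hd).
  by rewrite inE -h1 uU // iot.
exists (fun x c => if x == n then nth x0 (enum V) c else u x (io c)); split.
- by move=> x c hx; rewrite ltn_eqF ?u1 // /n; lia.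
- by move=> x c hx; rewrite ltn_eqF ?u2 // /n; lia.
- move=> x c hx hc; case: eqP => [_|/eqP hxn]; last by apply: u3; [apply: new|apply: iot].
  by have /(subsetP hVW) := Vc _ hc; rewrite inE => /andP[].
- move=> x y c d hx hy hc hd; case: eqP => [->|/eqP hxn]; case: eqP => [->|/eqP hyn].
  + move/eqP; rewrite nth_uniq ?enum_uniq // -?cardE ?(leq_trans hc) ?(leq_trans hd) //.
    by move/eqP.
  + by move/esym/uV => h1; case: h1 => //; apply: new.
  + by move/uV => h1; case: h1 => //; apply: new.
  by case/u4; rewrite ?iot ?new // => -> /io_inj ->.
move=> x y c d; rewrite size_rcons !addnS !ltnS => hx hy hc hd hxy.
have hVe z p q : z \in js -> p < t -> q < t -> e (nth x0 (enum V) q) (u z (io p)).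
  move=> hz /ioC [c' hc' ->] hq; exact: (allP (hCV _ _ (Vc _ hq) hc')).
case: eqP => [xn|/eqP xn]; case: eqP => [yn|/eqP yn].
- by move: hxy; rewrite xn yn /padj eqxx.
- have hyP : y < l.*2 + size P by rewrite ltn_neqAle yn.
  by apply: hVe => //; apply: (padj_rcons_new hP hyP); rewrite padj_sym -/n -xn.
- have hxP : x < l.*2 + size P by rewrite ltn_neqAle xn.
  by rewrite es; apply: hVe => //; apply: (padj_rcons_new hP hxP); rewrite -/n -yn.
have hxP : x < l.*2 + size P by rewrite ltn_neqAle xn.
have hyP : y < l.*2 + size P by rewrite ltn_neqAle yn.
by apply: u5; rewrite ?iot //; apply: padj_rcons_old hxy.
Qed.

Lemma connect_cliques h : 0 < h -> exists L N0,
  forall (T : finType) (e : rel T) (W : {set T}) (a b : seq T),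
  symmetric e -> size a = l -> size b = l -> ppath l e a -> ppath l e b ->
  N0 <= #|W| ->
  (forall xs, size xs <= l.+1 -> {subset xs <= [predU mem W & mem (a ++ b)]} ->
     #|W| <= h * #|common e W xs|) ->
  exists w, [/\ size w = L, uniq w, {subset w <= W} & ppath l e (a ++ w ++ b)].
Proof.
move=> h0; have [P [w [hP hw pw]]] := pattern_walk l.
have [N0 hN] := blowup hP (ltn0Sn (size w)) h0.
exists (size w), N0.+1 => T e W a b es sa sb pa pb hW hcom.
have [x0 _] : exists x0, x0 \in W by apply/card_gt0P; lia.
have [u [u1 u2 u3 u4 u5]] := hN T e W a b x0 es sa sb pa pb (ltnW hW) hcom.
(* Entry [i] of the walk takes copy [i] of its label, so the entries differ even where labels
   recur. *)
pose p := mkseq (fun i => u (nth 0 w i) i) (size w).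
have wl i : i < size w -> new_label l P (nth 0 w i) by move=> hi; apply: (allP hw); rewrite mem_nth.
exists p; split; first by rewrite size_mkseq.
- apply/(uniqP x0) => i j; rewrite !inE size_mkseq => hi hj; rewrite !nth_mkseq //.
  by case/u4 => //; [exact: wl|exact: wl|lia|lia].
- by move=> x /(nthP x0) [i]; rewrite size_mkseq => hi <-; rewrite nth_mkseq // u3 ?wl // ltnS ltnW.
pose lab := iota 0 l ++ w ++ iota l l.
(* The vertices of [a] and [b] are read with copy index 0; the request for [(size w).+1] copies
   makes this index legal even for an empty walk. *)
pose cp k := if l <= k < l + size w then k - l else 0.
have cpw k : cp k < (size w).+1 by rewrite /cp; case: ifP; lia.
have szl : size lab = size (a ++ p ++ b).
  by rewrite !size_cat !size_iota size_mkseq sa sb.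
have nthE k : k < size lab ->
    nth x0 (a ++ p ++ b) k = u (nth 0 lab k) (cp k) /\ nth 0 lab k < l.*2 + size P.
  rewrite /lab !size_cat !size_iota => hk; rewrite !nth_cat sa !size_iota /cp.
  case: (ltnP k l) => h1; first by rewrite nth_iota // add0n u1 //; split=> //; lia.
  rewrite size_mkseq /=; case: ltnP => h2.
    rewrite ifT; last by lia.
    by rewrite nth_mkseq //; split=> //; have /andP[] := wl _ h2.
  by rewrite nth_iota; [rewrite u2 ?addKn; [split=> //; lia|lia]|lia].
apply/(ppathP _ _ x0) => i j ij jl; rewrite -szl => hj.
have [|-> hi1] := nthE i; first by lia.
have [-> hj1] := nthE j hj.
by apply: u5 => //; have /(ppathP _ _ 0) := pw; apply.
Qed.

End Blowup.

(** * Edges of a power cycle *)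

(** Adjacency of positions in the [l]th power of a cycle of length [n]: cyclic distance between 1
    and [l]. For [l < n] no position is near itself. *)
Definition near (n l a b : nat) : bool :=
  has (fun d => (b == (a + d) %% n) || (a == (b + d) %% n)) (iota 1 l).

Lemma near_sym n l : symmetric (near n l).
Proof. by move=> a b; apply: eq_has => d; rewrite orbC. Qed.

Lemma near_card n l a : a < n -> l < n -> #|[set b : 'I_n | near n l a b]| <= 2 * l.
Proof.
move=> an ln.
pose f (p : bool * 'I_l) : nat := if p.1 then (a + p.2.+1) %% n else (a + (n - p.2.+1)) %% n.
have n0 : 0 < n by apply: leq_ltn_trans ln.
pose g (p : bool * 'I_l) : 'I_n := Ordinal (ltn_pmod (if p.1 then a + p.2.+1 else a + (n - p.2.+1)) n0).
apply: (@leq_trans #|[set g p | p in [set: bool * 'I_l]]|); last first.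
  by apply: leq_trans (leq_imset_card _ _) _; rewrite cardsT card_prod card_bool card_ord.
apply: subset_leq_card; apply/subsetP => b; rewrite inE => /hasP[d].
rewrite mem_iota => /andP[d0 dl] /orP[/eqP hb|/eqP ha].
  have dl' : d.-1 < l by lia.
  apply/imsetP; exists (true, Ordinal dl') => //; apply: val_inj => /=.
  by rewrite prednK.
have dl' : d.-1 < l by lia.
apply/imsetP; exists (false, Ordinal dl') => //; apply: val_inj => /=.
rewrite prednK // ha modnDml -addnA subnKC; last by lia.
by rewrite modnDr modn_small.
Qed.

Lemma ex_least (P : pred nat) : (exists k, P k) ->
  exists k, P k /\ forall k', k' < k -> ~~ P k'.
Proof.
move=> h; case: (ex_minnP h) => k h1 h2; exists k; split=> // k' hk.
by apply: contraL hk => /h2; rewrite -leqNgt.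
Qed.

Section CyclicEdges.
Variables (T : finType) (l : nat) (x0 : T).

Definition cedges (c : seq T) : {set {set T}} :=
  [set E : {set T} | [exists u, exists v, (E == [set u; v]) && near #|T| l (index u c) (index v c)]].

Variable c : seq T.
Hypotheses (uc : uniq c) (cT : forall x, x \in c).

Let n := #|T|.

Lemma size_full : size c = n.
Proof. by rewrite /n -(card_uniqP uc); apply: eq_card => x; rewrite cT. Qed.

Let n0 : 0 < n. Proof. by apply/card_gt0P; exists x0. Qed.

Definition at_ (k : nat) : T := nth x0 c (k %% n).

Lemma index_at k : index (at_ k) c = k %% n.
Proof. by rewrite index_uniq // size_full ltn_pmod. Qed.

Lemma at_index x : at_ (index x c) = x.
Proof. by rewrite /at_ modn_small ?nth_index // -size_full index_mem. Qed.

Lemma index_lt x : index x c < n. Proof. by rewrite -size_full index_mem. Qed.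

Lemma at_mod k m : k = m %[mod n] -> at_ k = at_ m.
Proof. by rewrite /at_ => ->. Qed.

Variable U : {set T}.

Let fwd (u : T) : nat := #|[set d : 'I_l | at_ (index u c + d.+1) \in U]|.

Lemma fwd_le u : fwd u <= l.
Proof. by rewrite /fwd -[leqRHS]card_ord max_card. Qed.

(** Each edge is charged to the end from which it runs forwards, and [fwd] counts the forward edges
    of a vertex that stay in [U]. *)
Lemma edges_fwd : #|[set E in cedges c | E \subset U]| <= \sum_(u in U) fwd u.
Proof.
pose F := [set p : T * 'I_l | (p.1 \in U) && (at_ (index p.1 c + p.2.+1) \in U)].
have -> : \sum_(u in U) fwd u = #|F|.
  rewrite (eq_bigr (fun u => \sum_(d : 'I_l | at_ (index u c + d.+1) \in U) 1)).
    by rewrite pair_big_dep /= sum1dep_card.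
  by move=> u _; rewrite /fwd sum1dep_card.
pose f (p : T * 'I_l) := [set p.1; at_ (index p.1 c + p.2.+1)].
apply: leq_trans (leq_imset_card f F); apply: subset_leq_card; apply/subsetP => E.
rewrite !inE => /andP[/existsP[u /existsP[v /andP[/eqP -> /hasP[d]]]]].
rewrite subUset !sub1set mem_iota => /andP[d0 dl] h /andP[uU vU].
have dl' : d.-1 < l by lia.
case/orP: h => /eqP h.
  have av : at_ (index u c + d) = v by rewrite /at_ -h nth_index.
  apply/imsetP; exists (u, Ordinal dl'); rewrite /f ?inE /= prednK // av ?uU ?vU //.
have au : at_ (index v c + d) = u by rewrite /at_ -h nth_index.
apply/imsetP; exists (v, Ordinal dl'); rewrite /f ?inE /= prednK // au ?uU ?vU //.
by rewrite setUC.
Qed.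

Lemma fwd_pos u : 0 < fwd u -> exists d, [/\ 0 < d, d <= l & at_ (index u c + d) \in U].
Proof. by case/card_gt0P => d; rewrite inE => h; exists d.+1. Qed.

(** Otherwise every element of [U] is followed by another one within [l] steps. Going back from any
    vertex, the nearest element of [U] is then less than [l] steps away, so [U] shifted by 0, ..., l
    - 1 covers everything and [n <= l * #|U|]. *)
Lemma gap_exists : (exists u, u \in U) -> l * #|U| < n -> exists2 a, a \in U & fwd a = 0.
Proof.
move=> [b bU] hn; have [/existsP[a /andP[aU /eqP fa]]|] := boolP [exists a in U, fwd a == 0].
  by exists a.
rewrite negb_exists => /forallP hf; exfalso; move: hn; apply/negP; rewrite -leqNgt.
pose g (p : T * 'I_l) := at_ (index p.1 c + p.2).
have -> : l * #|U| = #|[set p : T * 'I_l | p.1 \in U]|.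
  rewrite mulnC -[l in LHS]card_ord -cardsT -cardsX; apply: eq_card => p.
  by rewrite !inE andbT.
apply: leq_trans (leq_imset_card g _); rewrite /n -cardsT; apply: subset_leq_card.
apply/subsetP => x _; set i := index x c; have il := index_lt x.
have [|k [/andP[kn kU] kmin]] := @ex_least (fun k => (k < n) && (at_ (i + (n - k)) \in U)).
  have bl := index_lt b; have [bi|bi] := leqP (index b c) i.
    exists (i - index b c); apply/andP; split; first by rewrite /i in bi *; lia.
    rewrite (_ : at_ _ = b) // -[RHS]at_index; apply: at_mod.
    have -> : i + (n - (i - index b c)) = index b c + n by rewrite /i in bi *; lia.
    by rewrite modnDr.
  exists (i + n - index b c); apply/andP; split; first by rewrite /i in bi *; lia.
  rewrite (_ : at_ _ = b) // -[RHS]at_index; apply: at_mod; congr (_ %% _).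
  by rewrite /i in bi *; lia.
set u := at_ _ in kU; have fu : 0 < fwd u.
  by rewrite lt0n; have := hf u; rewrite negb_and kU.
have [d [d0 dl hd]] := fwd_pos fu.
have kd : k < d.
  rewrite ltnNge; apply/negP => dk; have := kmin (k - d); rewrite negb_and.
  have -> : at_ (i + (n - (k - d))) = at_ (index u c + d).
    apply: at_mod; rewrite index_at modnDml; congr (_ %% _); lia.
  by rewrite hd orbF; lia.
have kl : k < l by lia.
apply/imsetP; exists (u, Ordinal kl); first by rewrite inE.
rewrite /g /= index_at -[LHS]at_index; apply: at_mod; rewrite modnDml -addnA subnK; last by lia.
by rewrite modnDr.
Qed.

(** The element [a'] of [U] that precedes [a] works: nothing of [U] lies between them, and nothing
    within [l] steps after [a], so its only possible forward neighbour in [U] is [a]. *)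
Lemma second_gap a : a \in U -> fwd a = 0 -> 1 < #|U| ->
  exists a', [/\ a' \in U, a' != a & fwd a' <= 1].
Proof.
move=> aU fa U1; set i := index a c; have il := index_lt a.
have [b [bU ba]] : exists b, b \in U /\ b != a.
  have /card_gt0P[b] : 0 < #|U :\ a| by have := cardsD1 a U; rewrite aU; lia.
  by rewrite !inE => /andP[h1 h2]; exists b.
have [|k [/and3P[k0 kn kU] kmin]] := @ex_least (fun k => [&& 0 < k, k < n & at_ (i + (n - k)) \in U]).
  have bl := index_lt b.
  have bi' : index b c != i.
    by apply: contraNneq ba => h; rewrite -(at_index b) h at_index.
  have [bi|bi] := leqP (index b c) i.
    exists (i - index b c); apply/and3P; split; try (rewrite /i in bi bi' *; lia).
    rewrite (_ : at_ _ = b) // -[RHS]at_index; apply: at_mod.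
    have -> : i + (n - (i - index b c)) = index b c + n by rewrite /i in bi *; lia.
    by rewrite modnDr.
  exists (i + n - index b c); apply/and3P; split; try (rewrite /i in bi bi' *; lia).
  rewrite (_ : at_ _ = b) // -[RHS]at_index; apply: at_mod; congr (_ %% _).
  by rewrite /i in bi *; lia.
exists (at_ (i + (n - k))); split=> //.
  apply/eqP => h; have := index_at (i + (n - k)); rewrite h -/i => hi.
  have : i + (n - k) = i %[mod n] by rewrite -hi modn_small.
  move/eqP; rewrite -[X in _ == X %[mod n]]addn0 eqn_modDl mod0n modn_small; last by lia.
  by lia.
set a' := at_ _; rewrite leqNgt; apply/negP => /card_gt1P[d1 [d2 [h1 h2 d12]]].
have key (d : 'I_l) : at_ (index a' c + d.+1) \in U -> d.+1 = k.
  move=> hd; have e1 : at_ (index a' c + d.+1) = at_ (i + (n - k) + d.+1).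
    by apply: at_mod; rewrite index_at modnDml.
  rewrite e1 in hd; case: (ltngtP d.+1 k) => // hk.
    have := kmin (k - d.+1); rewrite !negb_and.
    have -> : i + (n - (k - d.+1)) = i + (n - k) + d.+1 by move: hk kn; clear; lia.
    by rewrite hd orbF; lia.
  have hdl : d.+1 - k - 1 < l by move: (ltn_ord d); clear; lia.
  have : 0 < fwd a.
    apply/card_gt0P; exists (Ordinal hdl); rewrite inE /=.
    rewrite (_ : at_ _ = at_ (i + (n - k) + d.+1)) //; apply: at_mod.
    have -> : i + (n - k) + d.+1 = index a c + (d.+1 - k - 1).+1 + n by rewrite -/i; move: hk kn; clear; lia.
    by rewrite modnDr.
  by rewrite fa.
move: h1 h2; rewrite !inE => /key e1 /key e2; move/eqP: d12; apply.
by apply: val_inj; apply: succn_inj; rewrite e1 e2.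
Qed.

Lemma cedges_le : #|[set E in cedges c | E \subset U]| <= l * #|U|.
Proof.
apply: leq_trans edges_fwd _; rewrite mulnC -sum_nat_const; apply: leq_sum => u _.
exact: fwd_le.
Qed.

(** The two elements before a gap have forward degrees at most 0 and 1, the others at most [l]. *)
Lemma cedges_gap_le : 1 < #|U| -> l * #|U| < n ->
  #|[set E in cedges c | E \subset U]| <= l * (#|U| - 2) + 1.
Proof.
move=> U1 hn; have [|a aU fa] := gap_exists _ hn; first by apply/card_gt0P; apply: ltnW.
have [a' [aU' ne fa']] := second_gap aU fa U1.
apply: leq_trans edges_fwd _; rewrite (big_setD1 a aU) /= fa add0n.
have a'D : a' \in U :\ a by rewrite !inE ne.
rewrite (big_setD1 a' a'D) /= addnC leq_add //.
have -> : #|U| - 2 = #|(U :\ a) :\ a'|.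
  by have := cardsD1 a U; have := cardsD1 a' (U :\ a); rewrite aU a'D; lia.
rewrite mulnC -sum_nat_const; apply: leq_sum => u _; exact: fwd_le.
Qed.

End CyclicEdges.

Import Order.TTheory GRing.Theory Num.Theory.
Local Open Scope ring_scope.

(** * Random halves *)

Lemma bin_half_max q i : ('C(q, i) <= 'C(q, q./2))%N.
Proof.
have up a b : (a <= b)%N -> (b <= q./2)%N -> ('C(q, a) <= 'C(q, b))%N.
  elim: b => [|b IH]; first by rewrite leqn0 => /eqP ->.
  rewrite leq_eqVlt => /orP[/eqP -> //|]; rewrite ltnS => hab hb.
  apply: leq_trans (IH hab (ltnW hb)) _.
  rewrite -(leq_pmul2l (ltn0Sn b)) mul_bin_left leq_mul2r; apply/orP; right; lia.
have [hi|hi] := leqP i q./2; first exact: up.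
have [hq|hq] := leqP i q; last by rewrite bin_small.
by rewrite -bin_sub //; apply: up; lia.
Qed.

Lemma half_bounds q : (2 * q./2 <= q + 0)%N /\ (2 * (q - q./2) <= q + 1)%N.
Proof. by lia. Qed.

Lemma bin_half_ge q : (2 ^ q <= q.+1 * 'C(q, q./2))%N.
Proof.
rewrite -[X in (X ^ _)%N]/(1 + 1)%N expnDn -[X in (_ <= X * _)%N]card_ord -sum_nat_const.
by apply: leq_sum => i _; rewrite !exp1n !muln1 bin_half_max.
Qed.

Section Split.
Variables (R : realType) (T : finType).
Implicit Types (I J N X : {set T}).

(** The sum factorizes over [I]: an element of [N] contributes [c1 + c2], any other element 2. *)
Lemma subset_weight_sum I N (c1 c2 y : R) : N \subset I -> 0 <= c1 -> 0 <= c2 ->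
  0 <= y -> c1 + c2 <= 2 + y ->
  \sum_(J : {set T} | J \subset I) \prod_(i in N) (if i \in J then c1 else c2)
    <= (2 + y) ^+ #|I|.
Proof.
move=> NI c10 c20 y0 hc.
pose F i := if i \in I then (if i \in N then c1 else 1) else 0 : R.
pose G i := if i \in N then c2 else 1 : R.
have F0 i : 0 <= F i by rewrite /F; do 2?case: ifP.
have G0 i : 0 <= G i by rewrite /G; case: ifP.
have -> : \sum_(J : {set T} | J \subset I) \prod_(i in N) (if i \in J then c1 else c2) =
    \sum_(J : {set T} | J \subset I) \prod_i (if i \in J then F i else G i).
  apply: eq_bigr => J /subsetP JI; rewrite big_mkcond; apply: eq_bigr => i _.
  rewrite /F /G; case: ifP => hN; case: ifP => hJ //; rewrite ?(JI _ hJ) //.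
apply: (@le_trans _ _ (\sum_(J : {set T}) \prod_i (if i \in J then F i else G i))).
  rewrite [leRHS](bigID (fun J => J \subset I)) /= lerDl sumr_ge0 // => J _.
  by apply: prodr_ge0 => i _; case: ifP.
rewrite -bigA_distr -prodr_const (big_mkcond (mem I)) /=.
apply: ler_prod => i _; rewrite addr_ge0 //= /F /G.
have [hI|hI] := boolP (i \in I); first by case: ifP => //; lra.
by rewrite (contraNF (subsetP NI i) hI) add0r.
Qed.

(** Chernoff bound with weights [1 + x] and its inverse on the two sides of the split, whose sum is
    at most [2 + x ^+ 2]. All subsets of [I] are counted, whatever their size. *)
Lemma unbalanced_count I N (x : R) D : N \subset I -> 0 <= x ->
  (1 + x) ^+ D * #|[set J : {set T} | (J \subset I) && (#|N :&: J| + D <= #|N :\: J|)%N]|%:R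
     <= (2 + x ^+ 2) ^+ #|I|
  /\ (1 + x) ^+ D * #|[set J : {set T} | (J \subset I) && (#|N :\: J| + D <= #|N :&: J|)%N]|%:R
     <= (2 + x ^+ 2) ^+ #|I|.
Proof.
move=> NI x0; have c0 : 0 < 1 + x by lra.
have hc : (1 + x) + (1 + x)^-1 <= 2 + x ^+ 2.
  rewrite -(ler_pM2r c0) mulrDl mulVf ?gt_eqF //.
  have : 0 <= x ^+ 3 by rewrite exprn_ge0.
  nra.
have x2 : 0 <= x ^+ 2 by rewrite exprn_ge0.
have hV : 0 <= (1 + x)^-1 by rewrite invr_ge0 ltW.
have key c1 c2 (P : pred {set T}) : 0 <= c1 -> 0 <= c2 -> c1 + c2 <= 2 + x ^+ 2 ->
    (forall J, P J -> (1 + x) ^+ D <= c1 ^+ #|N :&: J| * c2 ^+ #|N :\: J|) ->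
    (1 + x) ^+ D * #|[set J : {set T} | (J \subset I) && P J]|%:R <= (2 + x ^+ 2) ^+ #|I|.
  move=> c10 c20 hcc hP; apply: le_trans (subset_weight_sum NI c10 c20 x2 hcc).
  rewrite mulr_natr -sumr_const (eq_bigl _ _ (in_set _)) big_mkcondr /=.
  apply: ler_sum => J _; rewrite (bigID (mem J)) /=.
  rewrite (eq_bigr (fun => c1)) => [|i /andP[_ ->] //].
  rewrite [X in _ * X](eq_bigr (fun => c2)) => [|i /andP[_ /negbTE ->] //].
  have -> : \prod_(i in N | i \in J) c1 = c1 ^+ #|N :&: J|.
    by rewrite -prodr_const; apply: eq_bigl => i; rewrite inE.
  have -> : \prod_(i in N | i \notin J) c2 = c2 ^+ #|N :\: J|.
    by rewrite -prodr_const; apply: eq_bigl => i; rewrite inE andbC.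
  by case: ifP => [/hP //|_]; rewrite mulr_ge0 ?exprn_ge0.
have c1 : 1 <= 1 + x by lra.
split.
  apply: (key (1 + x)^-1 (1 + x)) => //; [exact: ltW|by rewrite addrC|].
  move=> J hJ; rewrite exprVn mulrC ler_pdivlMr ?exprn_gt0 // -exprD.
  by rewrite ler_weXn2l // addnC.
apply: (key (1 + x) (1 + x)^-1) => //; first exact: ltW.
move=> J hJ; rewrite exprVn ler_pdivlMr ?exprn_gt0 // -exprD.
by rewrite ler_weXn2l // addnC.
Qed.

Variable e : rel T.

Definition dg I x : nat := #|[set y in I | e x y]|.

Definition good_split (I X : {set T}) (b : R) (J : {set T}) : bool :=
  [forall x in X, (b * #|J|%:R <= (dg J x)%:R) && (b * #|I :\: J|%:R <= (dg (I :\: J) x)%:R)].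

(** Union bound over [X] and over the two directions of imbalance. Passing from all subsets to those
    of size [#|I|./2] costs the factor [#|I|.+1], by [bin_half_ge]. *)
Lemma bad_split_count I X (b xi : R) : 0 < xi -> xi <= 1 -> 2 <= xi * #|I|%:R ->
  (forall x, x \in X -> b * #|I|%:R <= (dg I x)%:R) ->
  #|[set J : {set T} | [&& J \subset I, #|J| == (#|I|./2)%N & ~~ good_split I X (b - xi) J]]|%:R
  <= 4 * #|X|%:R * #|I|.+1%:R * expR (- (xi ^+ 2 * #|I|%:R / 32)) * 'C(#|I|, #|I|./2)%:R.
Proof.
move=> xi0 xi1 hxi hX; set q := #|I| in hxi hX *.
pose N x := [set y in I | e x y].
have NI x : N x \subset I by apply/subsetP => y; rewrite inE => /andP[].
(* An imbalance below [D] leaves each half at least half of (b - xi / 2) q neighbours. The remaining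
   xi q / 4 is at least 1/2 and pays for the odd vertex of the larger half. *)
pose D := Num.truncn (xi * q%:R / 2).
pose B1 x := [set J : {set T} | (J \subset I) && (#|N x :&: J| + D <= #|N x :\: J|)%N].
pose B2 x := [set J : {set T} | (J \subset I) && (#|N x :\: J| + D <= #|N x :&: J|)%N].
have /andP[D1 D2] : D%:R <= xi * q%:R / 2 < D.+1%:R by apply: truncn_itv; lra.
(* With this [x] the numerator of [c] is at most 2^q exp(xi^2 q / 32), and the denominator is at
   least exp(xi^2 q / 16) up to a factor at most 2. *)
set x := xi / 4; have x0 : 0 <= x by rewrite /x; lra.
pose c := (2 + x ^+ 2) ^+ q / (1 + x) ^+ D.
have hB v : #|B1 v|%:R <= c /\ #|B2 v|%:R <= c.
  have [h1 h2] := unbalanced_count D (NI v) x0.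
  by rewrite /c; split; rewrite ler_pdivlMr ?exprn_gt0 //; try lra; rewrite mulrC.
have cov : [set J : {set T} | [&& J \subset I, #|J| == (q./2)%N & ~~ good_split I X (b - xi) J]]
    \subset \bigcup_(v in X) (B1 v :|: B2 v).
  apply/subsetP => J; rewrite inE => /and3P[JI /eqP hJ].
  rewrite negb_forall => /existsP[v]; rewrite negb_imply => /andP[hv hn].
  apply/bigcupP; exists v => //; rewrite !inE JI /=; apply/negPn/negP.
  rewrite negb_or -!ltnNge => /andP[h1 h2]; move/negP: hn; apply.
  have hN := hX v hv; have e0 := cardsID J (N v).
  have e1 : dg J v = #|N v :&: J|.
    by apply: eq_card => y; rewrite !inE; have [/(subsetP JI) ->|] := boolP (y \in J); rewrite ?andbF ?andbT.
  have e2 : dg (I :\: J) v = #|N v :\: J|.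
    by apply: eq_card => y; rewrite !inE andbA.
  have e3 : #|I :\: J| = (q - q./2)%N.
    by rewrite -hJ /q -(cardsID J I) (setIidPr JI) addKn.
  have b1 : b <= 1.
    have : (dg I v <= q)%N by apply: subset_leq_card; apply: NI.
    have q0 : 0 < q%:R :> R by rewrite ltr0n lt0n; apply: contraTneq hxi => ->; lra.
    rewrite -(ler_nat R) => h; have := le_trans hN h.
    by rewrite -{2}[q%:R]mul1r ler_pM2r.
  have e4 : #|N v| = dg I v by [].
  rewrite e1 e2 e3 hJ.
  have [k1n k2n] := half_bounds q.
  have [k3n k4n] : (dg I v <= 2 * #|N v :&: J| + D)%N /\ (dg I v <= 2 * #|N v :\: J| + D)%N.
    by move: e0 h1 h2; rewrite e4; clear; lia.
  have toR m n k : (m <= 2 * n + k)%N -> m%:R <= 2 * n%:R + k%:R :> R.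
    by rewrite -(ler_nat R) natrD natrM.
  have toR' m n k : (2 * n <= m + k)%N -> 2 * n%:R <= m%:R + k%:R :> R.
    by rewrite -(ler_nat R) natrD natrM.
  have k1 := toR' _ _ _ k1n.
  have k2 := toR' _ _ _ k2n; have k3 := toR _ _ _ k3n; have k4 := toR _ _ _ k4n.
  clear k1n k2n k3n k4n.
  have [hb|hb] := leP (b - xi) 0.
    by apply/andP; split; apply: (@le_trans _ _ 0); rewrite ?ler0n // mulr_le0_ge0 // ler0n.
  have m1 := ler_wpM2l (ltW hb) k1; have m2 := ler_wpM2l (ltW hb) k2.
  apply/andP; split; lra.
have {}cov : #|[set J : {set T} | [&& J \subset I, #|J| == (q./2)%N & ~~ good_split I X (b - xi) J]]|%:R
    <= 2 * #|X|%:R * c.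
  have h : (#|[set J : {set T} | [&& J \subset I, #|J| == (q./2)%N & ~~ good_split I X (b - xi) J]]|
      <= \sum_(v in X) (#|B1 v| + #|B2 v|))%N.
    apply: leq_trans (subset_leq_card cov) _.
    apply: (@leq_trans (\sum_(v in X) #|B1 v :|: B2 v|)); last first.
      by apply: leq_sum => v _; rewrite cardsU leq_subr.
    elim/big_rec2: _ => [|v n S _ hS]; first by rewrite cards0.
    by rewrite cardsU (leq_trans (leq_subr _ _)) // leq_add2l.
  move: h; rewrite -(ler_nat R) natr_sum => /le_trans; apply.
  rewrite mulrAC mulr_natr -sumr_const; apply: ler_sum => v _.
  have [] := hB v; rewrite natrD; lra.
apply: le_trans cov _.
have hc : c <= 2 ^+ q * 2 * expR (- (xi ^+ 2 * q%:R / 32)).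
  have x1 : 0 < 1 + x by lra.
  rewrite /c ler_pdivrMr; last exact: exprn_gt0.
  have u1 : (2 + x ^+ 2) ^+ q <= 2 ^+ q * expR (xi ^+ 2 * q%:R / 32).
    have -> : 2 + x ^+ 2 = 2 * (1 + x ^+ 2 / 2) by lra.
    rewrite exprMn ler_wpM2l ?exprn_ge0 //.
    have -> : xi ^+ 2 * q%:R / 32 = (x ^+ 2 / 2) * q%:R by rewrite /x; lra.
    rewrite expRM_natr lerXn2r ?nnegrE ?expR_ge0 ?expR_ge1Dx //.
    by have := sqr_ge0 x; lra.
  apply: le_trans u1 _; set E := expR (- _).
  rewrite -!(mulrA (2 ^+ q)) ler_wpM2l ?exprn_ge0 // -(mulrA 2).
  have u2 : expR (x / 2) <= 1 + x.
    have h := expR_ge1Dx (- (x / 2)); rewrite expRN in h.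
    have xl : x <= 1 / 4 by rewrite /x; lra.
    have hp : 0 < 1 - x / 2 by lra.
    have : expR (x / 2) <= (1 - x / 2)^-1.
      by rewrite -[leLHS]invrK lef_pV2 ?posrE // ?invr_gt0 ?expR_gt0.
    by move/le_trans; apply; rewrite -div1r ler_pdivrMr //; nra.
  have u3 : expR (x / 2 * (xi * q%:R / 2 - 1)) <= (1 + x) ^+ D.
    apply: (@le_trans _ _ (expR (x / 2) ^+ D)).
      have x20 : 0 <= x / 2 by lra.
      rewrite -expRM_natr ler_expR ler_wpM2l //.
      by move: D2; rewrite -natr1; clear; lra.
    by rewrite lerXn2r // nnegrE ?expR_ge0 //; lra.
  apply: (@le_trans _ _ (2 * (E * expR (x / 2 * (xi * q%:R / 2 - 1))))); last first.
    by apply: ler_wpM2l => //; apply: ler_wpM2l; rewrite ?expR_ge0.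
  rewrite /E -expRD.
  have -> : - (xi ^+ 2 * q%:R / 32) + x / 2 * (xi * q%:R / 2 - 1) = xi ^+ 2 * q%:R / 32 - x / 2.
    by rewrite /x; field.
  rewrite expRB mulrCA -[leLHS]mulr1 ler_wpM2l ?expR_ge0 //.
  rewrite ler_pdivlMr ?expR_gt0 // mul1r (le_trans u2) //; rewrite /x; lra.
have hb : 2 ^+ q <= q.+1%:R * 'C(q, q./2)%:R :> R.
  by rewrite -natrX -natrM ler_nat bin_half_ge.
have X0 : 0 <= 2 * #|X|%:R :> R by rewrite mulr_ge0 ?ler0n.
apply: le_trans (ler_wpM2l X0 hc) _.
set E := expR _; have E0 : 0 <= E by rewrite expR_ge0.
have := ler_wpM2l (mulr_ge0 X0 (mulr_ge0 (ler0n R 2) E0)) hb.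
set z := 2 ^+ q; set w := _%:R * _%:R; rewrite /w; nra.
Qed.

End Split.

Lemma perm_enumU (T : finType) (A B : {set T}) : [disjoint A & B] ->
  perm_eq (enum (A :|: B)) (enum A ++ enum B).
Proof.
move=> dAB; apply: uniq_perm; first exact: enum_uniq.
  rewrite cat_uniq !enum_uniq andbT /=; apply/hasPn => x; rewrite !mem_enum => hB.
  by apply: contraL hB => hA; rewrite (disjointFr dAB hA).
by move=> x; rewrite mem_cat !mem_enum inE.
Qed.

Lemma perm_enum_seq (T : finType) (w : seq T) : uniq w -> perm_eq w (enum [set x in w]).
Proof. by move=> uw; apply: uniq_perm; rewrite ?enum_uniq // => x; rewrite mem_enum inE. Qed.

Lemma exists_nat_ge (R : realType) (x : R) : exists n : nat, x <= n%:R.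
Proof. by exists (Num.truncn x).+1; apply/ltW/truncnS_gt. Qed.

(** The number of bad halves is below the number of all halves once 8 K q^2 < t^3 / 6 with t = xi^2
    q / 32, because exp(t) exceeds t^3 / 6. *)
Lemma half_split_exists (R : realType) (xi : R) K : 0 < xi -> xi <= 1 ->
  exists q0, forall (T : finType) (e : rel T) (I X : {set T}) (b : R),
  (q0 <= #|I|)%N -> (#|X| <= K * #|I|)%N ->
  (forall x, x \in X -> b * #|I|%:R <= (dg e I x)%:R) ->
  exists J : {set T}, [/\ J \subset I, #|J| = (#|I|./2)%N &
    forall x, x \in X -> (b - xi) * #|J|%:R <= (dg e J x)%:R].
Proof.
move=> xi0 xi1.
have [m1 hm1] := exists_nat_ge (2 / xi).
have [m2 hm2] := exists_nat_ge (8 * K%:R * 6 * 32 ^+ 3 / xi ^+ 6).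
exists (maxn m1 m2).+1 => T e I X b; set q := #|I| => hq hX hdg.
have q0 : 0 < q%:R :> R by rewrite ltr0n; apply: leq_trans hq.
have hq1 : 2 / xi <= q%:R.
  by apply: le_trans hm1 _; rewrite ler_nat; apply: leq_trans (leq_trans (leq_maxl m1 m2) _) hq.
have hq2 : 8 * K%:R * 6 * 32 ^+ 3 / xi ^+ 6 < q%:R.
  apply: le_lt_trans hm2 _; rewrite ltr_nat; apply: leq_ltn_trans (leq_maxr m1 m2) _; exact: hq.
have [/existsP[J /and3P[h1 /eqP h2 /forall_inP h3]]|] :=
    boolP [exists J : {set T}, [&& J \subset I, #|J| == (q./2)%N & good_split e I X (b - xi) J]].
  by exists J; split=> // x /h3 /andP[].
rewrite negb_exists => /forallP hn; exfalso.
have := bad_split_count xi0 xi1 _ hdg; rewrite -/q.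
have h2 : 2 <= xi * q%:R by rewrite mulrC -ler_pdivrMr.
move=> /(_ h2); apply/negP; rewrite -ltNge.
have -> : [set J : {set T} | [&& J \subset I, #|J| == (q./2)%N & ~~ good_split e I X (b - xi) J]] =
    [set J : {set T} | (J \subset I) && (#|J| == (q./2)%N)].
  apply/setP => J; rewrite !inE; have := hn J.
  by case: (J \subset I) => //=; case: eqP => //= _ ->.
have -> : #|[set J : {set T} | (J \subset I) && (#|J| == (q./2)%N)]| = 'C(q, q./2)%N.
  exact: cards_draws.
rewrite -[ltRHS]mul1r ltr_pM2r; last by rewrite ltr0n bin_gt0; clear; lia.
rewrite expRN ltr_pdivrMr ?expR_gt0 // mul1r.
set t := xi ^+ 2 * q%:R / 32.
have t0 : 0 <= t by rewrite /t divr_ge0 // mulr_ge0 ?exprn_ge0 ?(ltW xi0) ?(ltW q0).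
apply: (@le_lt_trans _ _ (4 * (K%:R * q%:R) * (2 * q%:R))).
  rewrite ler_pM ?mulr_ge0 ?ler0n // ?ler_wpM2l ?ler0n // -?natrM ?ler_nat //.
  by move: q0; rewrite ltr0n; lia.
apply: (@lt_le_trans _ _ (t ^+ 3 / 6)); last first.
  by apply: le_trans (expR_ge1Dxn 2 t0); rewrite -[leLHS]add0r lerD // ler01.
rewrite ltr_pdivlMr //.
have -> : t ^+ 3 = (xi ^+ 6 / 32 ^+ 3 * q%:R) * q%:R ^+ 2 by rewrite /t; field.
rewrite ltr_pdivrMr ?exprn_gt0 // in hq2.
have h4 : 8 * K%:R * 6 < xi ^+ 6 / 32 ^+ 3 * q%:R.
  by rewrite (mulrAC (xi ^+ 6)) ltr_pdivlMr ?exprn_gt0 // (mulrC (xi ^+ 6)).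
have := ltr_pM2r (exprn_gt0 2 q0) (8 * K%:R * 6) (xi ^+ 6 / 32 ^+ 3 * q%:R).
rewrite h4; set z := xi ^+ 6 / _ * _; move: (z) => w; clear; lra.
Qed.

(** A subset of density about 2^-j with inherited degrees is obtained by [j] halvings, so that
    concentration is needed for halves only. The last halving takes half of the error, the earlier
    ones share the rest. *)
Lemma reservoir_exists (R : realType) j (xi : R) K : 0 < xi -> xi <= 1 ->
  exists q0, forall (T : finType) (e : rel T) (I X : {set T}) (b : R),
  (q0 <= #|I|)%N -> (#|X| <= K * #|I|)%N ->
  (forall x, x \in X -> b * #|I|%:R <= (dg e I x)%:R) ->
  exists J : {set T}, [/\ J \subset I, (#|J| * 2 ^ j <= #|I|)%N, (#|I| < #|J|.+1 * 2 ^ j)%N &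
    forall x, x \in X -> (b - xi) * #|J|%:R <= (dg e J x)%:R].
Proof.
elim: j xi => [|j IH] xi xi0 xi1.
  exists 0%N => T e I X b _ _ h; exists I; split; rewrite ?muln1 // => x /h.
  by apply: le_trans; rewrite ler_wpM2r ?ler0n //; lra.
have [||q0 h0] := IH (xi / 2); [lra|lra|].
have [||q1 h1] := @half_split_exists R (xi / 2) (K * 2 ^ j.+1); [lra|lra|].
exists (maxn q0 (q1.+1 * 2 ^ j))%N => T e I X b; rewrite geq_max => /andP[hq0 hq1] hX hb.
have [J [JI J1 J2 J3]] := h0 T e I X b hq0 hX hb.
have e2 : (0 < 2 ^ j)%N by rewrite expn_gt0.
have hJ : (q1 < #|J|)%N.
  by rewrite -(ltn_pmul2r e2); move: J2; rewrite mulSn mulSn in hq1 *; lia.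
have [||J' [J'J J'1 J'2]] := h1 T e J X (b - xi / 2) _ _ J3.
- exact: ltnW.
- apply: leq_trans hX _; rewrite -mulnA leq_mul2l expnS; apply/orP; right.
  by apply: leq_trans (ltnW J2) _; rewrite (mulnC 2) -mulnA mulnC leq_mul2l; apply/orP; right; lia.
exists J'; split; first exact: subset_trans J'J JI.
- rewrite J'1 expnS mulnA; apply: leq_trans J1; rewrite leq_mul2r; apply/orP; right; lia.
- rewrite J'1 expnS mulnA; apply: leq_trans J2 _; rewrite leq_mul2r; apply/orP; right; lia.
by move=> x /J'2; rewrite (_ : b - xi / 2 - xi / 2 = b - xi) //; field.
Qed.

(** * Absorption *)

Section Common.
Variables (R : realType) (T : finType) (e : rel T).
Hypothesis es : symmetric e.

Lemma common_ge (W : {set T}) (g : R) (xs : seq T) :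
  (forall x, x \in xs -> g * #|W|%:R <= (dg e W x)%:R) ->
  #|W|%:R - (size xs)%:R * ((1 - g) * #|W|%:R) <= #|common e W xs|%:R.
Proof.
elim: xs => [|x xs IH] h.
  by rewrite mul0r subr0 ler_nat subset_leq_card //; apply/subsetP => y; rewrite inE andbT.
have {IH}h1 := IH (fun y hy => h y (mem_behead (s := x :: xs) hy)).
have {h}h2 := h x (mem_head _ _).
have h3 : (#|common e W xs| + dg e W x <= #|common e W (x :: xs)| + #|W|)%N.
  rewrite /dg -cardsUI addnC; apply: leq_add; apply: subset_leq_card; apply/subsetP => y.
    by rewrite !inE /= (es y) => /andP[/andP[-> ->] /andP[_ ->]].
  by rewrite !inE => /orP[] /andP[].
move: h3; rewrite -(ler_nat R) !natrD /= -natr1 => h3; lra.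
Qed.

Lemma dg_sub (I W : {set T}) (b c : R) x : W \subset I -> 0 <= b - c ->
  #|I :\: W|%:R <= c * #|I|%:R -> b * #|I|%:R <= (dg e I x)%:R ->
  (b - c) * #|W|%:R <= (dg e W x)%:R.
Proof.
move=> WI bc hc hb.
have h1 : (dg e I x <= dg e W x + #|I :\: W|)%N.
  rewrite /dg -(cardsID W [set y in I | e x y]) leq_add //; apply: subset_leq_card.
    by apply/subsetP => y; rewrite !inE => /andP[/andP[_ ->] ->].
  by apply/subsetP => y; rewrite !inE => /andP[-> /andP[->]].
have h2 : #|W|%:R <= #|I|%:R :> R by rewrite ler_nat subset_leq_card.
move: h1; rewrite -(ler_nat R) natrD => h1.
have := ler_wpM2l bc h2; lra.
Qed.

End Common.

Section HamConnected.
Variables (R : realType) (l : nat).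

(** Above this relative degree, [l.+1] non-neighbourhoods have relative size below 1 / (l + 1) each
    and cannot cover the vertex set, so any [l.+1] vertices have common neighbours. *)
Definition crit : R := l%:R / l.+1%:R.

Lemma common_crit (eta : R) h : 0 < eta -> eta^-1 <= h%:R ->
  forall (T : finType) (e : rel T) (W : {set T}) (xs : seq T), symmetric e ->
  (size xs <= l.+1)%N ->
  (forall x, x \in xs -> (crit + eta) * #|W|%:R <= (dg e W x)%:R) ->
  (#|W| <= h * #|common e W xs|)%N.
Proof.
move=> eta0 hh T e W xs es hs hx.
have hc := common_ge es hx.
have h0 : 0 < h%:R :> R by apply: lt_le_trans hh; rewrite invr_gt0.
have [hneg|hpos] := ltP (1 - (crit + eta)) 0.
  have h1 : #|W|%:R <= #|common e W xs|%:R :> R.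
    apply: le_trans hc; rewrite lerBrDr gerDl mulr_ge0_le0 // mulr_le0_ge0 //; exact: ltW.
  move: h1; rewrite ler_nat => h1; apply: leq_trans h1 _.
  by rewrite -{1}[#|common e W xs|]mul1n leq_mul2r -(ltr_nat R) h0 orbT.
have hW : 0 <= #|W|%:R :> R by [].
have h1 : (size xs)%:R * ((1 - (crit + eta)) * #|W|%:R) <= l.+1%:R * ((1 - (crit + eta)) * #|W|%:R).
  by rewrite ler_wpM2r ?mulr_ge0 // ler_nat.
have h2 : l.+1%:R * (1 - (crit + eta)) = 1 - l.+1%:R * eta.
  rewrite /crit -natr1; have : l%:R + 1 != 0 :> R by rewrite natr1 pnatr_eq0.
  by move=> hl; field.
have h3 : eta * #|W|%:R <= #|common e W xs|%:R.
  apply: le_trans hc; rewrite [leRHS]mulrA h2 in h1.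
  have : eta * #|W|%:R <= l.+1%:R * eta * #|W|%:R.
    have hl1 : 1 <= l.+1%:R :> R by rewrite ler1n.
    by have := ler_wpM2r (ltW eta0) hl1; rewrite mul1r => /(ler_wpM2r hW).
  lra.
rewrite -(ler_nat R) natrM; apply: (@le_trans _ _ (h%:R * (eta * #|W|%:R))).
  rewrite mulrA -[leLHS]mul1r ler_wpM2r //.
  by rewrite -ler_pdivrMr // div1r.
by rewrite ler_wpM2l // ltW.
Qed.

Lemma connect_crit (eta : R) : 0 < eta -> exists L N0,
  forall (T : finType) (e : rel T) (W : {set T}) (a b : seq T),
  symmetric e -> size a = l -> size b = l -> ppath l e a -> ppath l e b ->
  (N0 <= #|W|)%N ->
  (forall x, [|| x \in W, x \in a | x \in b] -> (crit + eta) * #|W|%:R <= (dg e W x)%:R) ->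
  exists w, [/\ size w = L, uniq w, {subset w <= W} & ppath l e (a ++ w ++ b)].
Proof.
move=> eta0; have [h hh] := exists_nat_ge eta^-1.
have h0 : (0 < h)%N by rewrite -(ltr_nat R); apply: lt_le_trans hh; rewrite invr_gt0.
have [L [N0 H]] := connect_cliques l h0; exists L, N0 => T e W a b es sa sb pa pb hW hdg.
apply: H => // xs hs hxs; apply: (common_crit eta0 hh es hs) => x /hxs.
by rewrite inE /= mem_cat => hx; apply: hdg.
Qed.

(** Greedy selection inside the neighbourhood of [v]: a new vertex has to see [v] and at most [l]
    vertices of the path, together at most [l.+1]. *)
Lemma exists_ppath (eta : R) k : 0 < eta -> exists N0,
  forall (T : finType) (e : rel T) (W : {set T}) v,
  symmetric e -> (N0 <= #|W|)%N ->
  (forall x, (x \in W) || (x == v) -> (crit + eta) * #|W|%:R <= (dg e W x)%:R) ->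
  exists s, [/\ size s = k, uniq s, ppath l e s & forall x, x \in s -> (x \in W) && e v x].
Proof.
move=> eta0; have [h hh] := exists_nat_ge eta^-1.
have h0 : (0 < h)%N by rewrite -(ltr_nat R); apply: lt_le_trans hh; rewrite invr_gt0.
exists (h * k.+1)%N => T e W v es hW hdg.
pose Js := nseq k (common e W [:: v]).
have : (\prod_(J <- Js) 1 <= size (sel l e Js))%N.
  apply: (size_sel (k := fun _ => 1%N)) => J z /nseqP[-> _]; rewrite size_nseq => hz uz hzJ.
  have hzW x : x \in z -> x \in W.
    by case/hzJ => J' /nseqP[-> _]; rewrite inE => /andP[].
  have hc : (#|W| <= h * #|common e W (v :: take l z)|)%N.
    apply: (common_crit eta0 hh) => //=; first by rewrite ltnS size_take_min geq_minl.
    by move=> x; rewrite inE => /orP[hx|/mem_take /hzW hx]; apply: hdg; rewrite hx ?orbT.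
  have {}hc : (k < #|common e W (v :: take l z)|)%N.
    by have := leq_trans hW hc; rewrite leq_pmul2l.
  have : (0 < #|common e W (v :: take l z) :\: [set x in z]|)%N.
    rewrite cardsD subn_gt0; apply: leq_ltn_trans hc.
    apply: leq_trans (subset_leq_card (subsetIr _ _)) _.
    by rewrite cardsE (leq_trans (card_size _)) // ltnW.
  move/leq_trans; apply; apply: subset_leq_card; apply/subsetP => x.
  by rewrite !inE /= => /andP[-> /andP[-> /andP[-> ->]]].
rewrite big1_eq; case E: (sel l e Js) => [|s ss] // _.
have /mem_sel[h1 h2 h3 h4] : s \in sel l e Js by rewrite E inE eqxx.
rewrite size_nseq in h1 h4.
exists s; split=> // x hx.
have := h4 x (index x s); rewrite -h1 index_mem => /(_ hx).
rewrite nth_index // nth_nseq; case: ifP => [_|_]; last by rewrite inE.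
by rewrite inE /= andbT es.
Qed.

(* The path through A starts with a, ends with g, and can absorb any subset of
   rs: every v in rs has its own stretch of 2l vertices inside its neighbourhood. *)
Lemma absorbing_path (eta : R) : 0 < eta -> eta <= 1 -> exists c0 n0,
  forall (T : finType) (e : rel T) (I V : {set T}) (a : seq T),
  symmetric e -> size a = l -> ppath l e a -> V \subset I -> (n0 <= #|I|)%N ->
  (forall x, (x \in I) || (x \in a) -> (crit + eta) * #|I|%:R <= (dg e I x)%:R) ->
  forall rs : seq T, {subset rs <= I} ->
  (size rs * c0)%:R + #|I :\: V|%:R <= eta / 4 * #|I|%:R ->
  exists (A : {set T}) (g : seq T), [/\ A \subset V, (#|A| <= size rs * c0)%N,
    size g = l, (forall x, x \in g -> (x \in A) || (x \in a)) &
    forall p : pred T, exists s P, [/\ perm_eq s (enum A ++ filter p rs),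
      P ++ g = a ++ s & ppath l e (a ++ s)]].
Proof.
move=> eta0 eta1; have eta20 : 0 < eta / 2 by lra.
have [N1 H1] := exists_ppath (l + l) eta20.
have [L [N2 H2]] := connect_crit eta20.
have [n1 hn1] := exists_nat_ge (4 * (l + l)%:R / eta).
have [n2 hn2] := @exists_nat_ge R (4 * (maxn N1 N2)%:R).
exists (l + l + L)%N, (maxn n1 n2).
move=> T e I V a es sa pa VI; rewrite !geq_max => /andP[hn hn'] hdg.
have hI : (l + l)%:R <= eta / 4 * #|I|%:R.
  have : 4 * (l + l)%:R / eta <= #|I|%:R by apply: le_trans hn1 _; rewrite ler_nat.
  rewrite ler_pdivrMr //; lra.
elim=> [|v rs IH] hrs hsz.
  exists set0, a; split; rewrite ?sub0set ?cards0 //; first by move=> x ->; rewrite orbT.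
  by move=> p; exists [::], [::]; rewrite enum_set0 !cats0.
have [||A [g [AV hA sg hg hp]]] := IH.
- by move=> x hx; apply: hrs; rewrite inE hx orbT.
- apply: le_trans hsz; rewrite lerD2r ler_nat leq_mul2r /= leqnSn orbT //.
have Adg (W : {set T}) : W \subset V -> #|V :\: W|%:R <= (size (v :: rs) * (l + l + L))%:R + (l + l)%:R :> R ->
    (maxn N1 N2 <= #|W|)%N /\
    forall x, (x \in I) || (x \in a) -> (crit + eta / 2) * #|W|%:R <= (dg e W x)%:R.
  move=> WV hW.
  have WI := subset_trans WV VI.
  have hIW : #|I :\: W|%:R <= eta / 2 * #|I|%:R.
    have : (#|I :\: W| <= #|I :\: V| + #|V :\: W|)%N.
      rewrite -(cardsID V (I :\: W)) addnC leq_add //; apply: subset_leq_card.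
        by apply/subsetP => x; rewrite !inE => /andP[-> /andP[_ ->]].
      by apply/subsetP => x; rewrite !inE => /andP[/andP[-> _] ->].
    rewrite -(ler_nat R) natrD; lra.
  split.
    have h4 : #|I|%:R = #|W|%:R + #|I :\: W|%:R :> R.
      by rewrite -natrD -(cardsID W I) (setIidPr WI).
    rewrite -(ler_nat R); have : 4 * (maxn N1 N2)%:R <= #|I|%:R :> R by apply: le_trans hn2 _; rewrite ler_nat.
    have : 0 <= #|I|%:R :> R by []. nra.
  move=> x /hdg hx; have -> : crit + eta / 2 = (crit + eta) - eta / 2 by lra.
  apply: dg_sub hx => //; have : 0 <= crit by rewrite /crit divr_ge0.
  lra.
have c0E : (size (v :: rs) * (l + l + L))%:R + (l + l)%:R =
    (size rs * (l + l + L))%:R + ((l + l + L)%:R + (l + l)%:R) :> R.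
  by rewrite /= mulSn natrD addrAC addrA addrC addrA.
have [|hW1 hW1dg] := Adg (V :\: A) (subsetDl _ _).
  rewrite setDDr setDv set0U (setIidPr AV) c0E; apply: (@le_trans _ _ (size rs * (l + l + L))%:R).
    by rewrite ler_nat.
  by rewrite lerDl addr_ge0.
have vI : v \in I by apply: hrs; rewrite mem_head.
have W1I x : x \in V :\: A -> x \in I by rewrite inE => /andP[_ /(subsetP VI)].
have AI x : x \in A -> x \in I by move/(subsetP AV)/(subsetP VI).
(* [al] is the stretch for [v]. It is cut into [a1] and [a2] of size [l]; the current end [g] gets
   connected to [a1], and [a2] becomes the new end. *)
have [||al [sal ual pal alW]] := H1 T e (V :\: A) v es.
- by apply: leq_trans hW1; rewrite leq_maxl.
- by move=> x /orP[/W1I hx|/eqP ->]; apply: hW1dg; rewrite ?hx ?vI.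
pose W2 := (V :\: A) :\: [set x in al].
have [||hW2 hW2dg] := Adg W2.
- by apply/subsetP => x; rewrite !inE => /andP[_ /andP[]].
- rewrite c0E; apply: (@le_trans _ _ (size rs * (l + l + L) + (l + l))%:R).
    rewrite ler_nat; apply: leq_trans (leq_add hA (_ : #|[set x in al]| <= l + l)%N); last first.
      by rewrite cardsE (leq_trans (card_size _)) // sal.
    rewrite -(cardsID A (V :\: W2)) leq_add //; apply: subset_leq_card; apply/subsetP => x.
      by rewrite !inE => /andP[].
    rewrite !inE => /and3P[xA h xV]; move: h.
    by rewrite xA xV !andbT negbK.
  by rewrite natrD lerD2l lerDr.
have [a1 [a2 [alE sa1 sa2]]] : exists a1 a2, [/\ al = a1 ++ a2, size a1 = l & size a2 = l].
  exists (take l al), (drop l al); rewrite cat_take_drop size_takel ?size_drop sal ?leq_addr //.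
  by rewrite addnK.
have [||||w [sw uw wW2 pw]] := H2 T e W2 g a1 es sg sa1.
- by have [s [P [_ h1]]] := hp pred0; rewrite -h1 => /ppath_cat /andP[].
- by move: pal; rewrite alE => /ppath_cat /andP[].
- by apply: leq_trans hW2; rewrite leq_maxr.
- move=> x; rewrite !inE => hx; apply: hW2dg; case/or3P: hx => [/andP[_ /andP[_ hx]]|/hg|hx].
  + by rewrite (subsetP VI).
  + by case/orP => [/AI ->|->]; rewrite ?orbT.
  by have /alW/andP[/W1I ->] : x \in al by rewrite alE mem_cat hx.
pose A' := A :|: ([set x in al] :|: [set x in w]).
have wW x : x \in w -> [&& x \notin al, x \notin A & x \in V].
  by move/wW2; rewrite !inE.
have d1 : [disjoint [set x in al] & [set x in w]].
  rewrite disjoint_sym disjoints_subset; apply/subsetP => x; rewrite !inE.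
  by move/wW => /and3P[].
have d2 : [disjoint A & [set x in al] :|: [set x in w]].
  rewrite disjoint_sym disjoints_subset; apply/subsetP => x; rewrite !inE.
  by case/orP => [/alW|/wW /and3P[_ ->] //]; rewrite inE => /andP[/andP[->]].
exists A', a2; split=> //.
- apply/subsetP => x; rewrite !inE => /or3P[/(subsetP AV) //|/alW|/wW /and3P[] //].
  by rewrite inE => /andP[/andP[]].
- rewrite mulSn; apply: leq_trans (leq_card_setU _ _) _.
  rewrite addnC leq_add //; apply: leq_trans (leq_card_setU _ _) _.
  by rewrite leq_add // cardsE (leq_trans (card_size _)) // ?sal ?sw.
- by move=> x hx; rewrite !inE alE mem_cat hx !orbT.
move=> p; have [s [P [h1 h2 h3]]] := hp p.
(* If [v] is to be absorbed, it goes between [a1] and [a2], where its whole window lies in its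
   neighbourhood. *)
pose m := if p v then [:: v] else [::].
exists (s ++ w ++ a1 ++ m ++ a2), (P ++ g ++ w ++ a1 ++ m); split.
- have -> : filter p (v :: rs) = m ++ filter p rs by rewrite /m /=; case: ifP.
  apply/permP => q; rewrite /A' !count_cat (permP (perm_enumU d2)) !count_cat (permP h1) !count_cat (permP (perm_enumU d1)).
  rewrite !count_cat -(permP (perm_enum_seq ual)) -(permP (perm_enum_seq uw)) alE count_cat.
  by clear; lia.
- by rewrite -!catA catA h2 -!catA.
rewrite (catA a s) -h2 -(catA P g); apply: ppath_glue; rewrite ?sg ?h2 //.
rewrite catA; apply: ppath_glue; rewrite ?sa1 -?catA //.
rewrite /m; case: ifP => _ /=; last by rewrite -alE.
apply: ppath_insert; rewrite -?alE //; apply/allP => x hx.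
  by rewrite es; have /alW/andP[] : x \in al by rewrite alE mem_cat hx.
by have /alW/andP[] : x \in al by rewrite alE mem_cat hx orbT.
Qed.

End HamConnected.

Section HamConnected.
Variables (R : realType) (l : nat).

(** What the threshold provides, weakened to a spanning power path with free ends. It is stated for
    induced subgraphs because it is applied to what the reservoir and the absorber leave over. *)
Definition ham_path_bound (b : R) (N0 : nat) : Prop :=
  forall (T : finType) (e : rel T), symmetric e -> irreflexive e ->
  forall H : {set T}, (N0 <= #|H|)%N -> (forall x, x \in H -> b * #|H|%:R <= (dg e H x)%:R) ->
  exists2 c, perm_eq c (enum H) & ppath l e c.

Lemma ham_connected (eta beta : R) N0 : 0 < eta -> eta <= 1 -> crit R l + eta <= beta ->
  ham_path_bound (beta - eta / 4) N0 ->
  exists q0, forall (T : finType) (e : rel T) (I : {set T}) (a b : seq T),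
  symmetric e -> irreflexive e -> size a = l -> size b = l -> ppath l e a -> ppath l e b ->
  (q0 <= #|I|)%N ->
  (forall x, [|| x \in I, x \in a | x \in b] -> beta * #|I|%:R <= (dg e I x)%:R) ->
  exists2 w, perm_eq w (enum I) & ppath l e (a ++ w ++ b).
Proof.
move=> eta0 eta1 hbeta hbb; have cr0 : 0 <= crit R l by rewrite /crit divr_ge0.
have [c0 [n0 Habs]] := @absorbing_path R l eta eta0 eta1.
have eta40 : 0 < eta / 4 by lra.
have [L [N2 Hcon]] := connect_crit l eta40.
have [m1 hm1] := exists_nat_ge (16 * (1 + c0%:R) / eta).
(* [2 ^ j] is so large that the reservoir and its absorber, which has at most [c0] vertices per
   reservoir vertex, together occupy at most eta / 16 of [I]. *)
have [j hj] : exists j, 16 * (1 + c0%:R) <= eta * (2 ^ j)%:R.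
  exists m1; rewrite [leRHS]mulrC -ler_pdivrMr //; apply: le_trans hm1 _.
  by rewrite ler_nat ltnW // ltn_expl.
have [|q1 Hres] := @reservoir_exists R j (eta / 4) 3 eta40; first lra.
have [m2 hm2] := exists_nat_ge (4 * L%:R / eta).
pose M := maxn N2 m2.
exists (maxn (maxn q1 (maxn n0 l)) (maxn (2 * maxn N0 l) ((M + L).+1 * 2 ^ j)))%N.
move=> T e I a b es ei sa sb pa pb.
rewrite !geq_max => /andP[/and3P[hq1 hn0 hl] /andP[hN0 hM]] hdg.
pose X := I :|: ([set x in a] :|: [set x in b]).
have inX x : (x \in X) = [|| x \in I, x \in a | x \in b] by rewrite !inE.
have hdX x : x \in X -> beta * #|I|%:R <= (dg e I x)%:R by rewrite inX; apply: hdg.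
have cX : (#|X| <= 3 * #|I|)%N.
  apply: leq_trans (leq_card_setU _ _) _; rewrite mulSn leq_add //.
  apply: leq_trans (leq_card_setU _ _) _; rewrite mulSn mul1n.
  by apply: leq_add; rewrite cardsE (leq_trans (card_size _)) // ?sa ?sb.
have [R0 [R0I R01 R02 R0dg]] := Hres T e I X beta hq1 cX hdX.
have e2 : (0 < 2 ^ j)%N by rewrite expn_gt0.
have R0M : (M + L <= #|R0|)%N.
  by apply: ltnW; rewrite -ltnS -(ltn_pmul2r e2) (leq_ltn_trans hM).
pose V := I :\: R0.
have hsmall : (#|R0| * (c0 + 1))%:R <= eta / 16 * #|I|%:R.
  rewrite natrM natrD; move: R01; rewrite -(ler_nat R) natrM => R01.
  have h1 : 0 <= #|R0|%:R :> R by [].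
  have := ler_wpM2r h1 hj; have := ler_wpM2l (ltW eta0) R01; lra.
have IV : I :\: V = R0 by rewrite /V setDDr setDv set0U (setIidPr R0I).
have [|||A [g [AV hA sg hg hp]]] := Habs T e I V a es sa pa (subsetDl _ _) hn0 _ (enum R0).
- move=> x hx; have : x \in X by rewrite inX; case/orP: hx => ->; rewrite ?orbT.
  by move/hdX; apply: le_trans; rewrite ler_wpM2r.
- by move=> x; rewrite mem_enum; apply: (subsetP R0I).
- rewrite IV -cardE -natrD -[X in (_ + X)%N]muln1 -mulnDr; apply: le_trans hsmall _.
  rewrite ler_wpM2r //; lra.
rewrite -cardE in hA.
pose H := V :\: A.
have HI : H \subset I by apply: subset_trans (subsetDl _ _) (subsetDl _ _).
have cIH : #|I :\: H|%:R <= eta / 16 * #|I|%:R.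
  apply: le_trans hsmall; rewrite ler_nat mulnDr muln1 addnC.
  rewrite -(cardsID R0 (I :\: H)) leq_add //.
    by apply: subset_leq_card; apply/subsetP => x; rewrite !inE => /andP[].
  apply: leq_trans hA; apply: subset_leq_card; apply/subsetP => x.
  by rewrite !inE => /and3P[h1 h2 h3]; move: h2; rewrite h1 h3 !andbT negbK.
have hI0 : 0 <= #|I|%:R :> R by [].
have Hdg x : x \in X -> (beta - eta / 4) * #|H|%:R <= (dg e H x)%:R.
  move/hdX; apply: dg_sub => //; first lra.
  by apply: le_trans cIH _; rewrite ler_wpM2r //; lra.
have cH : (maxn N0 l <= #|H|)%N.
  have h4 : #|I|%:R = #|H|%:R + #|I :\: H|%:R :> R.
    by rewrite -natrD -(cardsID H I) (setIidPr HI).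
  rewrite -(ler_nat R); move: hN0; rewrite -(ler_nat R) natrM => hN0.
  nra.
have [|c pc ppc] := hbb T e es ei H (leq_trans (leq_maxl _ _) cH).
  by move=> x hx; apply: Hdg; rewrite inX (subsetP HI).
have sc : (l <= size c)%N by rewrite (perm_size pc) -cardE; apply: leq_trans cH; exact: leq_maxr.
have cX' x : x \in c -> x \in X.
  by rewrite (perm_mem pc) mem_enum inX => /(subsetP HI) ->.
have gX x : x \in g -> x \in X.
  by rewrite inX => /hg /orP[/(subsetP AV)/setDP[->]|->]; rewrite ?orbT.
have R0X x : x \in R0 -> x \in X by rewrite inX => /(subsetP R0I) ->.
have pg : ppath l e g.
  by have [s [P [_ h1]]] := hp pred0; rewrite -h1 => /ppath_cat /andP[].
pose c1 := take l c; pose c2 := drop (size c - l) c.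
have sc2 : size c2 = l by rewrite size_drop subKn.
have [|||w1 [sw1 uw1 w1R pw1]] := Hcon T e R0 g c1 es sg (size_takel sc) pg.
- by move: ppc; rewrite -{1}(cat_take_drop l c) => /ppath_cat /andP[].
- by apply: leq_trans R0M; rewrite /M; clear; lia.
- move=> x hx; have {}hx : x \in X.
    by case/or3P: hx => [/R0X|/gX|/mem_take /cX'].
  by apply: le_trans (R0dg x hx); rewrite ler_wpM2r //; move: hbeta cr0 eta0; clear; lra.
pose R2 := R0 :\: [set x in w1].
have R2R0 : R2 \subset R0 by apply: subsetDl.
have cR2 : (#|R0 :\: R2| <= L)%N.
  rewrite -sw1 (leq_trans _ (card_size w1)) //; apply: subset_leq_card; apply/subsetP => x.
  by rewrite !inE => /andP[h1 h2]; move: h1; rewrite h2 andbT negbK.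
have [||||w2 [sw2 uw2 w2R pw2]] := Hcon T e R2 c2 b es sc2 sb.
- by move: ppc; rewrite -{1}(cat_take_drop (size c - l) c) => /ppath_cat /andP[].
- exact: pb.
- have := cardsID R2 R0; rewrite (setIidPr R2R0); move: cR2 R0M; rewrite /M; clear; lia.
- move=> x hx; have {}hx : x \in X.
    case/or3P: hx => [/(subsetP R2R0)/R0X|/mem_drop/cX'|] //.
    by rewrite inX => ->; rewrite !orbT.
  have h1 : 0 <= beta - eta / 4 - eta / 4 by move: hbeta cr0 eta0; clear; lra.
  apply: le_trans (dg_sub R2R0 h1 _ (R0dg x hx)); first by rewrite ler_wpM2r //; move: hbeta cr0 eta0; clear; lra.
  have : m2%:R <= #|R0|%:R :> R.
    by rewrite ler_nat; apply: leq_trans R0M; rewrite /M; clear; lia.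
  move/(le_trans hm2); rewrite ler_pdivrMr // => h2.
  apply: (@le_trans _ _ L%:R); first by rewrite ler_nat.
  lra.
have w2w1 x : x \in w2 -> (x \in R0) && (x \notin w1).
  by move/w2R; rewrite !inE => /andP[-> ->].
pose p x := (x \notin w1) && (x \notin w2).
have [s [P [ps hP pps]]] := hp p.
exists (s ++ w1 ++ c ++ w2).
  have dAH : [disjoint A & H] by rewrite disjoint_sym disjoints_subset; apply/subsetP => x; rewrite !inE => /andP[].
  have dRV : [disjoint R0 & A :|: H].
    rewrite disjoint_sym disjoints_subset; apply/subsetP => x; rewrite !inE.
    by case/orP => [/(subsetP AV)|/andP[_]]; rewrite ?inE => /andP[].
  have IE : I = R0 :|: (A :|: H).
    apply/setP => x; rewrite !inE.
    have [/(subsetP R0I) ->|_] := boolP (x \in R0) => //=.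
    by have [/(subsetP AV)|] := boolP (x \in A) => //=; rewrite inE => /andP[_ ->].
  have pw : perm_eq (filter (predC p) (enum R0)) (w1 ++ w2).
    apply: uniq_perm; first by rewrite filter_uniq ?enum_uniq.
      rewrite cat_uniq uw1 uw2 andbT /=; apply/hasPn => x /w2w1 /andP[_ ->] //.
    move=> x; rewrite mem_filter mem_enum mem_cat /= /p negb_and !negbK.
    case h1: (x \in w1) => /=; first by rewrite w1R.
    by case h2: (x \in w2) => //=; have /andP[->] := w2w1 _ h2.
  apply/permP => q; rewrite IE (permP (perm_enumU dRV)) !count_cat (permP (perm_enumU dAH)).
  rewrite !count_cat (permP ps) !count_cat (permP pc).
  have -> : count q (enum R0) = (count q (filter p (enum R0)) + count q (w1 ++ w2))%N.
    by rewrite -(permP pw) -count_cat; apply/esym/permP; rewrite perm_filterC.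
  rewrite count_cat; set u := count q (enum A); set v := count q (enum H).
  by move: u v (count q _) (count q w1) (count q w2); clear; lia.
have -> : a ++ (s ++ w1 ++ c ++ w2) ++ b = P ++ g ++ w1 ++ c ++ w2 ++ b.
  by rewrite (catA P) hP -!catA.
apply: ppath_glue; rewrite ?sg ?hP //.
rewrite -{1}(cat_take_drop l c) -!catA catA.
apply: ppath_glue; rewrite ?(size_takel sc) -?catA // catA cat_take_drop.
rewrite -{1}(cat_take_drop (size c - l) c) -!catA.
by apply: ppath_glue; rewrite ?sc2 // cat_take_drop.
Qed.

End HamConnected.

(** * Spread distributions *)

Section Dist.
Variable R : realType.

(* A finitely supported distribution is a list of weighted values, in which
   values may repeat. *)
Definition pr (A : Type) (d : seq (R * A)) (P : pred A) : R := \sum_(x <- d | P x.2) x.1.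

Definition dist_on (A : eqType) (d : seq (R * A)) (Q : A -> Prop) : Prop :=
  (forall x, x \in d -> 0 <= x.1 /\ Q x.2) /\ pr d predT = 1.

Definition dbind (A B : Type) (d : seq (R * A)) (f : A -> seq (R * B)) : seq (R * B) :=
  flatten [seq [seq (x.1 * y.1, y.2) | y <- f x.2] | x <- d].

Definition dunif (A : Type) (s : seq A) : seq (R * A) := [seq ((size s)%:R^-1, x) | x <- s].

Lemma pr_bind (A B : Type) (d : seq (R * A)) (f : A -> seq (R * B)) P :
  pr (dbind d f) P = \sum_(x <- d) x.1 * pr (f x.2) P.
Proof.
rewrite /pr /dbind big_flatten /= big_map; apply: eq_bigr => x _.
by rewrite big_map big_distrr.
Qed.

Lemma dist_bind (A B : eqType) (d : seq (R * A)) (f : A -> seq (R * B)) Q Q' :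
  dist_on d Q -> (forall a, Q a -> dist_on (f a) Q') -> dist_on (dbind d f) Q'.
Proof.
move=> [h1 h2] hf; split.
  move=> z /flatten_mapP[x hx /mapP[y hy ->]] /=; have [x0 /hf [h3 _]] := h1 x hx.
  by have [y0 hQ] := h3 y hy; rewrite mulr_ge0.
rewrite pr_bind -h2 big_seq_cond [RHS]big_seq_cond; apply: eq_bigr => x /andP[hx _].
by have [_ /hf [_ ->]] := h1 x hx; rewrite mulr1.
Qed.

Lemma pr_unif (A : Type) (s : seq A) P : pr (dunif s) P = (count P s)%:R / (size s)%:R.
Proof. by rewrite /pr /dunif big_map /= big_const_seq iter_addr_0 mulr_natl. Qed.

Lemma dist_unif (A : eqType) (s : seq A) (Q : A -> Prop) : (0 < size s)%N ->
  (forall a, a \in s -> Q a) -> dist_on (dunif s) Q.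
Proof.
move=> s0 h; split; first by move=> _ /mapP[x hx ->] /=; split; [rewrite invr_ge0|apply: h].
by rewrite pr_unif count_predT divff // pnatr_eq0 -lt0n.
Qed.

Lemma pr_ge0 (A : eqType) (d : seq (R * A)) Q P : dist_on d Q -> 0 <= pr d P.
Proof. by move=> [h _]; rewrite /pr big_seq_cond sumr_ge0 // => x /andP[/h[]]. Qed.

Lemma pr_le (A : eqType) (d : seq (R * A)) Q (P P' : pred A) : dist_on d Q ->
  (forall a, Q a -> P a -> P' a) -> pr d P <= pr d P'.
Proof.
move=> [h _] hP; rewrite /pr !(big_mkcond (fun x : R * A => _ x.2)) !big_seq.
apply: ler_sum => x /h [x0 hQ]; case: ifP => [/(hP _ hQ) -> //|_].
by case: ifP.
Qed.

Lemma pr_le1 (A : eqType) (d : seq (R * A)) Q P : dist_on d Q -> pr d P <= 1.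
Proof. by move=> h; have [_ <-] := h; apply: pr_le h _. Qed.

Lemma pr_eq0 (A : eqType) (d : seq (R * A)) Q P : dist_on d Q ->
  (forall a, Q a -> ~~ P a) -> pr d P = 0.
Proof.
move=> [h _] hP; rewrite /pr big_seq_cond big1 // => x /andP[/h [_ /hP]].
by move=> /negbTE ->.
Qed.

(** Two-stage estimate: the first stage must satisfy [P'], and given its outcome the event has
    probability at most [c]. *)
Lemma pr_bind_le (A B : eqType) (d : seq (R * A)) (f : A -> seq (R * B)) Q P P' (c : R) :
  dist_on d Q -> (forall a, Q a -> pr (f a) P <= if P' a then c else 0) ->
  pr (dbind d f) P <= pr d P' * c.
Proof.
move=> [h _] hf; rewrite pr_bind /pr big_distrl /= [leRHS]big_mkcond !big_seq.
apply: ler_sum => x /h [x0 /hf]; case: ifP => _ hc.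
  exact: ler_wpM2l.
by rewrite mulr_ge0_le0.
Qed.

Lemma dist_dirac (A : eqType) (a : A) (Q : A -> Prop) : Q a -> dist_on [:: (1 : R, a)] Q.
Proof.
move=> h; split; first by move=> x; rewrite inE => /eqP -> /=; rewrite ler01.
by rewrite /pr big_seq1.
Qed.

End Dist.

(** * Falling factorials and random splits *)

Section Falling.
Variable R : realType.

(** As a function of [a] the right side first increases, as long as x (h + 1 - a) is at least 1, and
    then decreases. So it is smallest at an end, where it is [h.+1] or [(1 + x) ^+ h]. *)
Lemma geom_vs_linear (x : R) h a : 0 <= x -> (a <= h)%N ->
  h.+1%:R <= (1 + x) ^+ h -> h.+1%:R <= (1 + x) ^+ a * (h.+1 - a)%:R.
Proof.
move=> x0 ah hh; have c0 : 0 < 1 + x by lra.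
have [hx|hx] := lerP 1 (x * (h.+1 - a)%:R).
  elim: a ah hx => [|a IH] ah hx; first by rewrite expr0 mul1r subn0.
  have hs : (h.+1 - a)%:R = (h.+1 - a.+1)%:R + 1 :> R.
    by rewrite natr1; congr _%:R; lia.
  have hx2 : 1 <= x * (h.+1 - a)%:R by rewrite hs; lra.
  apply: le_trans (IH (ltnW ah) hx2) _; rewrite exprSr -mulrA.
  by rewrite ler_wpM2l ?exprn_ge0 ?(ltW c0) // hs; lra.
have {hx ah} : (a <= h)%N && (x * (h - a)%:R <= 1).
  rewrite ah /= (le_trans _ (ltW hx)) // ler_wpM2l // ler_nat; lia.
move En : (h - a)%N => n; elim: n a En => [|n IH] a En /andP[ah hx].
  have -> : a = h by lia.
  by rewrite subSnn mulr1.
apply: (@le_trans _ _ ((1 + x) ^+ a.+1 * (h.+1 - a.+1)%:R)).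
  apply: IH; first by lia.
  apply/andP; split; first by lia.
  by apply: le_trans hx; rewrite ler_wpM2l // ler_nat.
rewrite exprSr -mulrA ler_wpM2l ?exprn_ge0 ?(ltW c0) //.
have -> : (h.+1 - a.+1 = n.+1)%N by lia.
have -> : (h.+1 - a)%:R = n.+1%:R + 1 :> R by rewrite natr1; congr _%:R; lia.
lra.
Qed.

(** Bernoulli's inequality for half of the exponent, squared, gives a term m^2 x^2 with m = h / 2
    rounded down, and m x^2 is at least 4. *)
Lemma geom_ge_linear (x : R) h : 0 <= x -> (3 <= h)%N -> 12 <= x ^+ 2 * h%:R ->
  h.+1%:R <= (1 + x) ^+ h.
Proof.
move=> x0 h3 hx; have c1 : 1 <= 1 + x by lra.
pose m := h./2; have hm : (m * 2 <= h)%N /\ (h < (m * 2).+2)%N by rewrite /m; split; lia.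
have m1 : (1 <= m)%N by rewrite /m; lia.
apply: (@le_trans _ _ ((1 + x) ^+ (m * 2))); last by rewrite ler_weXn2l //; case: hm.
have bern : 1 + m%:R * x <= (1 + x) ^+ m.
  elim: (m) => [|k IHk]; first by rewrite mul0r addr0 expr0.
  rewrite exprS; have := ler_wpM2l (ltac:(lra) : 0 <= 1 + x) IHk.
  apply: le_trans; rewrite -natr1; have : 0 <= k%:R * x ^+ 2 by rewrite mulr_ge0 ?sqr_ge0.
  nra.
have hh : h.+1%:R <= m%:R * 2 + 2 :> R by rewrite -natrM -natrD ler_nat; lia.
have hh' : h%:R <= m%:R * 3 :> R by rewrite -natrM ler_nat; lia.
have m1' : 1 <= m%:R :> R by rewrite ler1n.
rewrite exprM; apply: le_trans hh _.
have mx0 : 0 <= 1 + m%:R * x by rewrite addr_ge0 ?mulr_ge0.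
apply: (@le_trans _ _ ((1 + m%:R * x) ^+ 2)); last by rewrite lerXn2r // nnegrE (le_trans mx0).
have hxm : 4 <= x ^+ 2 * m%:R.
  have := ler_wpM2l (sqr_ge0 x) hh'; lra.
have := ler_wpM2r (le_trans ler01 m1') hxm; have := mulr_ge0 (ler0n R m) x0.
nra.
Qed.

(** Raising the base from n to n + 1 multiplies the falling factorial by (n + 1) / (n + 1 - a), at
    most [(1 + x) ^+ a] by the two preceding estimates. This accounts for the [l] vertices that a
    link takes out of each half. *)
Lemma ffact_shift (x : R) h l a : 0 <= x -> (3 <= h)%N -> 12 <= x ^+ 2 * h%:R -> (a <= h)%N ->
  ((h + l) ^_ a)%:R <= (1 + x) ^+ (l * a) * (h ^_ a)%:R.
Proof.
move=> x0 h3 hx ah; have c0 : 0 < 1 + x by lra.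
elim: l => [|l IH]; first by rewrite mul0n expr0 mul1r addn0.
set n := (h + l)%N in IH *.
have hn : (h <= n)%N by rewrite leq_addr.
have G : n.+1%:R <= (1 + x) ^+ a * (n.+1 - a)%:R.
  apply: geom_vs_linear => //; first exact: leq_trans hn.
  apply: geom_ge_linear => //; first exact: leq_trans hn.
  by apply: le_trans hx _; rewrite ler_wpM2l ?sqr_ge0 // ler_nat.
have na : 0 < (n.+1 - a)%:R :> R by rewrite ltr0n subn_gt0 ltnS (leq_trans ah).
rewrite addnS -/n -(ler_pM2r na) -natrM -ffactnSr ffactSS natrM.
apply: (@le_trans _ _ (((1 + x) ^+ a * (n.+1 - a)%:R) * (n ^_ a)%:R)); first by rewrite ler_wpM2r.
rewrite mulSn exprD -!mulrA ler_wpM2l ?exprn_ge0 ?(ltW c0) //.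
by rewrite mulrA [X in X <= _]mulrC ler_wpM2r ?(ltW na).
Qed.

End Falling.

Lemma ffact_le_exp n m : (n ^_ m <= n ^ m)%N.
Proof.
elim: m n => [|m IH] n; first by rewrite ffactn0.
case: n => [|n]; first by rewrite ffact0n.
by rewrite ffactSS expnS leq_mul2l /= (leq_trans (IH n)) //; case: (m) => // k; rewrite leq_exp2r.
Qed.

(** A random split sends [a] given elements to the left and [b] others to the right with probability
    exactly N1^_a N2^_b / (N1 + N2)^_(a + b). *)
Lemma bin_ffact_split N1 N2 a b : (a <= N1)%N -> (b <= N2)%N ->
  ('C(N1 + N2 - (a + b), N1 - a) * (N1 + N2) ^_ (a + b) = 'C(N1 + N2, N1) * (N1 ^_ a * N2 ^_ b))%N.
Proof.
move=> ha hb; have f0 : (0 < (N1 - a)`! * (N2 - b)`!)%N by rewrite muln_gt0 !fact_gt0.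
apply/eqP; rewrite -(eqn_pmul2r f0); apply/eqP.
transitivity (N1 + N2)`!.
  have := @bin_fact (N1 + N2 - (a + b)) (N1 - a) (ltac:(lia)).
  have -> : (N1 + N2 - (a + b) - (N1 - a) = N2 - b)%N by lia.
  have := @ffact_fact (N1 + N2) (a + b) (ltac:(lia)).
  by move=> <- <-; rewrite [RHS]mulnCA [RHS]mulnA.
have := @bin_fact (N1 + N2) N1 (leq_addr _ _); rewrite addKn => <-.
by rewrite -(ffact_fact ha) -(ffact_fact hb) -(mulnA 'C(_, _)); congr (_ * _)%N; rewrite mulnACA.
Qed.

Section Split.
Variable T : finType.

Lemma card_split_sets (I Y1 Y2 : {set T}) k : Y1 \subset I -> Y2 \subset I -> [disjoint Y1 & Y2] ->
  (#|[set J : {set T} | [&& J \subset I, #|J| == k, Y1 \subset J & Y2 \subset I :\: J]]|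
    <= 'C(#|I| - (#|Y1| + #|Y2|), k - #|Y1|))%N.
Proof.
move=> Y1I Y2I dY.
have -> : (#|I| - (#|Y1| + #|Y2|))%N = #|I :\: (Y1 :|: Y2)|.
  by rewrite cardsDS ?subUset ?Y1I // cardsU disjoint_setI0 // cards0 subn0.
rewrite -cards_draws -(card_in_imset (f := fun J => J :\: Y1)).
  apply: subset_leq_card; apply/subsetP => K /imsetP[J]; rewrite !inE.
  case/and4P=> JI /eqP hJ Y1J Y2J ->; rewrite cardsDS // hJ eqxx andbT.
  apply/subsetP => x; rewrite !inE => /andP[xY1 xJ]; rewrite (subsetP JI _ xJ) (negbTE xY1) andbT /=.
  by apply/negP => /(subsetP Y2J); rewrite inE xJ.
move=> J J'; rewrite !inE => /and4P[_ _ h _] /and4P[_ _ h' _] e.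
by rewrite -(setID J Y1) -(setID J' Y1) (setIidPr h) (setIidPr h') e.
Qed.

End Split.

Definition ceil_div (m H : nat) : nat := ((m + H.-1) %/ H)%N.

Lemma size_sel_ratio (T : finType) l (e : rel T) H (Js : seq {set T}) : (0 < H)%N ->
  (forall (J : {set T}) (z : seq T), J \in Js -> (size z < size Js)%N -> uniq z ->
     {in z, forall y, exists2 J' : {set T}, J' \in Js & y \in J'} ->
     (#|J| <= H * #|cand l e J z|)%N) ->
  (\prod_(J <- Js) #|J| <= H ^ size Js * size (sel l e Js))%N.
Proof.
move=> H0 h.
have hk m : (m <= H * ceil_div m H)%N.
  rewrite /ceil_div; have := divn_eq (m + H.-1) H; have := ltn_pmod (m + H.-1) H0; lia.
have hk2 m c : (m <= H * c)%N -> (ceil_div m H <= c)%N.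
  move=> hm; rewrite /ceil_div -ltnS ltn_divLR //; lia.
apply: (@leq_trans (\prod_(J <- Js) (H * ceil_div #|J| H))%N).
  by apply: leq_prod => J _; apply: hk.
rewrite big_split /= big_const_seq count_predT iter_muln_1 leq_mul2l; apply/orP; right.
by apply: size_sel => J z h1 h2 h3 h4; apply: hk2; apply: h.
Qed.

Lemma prod_uniq_ord (F : nat -> nat) n (D : seq nat) : uniq D -> all (fun i => i < n)%N D ->
  (\prod_(i < n | nat_of_ord i \in D) F i = \prod_(i <- D) F i)%N.
Proof.
move=> uD hD; rewrite -(big_mkord (fun i => i \in D)) -big_filter; apply: perm_big.
apply: uniq_perm => //; first by rewrite filter_uniq ?iota_uniq.
move=> i; rewrite mem_filter mem_index_iota /=.
by case h: (i \in D) => //=; apply: (allP hD).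
Qed.

Section Selection.
Variables (R : realType) (T : finType) (l : nat) (e : rel T) (x0 : T).

(** Ratio of [count_sel] and [size_sel_ratio]. The loss [H ^ size Js] occurs once; for nonempty [D]
    it is charged to every position, so as to have a bound with one factor per position. *)
Lemma sel_spread H (Js : seq {set T}) : (0 < H)%N -> {in Js, forall J : {set T}, (0 < #|J|)%N} ->
  (forall (J : {set T}) (z : seq T), J \in Js -> (size z < size Js)%N -> uniq z ->
     {in z, forall y, exists2 J' : {set T}, J' \in Js & y \in J'} ->
     (#|J| <= H * #|cand l e J z|)%N) ->
  (0 < size (sel l e Js))%N /\
  forall (D : seq nat) (y : nat -> T), uniq D -> all (fun i => i < size Js)%N D ->
    pr (dunif R (sel l e Js)) (fun z => all (fun i => nth x0 z i == y i) D) <=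
    (H ^ size Js)%:R ^+ size D / (\prod_(i <- D) #|nth set0 Js i|)%:R.
Proof.
move=> H0 Js0 hc; have hs := size_sel_ratio H0 hc.
have p0 : (0 < \prod_(J <- Js) #|J|)%N.
  by rewrite big_seq; elim/big_rec: _ => // J n hJ; rewrite muln_gt0 Js0.
have s0 : (0 < size (sel l e Js))%N.
  by have := leq_trans p0 hs; rewrite muln_gt0 => /andP[].
split=> // D y uD hD; set n := size Js in hs hD hc *.
have [D0|D1] := posnP (size D).
  by rewrite (size0nil D0) big_nil expr0 divr1; apply: pr_le1; apply: (dist_unif R (Q := fun=> True)).
rewrite pr_unif; set S := size _ in s0 hs *.
have hcount : (count (fun z => all (fun i => nth x0 z i == y i) D) (sel l e Js) <=
    \prod_(i < n | nat_of_ord i \notin D) #|nth set0 Js i|)%N.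
  apply: leq_trans (count_sel l e x0 y (mem D) Js); apply: sub_count => z /allP h.
  by apply/forallP => i; apply/implyP => /h.
have hp : (\prod_(J <- Js) #|J| = \prod_(i < n | nat_of_ord i \notin D) #|nth set0 Js i| *
    \prod_(i <- D) #|nth set0 Js i|)%N.
  rewrite -(prod_uniq_ord _ uD hD) (big_nth set0) big_mkord (bigID (fun i : 'I_n => nat_of_ord i \in D)) /=.
  by rewrite mulnC.
set cn := count _ _ in hcount *; set pD := (\prod_(i <- D) _)%N in hp *.
have pD0 : (0 < pD)%N by move: p0; rewrite hp muln_gt0 => /andP[].
rewrite ler_pdivrMr ?ltr0n // mulrAC ler_pdivlMr ?ltr0n // -natrX -!natrM ler_nat.
apply: (@leq_trans (\prod_(i < n | nat_of_ord i \notin D) #|nth set0 Js i| * pD)); first by rewrite leq_mul2r hcount orbT.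
rewrite -hp; apply: leq_trans hs _; rewrite leq_mul2r; apply/orP; right.
by rewrite -expnM leq_pexp2l // leq_pmulr.
Qed.

End Selection.

Section SpreadStep.
Variables (R : realType) (T : finType) (l : nat) (e : rel T) (x0 : T).
Hypothesis es : symmetric e.

Definition agrees (y : nat -> T) (D : seq nat) (w : seq T) := all (fun i => nth x0 w i == y i) D.

(** A uniformly random ordering satisfies this with [kappa = 1]. With falling factorials in place of
    powers of [q], the bounds for two halves combine without loss under a random split, by
    [bin_ffact_split]. *)
Definition spread (kappa : R) (q : nat) (d : seq (R * seq T)) : Prop :=
  forall (D : seq nat) (y : nat -> T), uniq D -> all (fun i => i < q)%N D ->
    pr d (agrees y D) <= kappa ^+ size D / (q ^_ size D)%:R.

Definition spread_paths (beta kappa : R) (q : nat) : Prop :=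
  forall (I : {set T}) (a b : seq T), #|I| = q -> size a = l -> size b = l ->
  ppath l e a -> ppath l e b ->
  (forall x, [|| x \in I, x \in a | x \in b] -> beta * q%:R <= (dg e I x)%:R) ->
  exists2 d : seq (R * seq T),
    dist_on d (fun w => perm_eq w (enum I) /\ ppath l e (a ++ w ++ b)) & spread kappa q d.

Lemma ffact_add_le n a a' : (n ^_ (a + a') <= n ^_ a * n ^ a')%N.
Proof.
elim: a' => [|a' IH]; first by rewrite addn0 muln1.
by rewrite addnS ffactnSr expnSr mulnA; apply: leq_mul; rewrite ?leq_subr.
Qed.

(** The link joins the two halves of a split: its first [l] vertices end the path in [J], its last
    [l] vertices start the path in [K]. It is a uniformly random selection. *)
Lemma link_spread (eta : R) h (J K : {set T}) : 0 < eta -> eta^-1 <= h%:R ->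
  (4 * h * l < #|J|)%N -> (4 * h * l < #|K|)%N ->
  (forall x, x \in J :|: K -> (crit R l + eta) * #|J|%:R <= (dg e J x)%:R /\
     (crit R l + eta) * #|K|%:R <= (dg e K x)%:R) ->
  exists2 d : seq (R * seq T),
    dist_on d (fun z => [/\ size z = (l + l)%N, uniq z, ppath l e z,
      {subset take l z <= J} & {subset drop l z <= K}]) &
    forall (D : seq nat) (y : nat -> T), uniq D -> all (fun i => i < l + l)%N D ->
      pr d (agrees y D) <= ((2 * h) ^ (l + l))%:R ^+ size D /
        (#|J| ^ count (fun i => i < l)%N D * #|K| ^ count (fun i => l <= i)%N D)%:R.
Proof.
move=> eta0 hh hJ hK hdg; pose Js := nseq l J ++ nseq l K.
have sJs : size Js = (l + l)%N by rewrite size_cat !size_nseq.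
have h0 : (0 < 2 * h)%N.
  by rewrite muln_gt0 /= -(ltr_nat R); apply: lt_le_trans hh; rewrite invr_gt0.
have memJs J' : J' \in Js -> J' = J \/ J' = K.
  by rewrite mem_cat => /orP[/nseqP[-> _]|/nseqP[-> _]]; [left|right].
have nthJs i : (i < l + l)%N -> nth set0 Js i = if (i < l)%N then J else K.
  by move=> hi; rewrite nth_cat size_nseq; case: ltnP => h1; rewrite nth_nseq ?h1 //; case: ifP => //; lia.
have pos : {in Js, forall J : {set T}, (0 < #|J|)%N}.
  by move=> J' /memJs [->|->]; [apply: leq_ltn_trans hJ|apply: leq_ltn_trans hK].
have [|s0 hsp] := @sel_spread R T l e x0 (2 * h) Js h0 pos.
  move=> J' z J'Js sz uz hz.
  have hJ' : (4 * h * l < #|J'|)%N by case: (memJs _ J'Js) => ->.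
  have hcom : (#|J'| <= h * #|common e J' (take l z)|)%N.
    apply: (@common_crit R l eta h eta0 hh T e J' _ es); first by rewrite size_take_min leqW ?geq_minl.
    move=> x /mem_take /hz [J2 J2Js xJ2].
    have xJK : x \in J :|: K by rewrite inE; case: (memJs _ J2Js) xJ2 => -> ->; rewrite ?orbT.
    by have [h1 h2] := hdg x xJK; case: (memJs _ J'Js) => ->.
  have hc2 : (#|common e J' (take l z)| <= #|cand l e J' z| + size z)%N.
    rewrite -(cardsID [set x in z] (common e J' (take l z))) addnC leq_add //.
      by apply: subset_leq_card; apply/subsetP => x; rewrite !inE => /and3P[-> -> ->].
    by apply: leq_trans (subset_leq_card (subsetIr _ _)) _; rewrite cardsE card_size.
  (* Fewer than 2l vertices are in use, at most half of the more than 4l common neighbours; this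
     turns [h] into [2 * h]. *)
  rewrite sJs in sz; move: hcom hc2 sz hJ'; clear; nia.
exists (dunif R (sel l e Js)).
  apply: dist_unif => // z /mem_sel [h1 h2 h3 h4]; split=> //; first by rewrite h1.
    move=> x /(nthP x0) [i]; rewrite size_takel ?h1 ?sJs ?leq_addr // => hi <-.
    by rewrite nth_take //; have := h4 x0 i; rewrite sJs nthJs ?hi ?ltn_addr //; apply.
  move=> x /(nthP x0) [i]; rewrite size_drop h1 sJs addnK => hi <-.
  rewrite nth_drop; have := h4 x0 (l + i)%N; rewrite sJs ltn_add2l nthJs ?ltn_add2l //.
  by rewrite [(l + i < l)%N]ltnNge leq_addr /=; apply.
move=> D y uD hD; have := hsp D y uD; rewrite sJs => /(_ hD).
congr (_ <= _ / _%:R).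
rewrite (bigID (fun i => i < l)%N) /=; congr (_ * _)%N.
  rewrite -big_filter -size_filter; set Df := filter _ _.
  rewrite (eq_big_seq (fun=> #|J|)); last first.
    by move=> i; rewrite mem_filter => /andP[hi /(allP hD) hi2]; rewrite nthJs // hi.
  by rewrite big_const_seq count_predT iter_muln_1.
rewrite (eq_bigl (fun i => l <= i)%N); last by move=> i; rewrite -leqNgt.
rewrite -big_filter -size_filter; set Df := filter _ _.
rewrite (eq_big_seq (fun=> #|K|)); last first.
  move=> i; rewrite mem_filter => /andP[hi /(allP hD) hi2].
  by rewrite nthJs // ltnNge hi.
by rewrite big_const_seq count_predT iter_muln_1.
Qed.

End SpreadStep.

Lemma all_count_add (N : nat) (D : seq nat) :
  (count (fun i => i < N) D + count (fun i => N <= i) D = size D)%N.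
Proof.
rewrite -(count_predC (fun i => i < N)%N D); congr (_ + _)%N.
by apply: eq_count => i /=; rewrite -leqNgt.
Qed.

Section Halves.
Variables (R : realType) (T : finType) (e : rel T) (x0 : T).

Lemma good_split_many (I X : {set T}) (b xi x : R) c : 0 < xi -> xi <= 1 ->
  2 <= xi * #|I|%:R -> (#|X| <= c)%N ->
  4 * c%:R * #|I|.+1%:R * expR (- (xi ^+ 2 * #|I|%:R / 32)) <= x / 2 ->
  (forall v, v \in X -> b * #|I|%:R <= (dg e I v)%:R) ->
  (1 - x / 2) * 'C(#|I|, #|I|./2)%:R <=
    #|[set J : {set T} | [&& J \subset I, #|J| == #|I|./2 & good_split e I X (b - xi) J]]|%:R.
Proof.
move=> xi0 xi1 hxi hX hx hdg; have hbad := bad_split_count xi0 xi1 hxi hdg.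
set S := [set J : {set T} | (J \subset I) && (#|J| == #|I|./2)].
have hS : #|S| = 'C(#|I|, #|I|./2)%N by apply: cards_draws.
have := cardsID [set J | good_split e I X (b - xi) J] S.
have -> : S :&: [set J | good_split e I X (b - xi) J] =
    [set J : {set T} | [&& J \subset I, #|J| == #|I|./2 & good_split e I X (b - xi) J]].
  by apply/setP => J; rewrite !inE -andbA.
have -> : S :\: [set J | good_split e I X (b - xi) J] =
    [set J : {set T} | [&& J \subset I, #|J| == #|I|./2 & ~~ good_split e I X (b - xi) J]].
  by apply/setP => J; rewrite !inE andbC -andbA.
rewrite hS => /(congr1 (fun n => n%:R : R)); rewrite natrD.
set g := #|_|%:R; set bd := #|_|%:R in hbad *.
set C := 'C(_, _)%:R in hbad * => hC; have C0 : 0 <= C by [].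
set E := expR _ in hbad hx; have E0 : 0 <= E by apply: expR_ge0.
have hX' : #|X|%:R <= c%:R :> R by rewrite ler_nat.
have hXE : 4 * #|X|%:R * #|I|.+1%:R * E <= 4 * c%:R * #|I|.+1%:R * E.
  by rewrite ler_wpM2r // ler_wpM2r // ler_wpM2l.
have : bd <= x / 2 * C.
  by apply: le_trans hbad _; rewrite ler_wpM2r //; apply: le_trans hx.
move: hC; clear; lra.
Qed.

(** Prescribing the sides of [size D] different elements leaves a binomial number of splits, which
    [bin_ffact_split] turns into a share of all splits. *)
Lemma compat_count (I : {set T}) (y : nat -> T) (D : seq nat) N1 N2 :
  #|I| = (N1 + N2)%N -> uniq D -> uniq (map y D) ->
  (count (fun i => i < N1)%N D <= N1)%N -> (count (fun i => N1 <= i)%N D <= N2)%N ->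
  (#|[set J : {set T} | [&& J \subset I, #|J| == N1 &
      all (fun i => y i \in if (i < N1)%N then J else I :\: J) D]]|%:R
   <= 'C(N1 + N2, N1)%:R * (N1 ^_ count (fun i => i < N1)%N D * N2 ^_ count (fun i => N1 <= i)%N D)%:R
        / ((N1 + N2) ^_ size D)%:R :> R).
Proof.
move=> hI uD uy hA hB; set A := count _ D in hA *; set B := count _ D in hB *.
have hAB : (A + B = size D)%N by apply: all_count_add.
have f0 : 0 < ((N1 + N2) ^_ size D)%:R :> R by rewrite ltr0n ffact_gt0 -hAB leq_add.
set S := [set J | _]; have [->|[J0 hJ0]] := set_0Vmem S.
  by rewrite cards0 divr_ge0 // mulr_ge0.
rewrite -natrM ler_pdivlMr // -natrM ler_nat.
rewrite -bin_ffact_split // hAB leq_mul2r; apply/orP; right.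
pose Y1 := [set x in map y (filter (fun i => i < N1)%N D)].
pose Y2 := [set x in map y (filter (fun i => N1 <= i)%N D)].
have um p : uniq (map y (filter p D)).
  by apply: subseq_uniq uy; apply: map_subseq; apply: filter_subseq.
have c1 : #|Y1| = A.
  by rewrite cardsE (card_uniqP _) // size_map size_filter.
have c2 : #|Y2| = B.
  by rewrite cardsE (card_uniqP _) // size_map size_filter.
have sub (J : {set T}) : all (fun i => y i \in if (i < N1)%N then J else I :\: J) D ->
    (Y1 \subset J) && (Y2 \subset I :\: J).
  move=> /allP h; apply/andP; split; apply/subsetP => z; rewrite inE => /mapP[i].
    by rewrite mem_filter => /andP[hi /h + ->]; rewrite hi.
  by rewrite mem_filter => /andP[hi /h + ->]; rewrite ltnNge hi.
have := hJ0; rewrite inE => /and3P[J0I _ /sub /andP[Y1J Y2J]].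
have dY : [disjoint Y1 & Y2].
  by rewrite disjoints_subset; apply: subset_trans Y1J _; rewrite -disjoints_subset disjoint_sym disjoints_subset (subset_trans Y2J) // subsetDr.
have := @card_split_sets T I Y1 Y2 N1 (subset_trans Y1J J0I) (subset_trans Y2J (subsetDl _ _)) dY.
rewrite c1 c2 hI -hAB; apply: leq_trans; apply: subset_leq_card; apply/subsetP => J.
by rewrite !inE => /and3P[-> -> /sub].
Qed.

End Halves.

Section SpreadStep.
Variables (R : realType) (T : finType) (l : nat) (e : rel T) (x0 : T).
Hypothesis es : symmetric e.

(* The three factors bound the left path, the link and the right path. *)
Lemma step_bound (kappa x G : R) q1 q2 a b a' b' c :
  0 <= x -> 1 <= kappa -> 1 <= G -> G <= kappa -> x <= 1 ->
  (3 <= q1)%N -> (q1 <= q2)%N -> 12 <= x ^+ 2 * q1%:R -> (a <= q1)%N -> (b <= q2)%N ->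
  0 <= c -> (a' <= l)%N -> (b' <= l)%N -> (0 < a + a' + (b' + b))%N ->
  c * (1 - x / 2) <= ((q1 + l) ^_ (a + a') * (q2 + l) ^_ (b' + b))%:R /
     ((q1 + l + (q2 + l)) ^_ (a + a' + (b' + b)))%:R ->
  c * (G ^+ (a' + b') / ((q1 + l) ^ a' * (q2 + l) ^ b')%:R
       * (kappa ^+ a / (q1 ^_ a)%:R) * (kappa ^+ b / (q2 ^_ b)%:R))
  <= (kappa * (1 + x) ^+ l.+1) ^+ (a + a' + (b' + b)) / ((q1 + l + (q2 + l)) ^_ (a + a' + (b' + b)))%:R.
Proof.
move=> x_0 k1 G1 Gk x1 h3 h12 hx ha hb c0 ha' hb' s0 hc.
set s := (a + a' + (b' + b))%N in s0 hc *.
set Q := ((q1 + l + (q2 + l)) ^_ s)%:R in hc *.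
have Q0 : 0 <= Q by [].
have n0 : 0 < ((q1 + l) ^ a' * (q2 + l) ^ b')%:R :> R by rewrite ltr0n muln_gt0 !expn_gt0 !addn_gt0 (leq_trans _ h3) // (leq_trans _ (leq_trans h3 h12)).
have f1 : 0 < (q1 ^_ a)%:R :> R by rewrite ltr0n ffact_gt0.
have f2 : 0 < (q2 ^_ b)%:R :> R by rewrite ltr0n ffact_gt0.
have hx2 : 12 <= x ^+ 2 * q2%:R by apply: le_trans hx _; rewrite ler_wpM2l ?sqr_ge0 // ler_nat.
have g1 := ffact_shift l x_0 h3 hx ha.
have g2 := ffact_shift l x_0 (leq_trans h3 h12) hx2 hb.
have u0 : 0 < 1 + x by lra.
set y1 := (1 + x) ^+ (l * a) in g1; set y2 := (1 + x) ^+ (l * b) in g2.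
have y10 : 0 <= y1 by rewrite exprn_ge0 // ltW.
have y20 : 0 <= y2 by rewrite exprn_ge0 // ltW.
have F : ((q1 + l) ^_ (a + a') * (q2 + l) ^_ (b' + b))%:R <=
    y1 * y2 * ((q1 ^_ a)%:R * (q2 ^_ b)%:R * ((q1 + l) ^ a' * (q2 + l) ^ b')%:R).
  apply: (@le_trans _ _ (((q1 + l) ^_ a * (q1 + l) ^ a') * ((q2 + l) ^_ b * (q2 + l) ^ b'))%:R).
    by rewrite ler_nat [(b' + b)%N]addnC leq_mul ?ffact_add_le.
  rewrite mulnACA natrM mulrA ler_wpM2r ?(ltW n0) // natrM.
  apply: (@le_trans _ _ ((y1 * (q1 ^_ a)%:R) * (y2 * (q2 ^_ b)%:R))); last by rewrite mulrACA.
  by apply: ler_pM.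
have Gs : G ^+ (a' + b') * (kappa ^+ a * kappa ^+ b) <= kappa ^+ s.
  rewrite -exprD; have -> : kappa ^+ s = kappa ^+ (a' + b') * kappa ^+ (a + b).
    by rewrite -exprD; congr (_ ^+ _); rewrite /s; clear; lia.
  rewrite ler_wpM2r ?exprn_ge0 //; first lra.
  by rewrite lerXn2r // nnegrE; lra.
have ys : y1 * y2 <= (1 + x) ^+ (l * s).
  rewrite /y1 /y2 -exprD -mulnDr ler_weXn2l ?leq_mul2l; first by []; first lra.
  by apply/orP; right; rewrite /s; clear; lia.
(* For [x] in [0, 1] the product of [1 + x] and [1 - x / 2] is at least 1, so restricting to good
   splits costs at most [1 + x]. *)
have cb : c <= (1 + x) * (c * (1 - x / 2)).
  have : 0 <= c * (x * (1 - x)) by rewrite mulr_ge0 // mulr_ge0 //; lra.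
  nra.
set U := (_ ^ a' * _)%:R in n0 F *; set FF := (_ * _)%:R in hc F.
set f1' := (q1 ^_ a)%:R in f1 F g1 *; set f2' := (q2 ^_ b)%:R in f2 F g2 *.
have Q1 : 0 < Q.
  rewrite lt_neqAle Q0 andbT eq_sym pnatr_eq0 -lt0n ffact_gt0 /s.
  by move: ha hb ha' hb'; clear; lia.
have -> : c * (G ^+ (a' + b') / U * (kappa ^+ a / f1') * (kappa ^+ b / f2')) =
    c / (f1' * f2' * U) * (G ^+ (a' + b') * (kappa ^+ a * kappa ^+ b)).
  have E c' g ka kb (u v w : R) : u != 0 -> v != 0 -> w != 0 ->
      c' * (g / w * (ka / u) * (kb / v)) = c' / (u * v * w) * (g * (ka * kb)).
    by move=> hu hv hw; field; rewrite hu hv hw.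
  by apply: E; rewrite gt_eqF.
have h0 : 0 < f1' * f2' * U by rewrite !mulr_gt0.
have c1 : c / (f1' * f2' * U) <= (1 + x) * (y1 * y2) / Q.
  have h : c * (1 - x / 2) * Q <= y1 * y2 * (f1' * f2' * U).
    by apply: le_trans F; rewrite -ler_pdivlMr.
  rewrite ler_pdivrMr // mulrAC ler_pdivlMr // -(mulrA (1 + x)).
  apply: (@le_trans _ _ ((1 + x) * (c * (1 - x / 2) * Q))).
    by rewrite [leRHS]mulrA ler_wpM2r.
  by apply: ler_wpM2l; rewrite ?(ltW u0).
apply: (@le_trans _ _ ((1 + x) * (y1 * y2) / Q * kappa ^+ s)).
  apply: ler_pM => //; first by rewrite divr_ge0 // ltW.
  by rewrite !mulr_ge0 ?exprn_ge0 //; lra.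
rewrite exprMn mulrAC; apply: ler_wpM2r; first by rewrite invr_ge0.
rewrite mulrC; apply: ler_wpM2l; first by rewrite exprn_ge0 //; lra.
(* Shifting falling factorials costs (1 + x)^(l s), and the restriction to good splits a single
   factor [1 + x], at most (1 + x)^s since [s] is positive. This explains the exponent [l.+1] per
   position. *)
rewrite -exprM mulSn exprD; apply: ler_pM => //; try lra.
  by rewrite mulr_ge0.
by rewrite -{1}[1 + x]expr1 ler_weXn2l //; lra.
Qed.

End SpreadStep.

(** * Recursive halving *)

Lemma count_addE (p p1 p2 : pred nat) (D : seq nat) :
  (forall i, i \in D -> (p i : nat) = (p1 i + p2 i)%N) -> count p D = (count p1 D + count p2 D)%N.
Proof.
elim: D => [|i D IH] //= h; rewrite IH; last by move=> j hj; apply: h; rewrite inE hj orbT.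
by rewrite h ?mem_head // addnACA.
Qed.

Lemma count_range_le (D : seq nat) m n : uniq D ->
  (count (fun i => (m <= i) && (i < n)) D <= n - m)%N.
Proof.
move=> uD; rewrite -size_filter -(size_iota m (n - m)); apply: uniq_leq_size.
  exact: filter_uniq.
by move=> i; rewrite mem_filter mem_iota => /andP[/andP[h1 h2] _]; lia.
Qed.

Section SpreadStep.
Variables (R : realType) (T : finType) (l : nat) (e : rel T) (x0 : T).
Hypothesis es : symmetric e.

Definition left_of q1 D : seq nat := [seq i <- D | (i < q1)%N].
Definition mid_of q1 k D : seq nat := [seq (i - q1)%N | i <- D & (q1 <= i)%N && (i < q1 + k)%N].
Definition right_of m D : seq nat := [seq (i - m)%N | i <- D & (m <= i)%N].

Lemma agrees_split y D (w1 z w2 : seq T) : agrees x0 y D (w1 ++ z ++ w2) ->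
  [&& agrees x0 y (left_of (size w1) D) w1,
      agrees x0 (fun i => y (i + size w1)%N) (mid_of (size w1) (size z) D) z &
      agrees x0 (fun i => y (i + (size w1 + size z))%N) (right_of (size w1 + size z) D) w2].
Proof.
move=> /allP h; apply/and3P; split; apply/allP => i.
- by rewrite mem_filter => /andP[hi /h]; rewrite nth_cat hi.
- case/mapP => j; rewrite mem_filter => /andP[/andP[h1 h2] /h].
  rewrite nth_cat ltnNge h1 /= nth_cat => + ->; rewrite subnK // ifT //.
  by rewrite ltn_subLR.
case/mapP => j; rewrite mem_filter => /andP[h1 /h] + ->; rewrite subnK //.
rewrite nth_cat ltnNge (leq_trans (leq_addr _ _) h1) /= nth_cat ltnNge.
by rewrite leq_subRL ?h1 ?(leq_trans (leq_addr _ _) h1) // subnDA.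
Qed.

Lemma uniq_shift k (p : pred nat) D : uniq D -> (forall i, p i -> k <= i)%N ->
  uniq [seq (i - k)%N | i <- D & p i].
Proof.
move=> uD hp; rewrite map_inj_in_uniq ?filter_uniq // => i j.
rewrite !mem_filter => /andP[/hp hi _] /andP[/hp hj _]; lia.
Qed.

(** The random path arises in three stages: a uniform good half [J], a random link between the
    halves, and random paths through the rest of each half, with the link and [a], [b] as prescribed
    ends. Agreement with [y] splits into one event for each stage. *)
Lemma spread_step (beta beta' xi x kappa eta : R) h q1 q2 :
  0 < xi -> xi <= 1 -> 0 <= x -> x <= 1 -> (q1 <= q2 <= q1.+1)%N ->
  let q := (q1 + l + (q2 + l))%N in
  2 <= xi * q%:R ->
  4 * (q + (l + l))%:R * q.+1%:R * expR (- (xi ^+ 2 * q%:R / 32)) <= x / 2 ->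
  (3 <= q1)%N -> 12 <= x ^+ 2 * q1%:R ->
  beta' * q1%:R <= (beta - xi) * (q1 + l)%:R - l%:R ->
  beta' * q2%:R <= (beta - xi) * (q2 + l)%:R - l%:R ->
  0 < eta -> eta^-1 <= h%:R -> crit R l + eta <= beta - xi ->
  (4 * h * l < q1 + l)%N -> ((2 * h) ^ (l + l))%:R <= kappa ->
  spread_paths l e x0 beta' kappa q1 -> spread_paths l e x0 beta' kappa q2 ->
  spread_paths l e x0 beta (kappa * (1 + x) ^+ l.+1) q.
Proof.
move=> xi0 xi1 x_0 x1 /andP[q12 q21] q hxi hexp h3 hx hb1 hb2 eta0 hh hcrit hl hG S1 S2.
move=> I a b hI sa sb pa pb hdg.
have q2E : (q./2 = q1 + l)%N by rewrite /q; move: q12 q21; clear; lia.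
pose N1 := (q1 + l)%N; pose N2 := (q2 + l)%N.
pose X := I :|: ([set v in a] :|: [set v in b]).
have inX v : (v \in X) = [|| v \in I, v \in a | v \in b] by rewrite !inE.
have hdX v : v \in X -> beta * #|I|%:R <= (dg e I v)%:R by rewrite inX hI; apply: hdg.
have cX : (#|X| <= q + (l + l))%N.
  apply: leq_trans (leq_card_setU _ _) _; rewrite hI leq_add2l.
  apply: leq_trans (leq_card_setU _ _) _.
  by apply: leq_add; rewrite cardsE (leq_trans (card_size _)) // ?sa ?sb.
have h0 : (0 < h)%N by rewrite -(ltr_nat R); apply: lt_le_trans hh; rewrite invr_gt0.
pose Gd (J : {set T}) := [&& J \subset I, #|J| == N1 & good_split e I X (beta - xi) J].
have cGd : (1 - x / 2) * 'C(q, N1)%:R <= #|[set J | Gd J]|%:R.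
  have := @good_split_many R T e I X beta xi x (q + (l + l)) xi0 xi1 _ cX _ hdX.
  by rewrite /Gd hI q2E; apply.
pose Zq (J : {set T}) (z : seq T) := [/\ size z = (l + l)%N, uniq z, ppath l e z,
   {subset take l z <= J} & {subset drop l z <= I :\: J}].
have GdX J v : Gd J -> v \in X -> (beta - xi) * N1%:R <= (dg e J v)%:R /\
    (beta - xi) * N2%:R <= (dg e (I :\: J) v)%:R.
  case/and3P=> JI /eqP cJ /forall_inP hJ /hJ; rewrite cardsDS // hI cJ.
  have -> : (q - N1 = N2)%N by rewrite /q /N1 /N2 addKn.
  by case/andP.
have cJK J : Gd J -> #|J| = N1 /\ #|I :\: J| = N2.
  by case/and3P=> JI /eqP cJ _; rewrite cardsDS // hI cJ /q /N1 /N2 addKn.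
have JIs J : Gd J -> J \subset I by case/and3P.
(* The properties are put under the implication from [Gd J], so that [choice] can be applied to all
   sets; a set that is not good gets the empty list. *)
have linkJ J : exists d : seq (R * seq T), Gd J ->
    dist_on d (Zq J) /\
    forall (D : seq nat) (y : nat -> T), uniq D -> all (fun i => i < l + l)%N D ->
      pr d (agrees x0 y D) <= ((2 * h) ^ (l + l))%:R ^+ size D /
        (N1 ^ count (fun i => i < l)%N D * N2 ^ count (fun i => l <= i)%N D)%:R.
  have [hJ|hJ] := boolP (Gd J); last by exists [::].
  have [cJ cK] := cJK J hJ.
  have [||v hv|d hd1 hd2] := @link_spread R T l e x0 es eta h J (I :\: J) eta0 hh.
  - by rewrite cJ.
  - by rewrite cK (leq_trans hl) // leq_add2r.
  - have vX : v \in X.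
      by rewrite inX; move: hv; rewrite !inE => /orP[/(subsetP (JIs _ hJ))|/andP[_]] ->.
    have [g1 g2] := GdX J v hJ vX; rewrite cJ cK.
    by split; [apply: le_trans g1|apply: le_trans g2]; rewrite ler_wpM2r.
  by exists d => _; split=> // D y uD hD; have := hd2 D y uD hD; rewrite cJ cK.
have [dl Hdl] := choice linkJ.
pose I1 (J : {set T}) (z : seq T) := J :\: [set v in take l z].
pose I2 (J : {set T}) (z : seq T) := (I :\: J) :\: [set v in drop l z].
have cz (K : {set T}) (s : seq T) m : uniq s -> size s = l -> {subset s <= K} -> #|K| = (m + l)%N ->
    #|K :\: [set v in s]| = m /\ forall v (g : R), g <= (dg e K v)%:R ->
      g - l%:R <= (dg e (K :\: [set v in s]) v)%:R.
  move=> us ss sK cK.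
  have cs : #|[set v in s]| = l by rewrite cardsE (card_uniqP us).
  have sK' : [set v in s] \subset K by apply/subsetP => v; rewrite inE => /sK.
  split; first by rewrite cardsDS // cK cs addnK.
  move=> v g hg; rewrite lerBlDr; apply: le_trans hg _; rewrite -natrD ler_nat -[X in (_ <= _ + X)%N]cs.
  rewrite /dg -(cardsID [set v in s] [set y in K | e v y]) addnC leq_add //; apply: subset_leq_card.
    by apply/subsetP => u; rewrite !inE => /and3P[-> -> ->].
  exact: subsetIr.
have pathsJ (p : {set T} * seq T) : exists d : seq (R * seq T) * seq (R * seq T),
    Gd p.1 -> Zq p.1 p.2 ->
    [/\ dist_on d.1 (fun w => perm_eq w (enum (I1 p.1 p.2)) /\ ppath l e (a ++ w ++ take l p.2)),
        spread x0 kappa q1 d.1,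
        dist_on d.2 (fun w => perm_eq w (enum (I2 p.1 p.2)) /\ ppath l e (drop l p.2 ++ w ++ b)) &
        spread x0 kappa q2 d.2].
  case: p => J z /=; have [hJ|hJ] := boolP (Gd J); last by exists ([::], [::]).
  have [[z1 z2 z3 z4 z5]|nz] := pselect (Zq J z); last by exists ([::], [::]).
  have [cJ cK] := cJK J hJ.
  have zl : (l <= size z)%N by rewrite z1 leq_addr.
  have [u1 u2] : uniq (take l z) /\ uniq (drop l z) by rewrite take_uniq ?drop_uniq.
  have [s1 s2] : size (take l z) = l /\ size (drop l z) = l.
    by rewrite size_takel // size_drop z1 addnK.
  have [p1 p2] : ppath l e (take l z) /\ ppath l e (drop l z).
    by apply/andP; apply: ppath_cat; rewrite cat_take_drop.
  have [c1 g1] := cz J _ q1 u1 s1 z4 cJ; have [c2 g2] := cz (I :\: J) _ q2 u2 s2 z5 cK.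
  have [v hv|d1 k1 k2] := S1 (I1 J z) a (take l z) c1 sa s1 pa p1.
    have vX : v \in X.
      rewrite inX; case/or3P: hv => [|->|/z4 /(subsetP (JIs _ hJ)) ->]; rewrite ?orbT //.
      by rewrite inE => /andP[_ /(subsetP (JIs _ hJ)) ->].
    by have [g3 _] := GdX J v hJ vX; apply: le_trans hb1 _; apply: g1.
  have [v hv|d2 k3 k4] := S2 (I2 J z) (drop l z) b c2 s2 sb p2 pb.
    have vX : v \in X.
      rewrite inX; case/or3P: hv => [|/z5 /setDP[-> _]|->]; rewrite ?orbT //.
      by rewrite !inE => /andP[_ /andP[_ ->]].
    by have [_ g3] := GdX J v hJ vX; apply: le_trans hb2 _; apply: g2.
  by exists (d1, d2).
have [dp Hdp] := choice pathsJ.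
pose dJ J := dbind (dl J) (fun z => dbind (dp (J, z)).1 (fun w1 => dbind (dp (J, z)).2
   (fun w2 => [:: (1 : R, w1 ++ z ++ w2)]))).
pose valid (J : {set T}) (w : seq T) := [/\ perm_eq w (enum I), ppath l e (a ++ w ++ b) &
  forall i, (i < q)%N -> nth x0 w i \in if (i < N1)%N then J else I :\: J].
have validP J z w1 w2 : Gd J -> Zq J z ->
    perm_eq w1 (enum (I1 J z)) /\ ppath l e (a ++ w1 ++ take l z) ->
    perm_eq w2 (enum (I2 J z)) /\ ppath l e (drop l z ++ w2 ++ b) ->
    [/\ valid J (w1 ++ z ++ w2), size w1 = q1 & size z = (l + l)%N].
  move=> hJ [z1 z2 z3 z4 z5] [w11 w12] [w21 w22].
  have [cJ cK] := cJK J hJ.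
  have [u1 u2] : uniq (take l z) /\ uniq (drop l z) by rewrite take_uniq ?drop_uniq.
  have zl : (l <= size z)%N by rewrite z1 leq_addr.
  have [s1 s2] : size (take l z) = l /\ size (drop l z) = l.
    by rewrite size_takel // size_drop z1 addnK.
  have [c1 _] := cz J _ q1 u1 s1 z4 cJ; have [c2 _] := cz (I :\: J) _ q2 u2 s2 z5 cK.
  have sw1 : size w1 = q1 by rewrite (perm_size w11) -cardE c1.
  have sw2 : size w2 = q2 by rewrite (perm_size w21) -cardE c2.
  have pe (K : {set T}) s : uniq s -> {subset s <= K} ->
      perm_eq (enum (K :\: [set v in s]) ++ s) (enum K).
    move=> us sK; apply: uniq_perm; rewrite ?enum_uniq //.
      rewrite cat_uniq enum_uniq us andbT; apply/hasPn => v vs.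
      by rewrite mem_enum !inE vs.
    move=> v; rewrite mem_cat !mem_enum !inE.
    by case hv: (v \in s) => /=; rewrite ?orbF // sK.
  have pe1 := pe J (take l z) u1 z4; have pe2 := pe (I :\: J) (drop l z) u2 z5.
  have pI : perm_eq (enum J ++ enum (I :\: J)) (enum I).
    have {2}<- : J :|: (I :\: J) = I.
      apply/setP => v; rewrite !inE; case hv: (v \in J) => //=.
      by rewrite (subsetP (JIs J hJ)).
    rewrite perm_sym; apply: perm_enumU; rewrite disjoint_sym disjoints_subset.
    by apply/subsetP => v; rewrite !inE => /andP[].
  split=> //; split.
  - apply/permP => t; rewrite -(permP pI) !count_cat -(permP pe1) -(permP pe2) !count_cat.
    have ez : count t z = (count t (take l z) + count t (drop l z))%N.
      by rewrite -count_cat cat_take_drop.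
    rewrite (permP w11) (permP w21) ez -!addnA; congr (_ + (_ + _))%N; exact: addnC.
  - rewrite -{1}(cat_take_drop l z) -!catA catA; apply: ppath_glue; rewrite ?s1 -?catA //.
    by apply: ppath_glue; rewrite ?s2 // cat_take_drop.
  move=> i hi; have -> : w1 ++ z ++ w2 = (w1 ++ take l z) ++ (drop l z ++ w2).
    by rewrite -!catA (catA (take l z)) cat_take_drop.
  rewrite nth_cat size_cat sw1 s1 -/N1.
  case: ltnP => hi1.
    have : nth x0 (w1 ++ take l z) i \in w1 ++ take l z by rewrite mem_nth // size_cat sw1 s1.
    rewrite mem_cat => /orP[|/z4 //]; rewrite (perm_mem w11) mem_enum.
    by move/setDP => [].
  have hi2 : (i - N1 < size (drop l z ++ w2))%N.
    by rewrite size_cat s2 sw2 ltn_subLR //; move: hi; rewrite /q /N1; clear; lia.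
  have := mem_nth x0 hi2; rewrite mem_cat => /orP[/z5 //|]; rewrite (perm_mem w21) mem_enum.
  by move/setDP => [].
have dirac_valid J z w1 w2 : valid J (w1 ++ z ++ w2) ->
    dist_on [:: (1 : R, w1 ++ z ++ w2)] (valid J) by apply: dist_dirac.
have dJ_dist J : Gd J -> dist_on (dJ J) (valid J).
  move=> hJ; have [h1 _] := Hdl J hJ; apply: dist_bind h1 _ => z hz.
  have [k1 _ k2 _] := Hdp (J, z) hJ hz; apply: dist_bind k1 _ => w1 hw1.
  apply: dist_bind k2 _ => w2 hw2; apply: dirac_valid.
  by have [] := validP J z w1 w2 hJ hz hw1 hw2.
have G0 : (0 < #|[set J | Gd J]|)%N.
  rewrite -(ltr_nat R); apply: lt_le_trans cGd; rewrite mulr_gt0 //; first lra.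
  by rewrite ltr0n bin_gt0 /q /N1 leq_addr.
pose dtot := dbind (dunif R (enum [set J | Gd J])) dJ.
have dU : dist_on (dunif R (enum [set J | Gd J])) Gd.
  by apply: dist_unif => [|J]; [rewrite -cardE|rewrite mem_enum inE].
exists dtot.
  apply: dist_bind dU _ => J hJ; have [h1 h2] := dJ_dist J hJ; split=> // w /h1 [? [? ? ?]].
  by split.
move=> D y uD hD.
have dtotV : dist_on dtot (fun w => perm_eq w (enum I)).
  apply: dist_bind dU _ => J hJ; have [h1 h2] := dJ_dist J hJ; split=> // w /h1 [? [? ? ?]].
  by split.
have kappa1 : 1 <= kappa.
  by apply: le_trans hG; rewrite ler1n expn_gt0 muln_gt0 h0.
have K0 : 0 <= kappa * (1 + x) ^+ l.+1 by rewrite mulr_ge0 ?exprn_ge0 //; lra.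
have [D0|Dpos] := posnP (size D).
  by rewrite (size0nil D0) expr0 divr1; apply: pr_le1 dtotV.
(* A sequence without repetitions cannot show one vertex at two positions, so the event is empty if
   [y] repeats on [D]. *)
have [uy|nuy] := boolP (uniq (map y D)); last first.
  rewrite (pr_eq0 dtotV) ?divr_ge0 ?exprn_ge0 // => w pw; apply: contra nuy => /allP hw.
  have -> : map y D = map (nth x0 w) D by apply/eq_in_map => i /hw /eqP ->.
  rewrite map_inj_in_uniq // => i j /(allP hD) hi /(allP hD) hj /eqP.
  have sw : size w = q by rewrite (perm_size pw) -cardE.
  by rewrite nth_uniq ?sw // ?(perm_uniq pw) ?enum_uniq // => /eqP.
pose Da := left_of q1 D; pose Dm := mid_of q1 (l + l) D; pose Db := right_of (q1 + (l + l)) D.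
pose comp (J : {set T}) := all (fun i => y i \in if (i < N1)%N then J else I :\: J) D.
pose bm : R := ((2 * h) ^ (l + l))%:R ^+ size Dm /
        (N1 ^ count (fun i => i < l)%N Dm * N2 ^ count (fun i => l <= i)%N Dm)%:R.
pose ba : R := kappa ^+ size Da / (q1 ^_ size Da)%:R.
pose bb : R := kappa ^+ size Db / (q2 ^_ size Db)%:R.
have kappa0 : 0 <= kappa by apply: le_trans kappa1.
have ba0 : 0 <= ba by rewrite divr_ge0 ?exprn_ge0.
have bb0 : 0 <= bb by rewrite divr_ge0 ?exprn_ge0.
have bm0 : 0 <= bm by rewrite divr_ge0 ?exprn_ge0.
have dJ_pr J : Gd J -> pr (dJ J) (agrees x0 y D) <= if comp J then bm * ba * bb else 0.
  move=> hJ; case: ifPn => [hcomp|ncomp]; last first.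
    rewrite (pr_eq0 (dJ_dist J hJ)) // => w [_ _ hw]; apply: contra ncomp => /allP hag.
    by apply/allP => i iD; rewrite -(eqP (hag i iD)); apply: hw; apply: (allP hD).
  have [h1 h2] := Hdl J hJ.
  have um : uniq Dm by apply: uniq_shift => // i /andP[].
  have am : all (fun i => i < l + l)%N Dm.
    by apply/allP => _ /mapP[i + ->]; rewrite mem_filter => /andP[/andP[k1 k2] _]; rewrite ltn_subLR.
  have := h2 Dm (fun i => y (i + q1)%N) um am; rewrite -/bm => hbm.
  apply: (@le_trans _ _ (pr (dl J) (agrees x0 (fun i => y (i + q1)%N) Dm) * (ba * bb))); last first.
    by rewrite -mulrA ler_wpM2r // mulr_ge0.
  apply: pr_bind_le h1 _ => z hz; have [k1 k1s k2 k2s] := Hdp (J, z) hJ hz.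
  (* Indicators of the earlier stages are carried along as factors, so that the bounds of the three
     stages multiply. *)
  pose cz' : R := if agrees x0 (fun i => y (i + q1)%N) Dm z then 1 else 0.
  have cz0 : 0 <= cz' by rewrite /cz'; case: ifP.
  have -> : (if agrees x0 (fun i => y (i + q1)%N) Dm z then ba * bb else 0) = ba * (bb * cz').
    by rewrite /cz'; case: ifP; rewrite ?mulr1 // !mulr0.
  have hba : pr (dp (J, z)).1 (agrees x0 y Da) <= ba.
    apply: k1s; first exact: filter_uniq.
    by apply/allP => i; rewrite mem_filter => /andP[].
  apply: (@le_trans _ _ (pr (dp (J, z)).1 (agrees x0 y Da) * (bb * cz'))); last first.
    by rewrite ler_wpM2r // mulr_ge0.
  apply: pr_bind_le k1 _ => w1 hw1.
  pose cw : R := if agrees x0 y Da w1 then cz' else 0.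
  have cw0 : 0 <= cw by rewrite /cw; case: ifP.
  have -> : (if agrees x0 y Da w1 then bb * cz' else 0) = bb * cw.
    by rewrite /cw; case: ifP; rewrite ?mulr0.
  have hbb : pr (dp (J, z)).2 (agrees x0 (fun i => y (i + (q1 + (l + l)))%N) Db) <= bb.
    apply: k2s; first by apply: uniq_shift.
    apply/allP => _ /mapP[i + ->]; rewrite mem_filter => /andP[k3 /(allP hD)].
    by rewrite ltn_subLR // /q; clear; lia.
  apply: (@le_trans _ _ (pr (dp (J, z)).2 (agrees x0 (fun i => y (i + (q1 + (l + l)))%N) Db) * cw)); last first.
    by rewrite ler_wpM2r.
  apply: pr_bind_le k2 _ => w2 hw2.
  have [_ sw1 sz] := validP J z w1 w2 hJ hz hw1 hw2.
  rewrite /pr big_mkcond big_seq1 /=; case: ifP => [|_]; last by case: ifP.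
  by move/agrees_split; rewrite sw1 sz -/Da -/Dm -/Db /cw /cz' => /and3P[-> -> ->].
pose A := count (fun i => i < N1)%N D; pose B := count (fun i => N1 <= i)%N D.
pose a' := count (fun i => i < l)%N Dm; pose b' := count (fun i => l <= i)%N Dm.
have sDm : size Dm = (a' + b')%N by rewrite /a' /b' all_count_add.
have AE : A = (size Da + a')%N.
  rewrite /A /a' /Da /Dm /left_of /mid_of size_filter count_map count_filter.
  by apply: count_addE => i _ /=; rewrite /N1; clear; lia.
have BE : B = (b' + size Db)%N.
  rewrite /B /b' /Db /Dm /right_of /mid_of size_map size_filter count_map count_filter.
  by apply: count_addE => i _ /=; rewrite /N1; clear; lia.
have AB : (A + B = size D)%N by apply: all_count_add.
have hA : (A <= N1)%N by have := count_range_le 0 N1 uD; rewrite subn0.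
have hBq : B = count (fun i => (N1 <= i) && (i < q))%N D.
  by apply: eq_in_count => i /(allP hD) ->; rewrite andbT.
have hB : (B <= N2)%N.
  by rewrite hBq (leq_trans (count_range_le N1 q uD)) // /q /N1 addKn.
have hDa : (size Da <= q1)%N.
  by rewrite size_filter; have := count_range_le 0 q1 uD; rewrite subn0.
have hDb : (size Db <= q2)%N.
  rewrite size_map size_filter (@eq_in_count _ _ (fun i => (q1 + (l + l) <= i) && (i < q))%N); last first.
    by move=> i /(allP hD) ->; rewrite andbT.
  by apply: leq_trans (count_range_le _ _ uD) _; rewrite /q; clear; lia.
have ha' : (a' <= l)%N.
  have : uniq Dm by apply: uniq_shift => // i /andP[].
  by move/(count_range_le 0 l); rewrite subn0.
have hb' : (b' <= l)%N.
  have um : uniq Dm by apply: uniq_shift => // i /andP[].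
  have := count_range_le l (l + l) um; rewrite addnK; apply: leq_trans.
  rewrite /b' (@eq_in_count _ _ (fun i => (l <= i) && (i < l + l))%N) // => i.
  by move=> /mapP[j + ->]; rewrite mem_filter => /andP[/andP[k1 k2] _]; rewrite [(_ - q1 < _)%N]ltn_subLR // k2 andbT.
apply: le_trans (pr_bind_le dU dJ_pr) _.
set c := pr _ _.
have c0 : 0 <= c by apply: pr_ge0 dU.
rewrite -AB AE BE.
rewrite /bm sDm; apply: (@step_bound R l kappa x _ q1 q2 (size Da) (size Db) a' b' c) => //; rewrite ?ler1n ?expn_gt0 ?muln_gt0 ?h0 //.
  by rewrite -BE -AE AB.
rewrite -AE -BE AB /c pr_unif -cardE.
have hcnt := compat_count R hI uD uy hA hB.
set g := #|[set J | Gd J]|%:R in cGd *.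
have g0 : 0 < g by rewrite ltr0n.
rewrite mulrAC ler_pdivrMr //.
set F := (_ * _)%:R in hcnt *; set Q := (_ ^_ size D)%:R in hcnt *.
set cc := count _ _.
(* The good compatible halves are counted among all compatible ones; dividing by the number of good
   halves instead of all halves costs the factor [1 - x / 2]. *)
have hcc : cc%:R <= 'C(N1 + N2, N1)%:R * F / Q.
  apply: le_trans hcnt; rewrite ler_nat /cc -size_filter cardE; apply: uniq_leq_size.
    by rewrite filter_uniq // enum_uniq.
  by move=> J; rewrite mem_filter !mem_enum !inE => /andP[hJ /and3P[-> -> _]].
apply: (@le_trans _ _ ('C(N1 + N2, N1)%:R * F / Q * (1 - x / 2))).
  by rewrite ler_wpM2r //; lra.
have -> : 'C(N1 + N2, N1)%:R * F / Q * (1 - x / 2) = F / Q * ((1 - x / 2) * 'C(N1 + N2, N1)%:R) by ring.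
by apply: ler_wpM2l; rewrite ?divr_ge0.
Qed.

End SpreadStep.

Section Recursion.
Variables (R : realType) (l : nat).

(** The decisive estimate is the third one. With exp(t) >= t^4 / 24 and t of order x^2 m it asks for
    x^9 m^2 to be large, which follows from x^8 m >= M and x m >= M. This is the origin of the
    exponent 8. *)
Lemma level_numeric (eta x : R) h M m q q1 : 0 < eta -> eta <= 1 -> 0 < x -> x <= 1 ->
  (0 < l)%N -> (q + (l + l))%N = m -> (m <= 2 * (q1 + (l + l)) + 1)%N ->
  128 / eta + 128 * l%:R / eta + 14 * 2 ^+ 32 / eta ^+ 4 + 48 + 8 * l%:R + 2 + 16 * h%:R * l%:R + 1 <= M%:R :> R ->
  M%:R <= x ^+ 8 * m%:R ->
  let xi := eta * x / 32 in
  [/\ 2 <= xi * q%:R, l%:R <= xi * q1%:R,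
   4 * (q + (l + l))%:R * q.+1%:R * expR (- (xi ^+ 2 * q%:R / 32)) <= x / 2,
   (3 <= q1)%N /\ 12 <= x ^+ 2 * q1%:R & (4 * h * l < q1 + l)%N].
Proof.
move=> eta0 eta1 x_0 x1 l0 qm hq1 hM hm xi.
have m0 : 0 <= m%:R :> R by [].
have hl0 : 0 <= l%:R :> R by []. have hh0 : 0 <= h%:R :> R by [].
have t1 : 0 <= 128 / eta by rewrite divr_ge0 // ltW.
have t2 : 0 <= 128 * l%:R / eta by rewrite divr_ge0 ?mulr_ge0 // ltW.
have t3 : 0 <= 14 * 2 ^+ 32 / eta ^+ 4 by rewrite divr_ge0 ?mulr_ge0 ?exprn_ge0 // ltW.
have t4 : 0 <= 16 * h%:R * l%:R :> R by rewrite !mulr_ge0.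
have xk k : (k <= 8)%N -> M%:R <= x ^+ k * m%:R.
  move=> hk; apply: le_trans hm _; rewrite ler_wpM2r //; apply: ler_wiXn2l => //; exact: ltW.
have xm := xk 1%N isT; rewrite expr1 in xm.
have x2m := xk 2%N isT.
have mM := xk 0%N isT; rewrite expr0 mul1r in mM.
have qm' : q%:R + (l%:R + l%:R) = m%:R :> R by rewrite -qm !natrD.
have hq1' : m%:R <= 2 * (q1%:R + (l%:R + l%:R)) + 1 :> R.
  by have := hq1; rewrite -(ler_nat R) natrD natrM !natrD.
have q1m : m%:R / 4 <= q1%:R :> R by lra.
have qm2 : m%:R / 2 <= q%:R :> R by lra.
have q10 : 0 <= q1%:R :> R by []. have q0 : 0 <= q%:R :> R by [].
have xi0 : 0 < xi by rewrite /xi divr_gt0 // mulr_gt0.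
have exm : 128 + 128 * l%:R <= eta * (x * m%:R).
  have : (128 / eta + 128 * l%:R / eta) <= x * m%:R by lra.
  by rewrite -mulrDl ler_pdivrMr // [leRHS]mulrC.
have ex0 : 0 <= eta * x by rewrite mulr_ge0 // ltW.
split.
- by have := ler_wpM2l ex0 qm2; rewrite /xi; move: exm (ler0n R l); clear; lra.
- by have := ler_wpM2l ex0 q1m; rewrite /xi; move: exm (ler0n R l); clear; lra.
- rewrite expRN ler_pdivrMr ?expR_gt0 //.
  set t := xi ^+ 2 * q%:R / 32.
  pose c := eta ^+ 2 / 2 ^+ 16.
  have c0 : 0 < c by rewrite /c divr_gt0 ?exprn_gt0.
  have ht : c * (x ^+ 2 * m%:R) <= t.
    have -> : c * (x ^+ 2 * m%:R) = (xi ^+ 2 / 32) * (m%:R / 2) by rewrite /c /xi; field.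
    have -> : t = (xi ^+ 2 / 32) * q%:R by rewrite /t mulrAC.
    by rewrite ler_wpM2l // divr_ge0 // sqr_ge0.
  have cx0 : 0 <= c * (x ^+ 2 * m%:R) by rewrite mulr_ge0 ?(ltW c0) // mulr_ge0 ?sqr_ge0.
  have hexp : (c * (x ^+ 2 * m%:R)) ^+ 4 / 24 <= expR t.
    apply: (@le_trans _ _ (t ^+ 4 / 24)).
      rewrite ler_wpM2r ?invr_ge0 // lerXn2r // nnegrE //; exact: le_trans ht.
    have := expR_ge1Dxn 3 (le_trans cx0 ht); rewrite (_ : 4`! = 24)%N //.
    by apply: le_trans; rewrite lerDr ler01.
  have x20 : 0 <= x / 2 by move: x_0; clear; lra.
  apply: le_trans (ler_wpM2l x20 hexp).
  have h1 : 4 * (q + (l + l))%:R * q.+1%:R <= 4 * m%:R ^+ 2 :> R.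
    rewrite qm expr2 mulrA ler_wpM2l ?mulr_ge0 // ler_nat -qm; move: l0; clear; lia.
  apply: le_trans h1 _.
  have -> : x / 2 * ((c * (x ^+ 2 * m%:R)) ^+ 4 / 24) =
     m%:R ^+ 2 * (c ^+ 4 * ((x ^+ 8 * m%:R) * (x * m%:R)) / 48) by field.
  rewrite mulrC ler_wpM2l ?sqr_ge0 //.
  have hMM : M%:R * M%:R <= (x ^+ 8 * m%:R) * (x * m%:R) by apply: ler_pM.
  (* The bound is used squared: 14 * 14 exceeds 4 * 48, the 48 coming from 24 and from [x / 2]. *)
  have hc : 14 <= c ^+ 2 * M%:R.
    have h3 : 14 * 2 ^+ 32 / eta ^+ 4 <= M%:R by lra.
    rewrite ler_pdivrMr ?exprn_gt0 // in h3.
    have -> : c ^+ 2 * M%:R = (M%:R * eta ^+ 4) / 2 ^+ 32 by rewrite /c; field.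
    by rewrite ler_pdivlMr ?exprn_gt0.
  rewrite ler_pdivlMr //.
  have h4 : 14 * 14 <= (c ^+ 2 * M%:R) * (c ^+ 2 * M%:R) by apply: ler_pM.
  have c40 : 0 <= c ^+ 4 by rewrite exprn_ge0 // ltW.
  have := ler_wpM2l c40 hMM.
  have -> : c ^+ 4 * (M%:R * M%:R) = (c ^+ 2 * M%:R) * (c ^+ 2 * M%:R) by ring.
  by move=> h5; apply: le_trans (le_trans h4 h5); clear; lra.
- split.
    rewrite -(ler_nat R); lra.
  have := ler_wpM2l (sqr_ge0 x) q1m; lra.
rewrite -(ltr_nat R) natrD !natrM; lra.
Qed.

(* Parts that are halved k more times have size at least 2^k M. Errors rho^k are
   summable over k, and rho^8 >= 1/2 makes (rho^k)^8 2^k at least 1. *)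
Let rho : R := 15 / 16.

Lemma rho_pow k M m : (M * 2 ^ k <= m)%N -> M%:R <= (rho ^+ k) ^+ 8 * m%:R.
Proof.
move=> hm; rewrite -exprM mulnC exprM.
have h : (1 / 2 : R) <= rho ^+ 8 by rewrite /rho; lra.
have h2 : (1 / 2 : R) ^+ k <= (rho ^+ 8) ^+ k.
  by rewrite lerXn2r // nnegrE; lra.
apply: (@le_trans _ _ ((1 / 2) ^+ k * (M * 2 ^ k)%:R)).
  rewrite natrM natrX mulrCA -exprMn (_ : 1 / 2 * 2 = 1) ?expr1n ?mulr1 //; lra.
apply: ler_pM => //; first by rewrite exprn_ge0 //; lra.
by rewrite ler_nat.
Qed.

Lemma spread_paths_weaken (T : finType) (e : rel T) x0 (b b' k k' : R) q :
  b <= b' -> 0 <= k -> k <= k' -> spread_paths l e x0 b k q -> spread_paths l e x0 b' k' q.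
Proof.
move=> hb k0 hk H I a c hI sa sc pa pc hdg; have [v hv|d h1 h2] := H I a c hI sa sc pa pc.
  by apply: le_trans (hdg v hv); rewrite ler_wpM2r.
exists d => // D y uD hD; apply: le_trans (h2 D y uD hD) _.
by rewrite ler_wpM2r ?invr_ge0 // lerXn2r // nnegrE // (le_trans k0).
Qed.

(** Level [k] has error parameter [rho ^+ k]. The sum of these over all levels is 16, so [bet] stays
    below [b0 + eta] and [kap] stays bounded. Degrees are required to be higher on larger parts, and
    every halving gives some of the surplus away. *)
Lemma spread_recursion (eta b0 : R) q0 : (0 < l)%N -> 0 < eta -> eta <= 1 ->
  crit R l + eta <= b0 ->
  (forall (T : finType) (e : rel T) (I : {set T}) (a b : seq T),
    symmetric e -> irreflexive e -> size a = l -> size b = l -> ppath l e a -> ppath l e b ->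
    (q0 <= #|I|)%N ->
    (forall x, [|| x \in I, x \in a | x \in b] -> b0 * #|I|%:R <= (dg e I x)%:R) ->
    exists2 w, perm_eq w (enum I) & ppath l e (a ++ w ++ b)) ->
  exists (kappa : R) n0, 1 <= kappa /\ forall (T : finType) (e : rel T) (x0 : T),
    symmetric e -> irreflexive e -> forall q, (n0 <= q)%N ->
    spread_paths l e x0 (b0 + eta) kappa q.
Proof.
move=> l0 eta0 eta1 hb0 base.
have cr0 : 0 <= crit R l by rewrite /crit divr_ge0.
have [h hh] := @exists_nat_ge R (eta / 2)^-1.
have h0 : (0 < h)%N by rewrite -(ltr_nat R); apply: lt_le_trans hh; rewrite invr_gt0; lra.
have [M1 hM1] := @exists_nat_ge R (128 / eta + 128 * l%:R / eta + 14 * 2 ^+ 32 / eta ^+ 4 + 48 + 8 * l%:R + 2 + 16 * h%:R * l%:R + 1).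
pose M := (maxn M1 (q0 + (l + l)).+1)%N.
have hM : 128 / eta + 128 * l%:R / eta + 14 * 2 ^+ 32 / eta ^+ 4 + 48 + 8 * l%:R + 2 + 16 * h%:R * l%:R + 1 <= M%:R :> R.
  by apply: le_trans hM1 _; rewrite ler_nat leq_maxl.
(* Parts at level 0 have at most 2M vertices, and there one fixed path is spread with constant [q],
   as [q ^_ s <= q ^ s]. The second summand dominates the constant of the links. *)
pose k0 : R := (M * 2 + (2 * h) ^ (l + l))%:R.
have k01 : 1 <= k0 by rewrite ler1n addn_gt0 muln_gt0 (leq_trans _ (leq_maxr _ _)).
have k00 : 0 <= k0 := le_trans ler01 k01.
pose kap k := k0 * expR (l.+1%:R * (16 * (1 - rho ^+ k))).
pose bet k := b0 + eta * (1 - rho ^+ k).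
have rk0 k : 0 < rho ^+ k by rewrite exprn_gt0 // /rho; lra.
have rk1 k : rho ^+ k <= 1 by rewrite exprn_ile1 // /rho; lra.
have rk2 k : 0 <= 1 - rho ^+ k by rewrite subr_ge0.
have kapge k : k0 <= kap k.
  rewrite /kap -[leLHS]mulr1 ler_wpM2l //.
  by rewrite -[leLHS]expR0 ler_expR mulr_ge0 // mulr_ge0.
(* Size is measured by [q + (l + l)], which is additive under a step: a part of q1 + l + (q2 + l)
   vertices splits into measures q1 + 2l and q2 + 2l. *)
have main k : forall (T : finType) (e : rel T) (x0 : T), symmetric e -> irreflexive e ->
    forall q, (M * 2 ^ k <= q + (l + l) <= M * 2 ^ k.+1)%N -> spread_paths l e x0 (bet k) (kap k) q.
  elim: k => [|k IH] T e x0 es ei q /andP[hq1 hq2].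
    move=> I a b hI sa sb pa pb hdg.
    have hq0 : (q0 <= #|I|)%N.
      rewrite hI; move: hq1; rewrite expn0 muln1 /M geq_max => /andP[_]; clear; lia.
    have [v hv|w pw ppw] := base T e I a b es ei sa sb pa pb hq0.
      by have := hdg v hv; rewrite /bet expr0 subrr mulr0 addr0 hI.
    exists [:: (1 : R, w)]; first exact: dist_dirac.
    move=> D y uD hD; apply: (@le_trans _ _ 1).
      by apply: (pr_le1 (Q := fun=> True)); apply: dist_dirac.
    have sD : (size D <= q)%N.
      rewrite -[q](size_iota 0); apply: uniq_leq_size uD _ => i /(allP hD).
      by rewrite mem_iota.
    rewrite ler_pdivlMr ?ltr0n ?ffact_gt0 // mul1r.
    apply: (@le_trans _ _ (q%:R ^+ size D)); first by rewrite -natrX ler_nat ffact_le_exp.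
    have qk : q%:R <= kap 0%N.
      apply: le_trans (kapge 0%N); rewrite ler_nat; move: hq2; rewrite expn1; clear; lia.
    by apply: lerXn2r; rewrite ?nnegrE ?(le_trans k00 (kapge 0%N)).
  set N1 := (q./2)%N.
  have hl : (8 * l + 2 <= q + (l + l))%N.
    have e2 : (0 < 2 ^ k.+1)%N by rewrite expn_gt0.
    apply: leq_trans hq1; apply: (@leq_trans M); last by rewrite leq_pmulr.
    rewrite -(ler_nat R) natrD natrM; apply: le_trans hM.
    have : 0 <= 128 / eta by rewrite divr_ge0 // ltW.
    have : 0 <= 128 * l%:R / eta by rewrite divr_ge0 ?mulr_ge0 // ltW.
    have : 0 <= 14 * 2 ^+ 32 / eta ^+ 4 by rewrite divr_ge0 ?mulr_ge0 ?exprn_ge0 // ltW.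
    have : 0 <= 16 * h%:R * l%:R :> R by rewrite !mulr_ge0.
    clear; lra.
  pose q1 := (N1 - l)%N; pose q2 := (q - N1 - l)%N.
  have [e1 e2] : (q1 + l + (q2 + l) = q)%N /\ (q1 <= q2 <= q1.+1)%N.
    by move: hl; rewrite /q1 /q2 /N1; clear; lia.
  have r1 : (M * 2 ^ k <= q1 + (l + l) <= M * 2 ^ k.+1)%N.
    move: hl hq1 hq2 e1 e2; rewrite !expnS; set z := (2 ^ k)%N; clear; nia.
  have r2 : (M * 2 ^ k <= q2 + (l + l) <= M * 2 ^ k.+1)%N.
    move: hl hq1 hq2 e1 e2; rewrite !expnS; set z := (2 ^ k)%N; clear; nia.
  have hx : M%:R <= (rho ^+ k) ^+ 8 * (q + (l + l))%:R.
    apply: rho_pow; apply: leq_trans hq1; rewrite leq_mul2l leq_exp2l // leqnSn orbT //.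
  have hmq : (q + (l + l) <= 2 * (q1 + (l + l)) + 1)%N by move: e1 e2; clear; lia.
  have [n1 n2 n3 [n4 n5] n6] := level_numeric eta0 eta1 (rk0 k) (rk1 k) l0 erefl hmq hM hx.
  set xi := eta * rho ^+ k / 32 in n1 n2 n3.
  have xi0 : 0 < xi by rewrite /xi divr_gt0 // mulr_gt0.
  have xi1 : xi <= 1.
    have : eta * rho ^+ k <= 1 * 1 by apply: ler_pM => //; rewrite ltW.
    rewrite /xi; lra.
  have betE : bet k.+1 = bet k + 2 * xi.
    (* Of the surplus 2 xi, one xi pays for the split and the other for the [l] vertices lost to the
       link. *)
    by rewrite /bet /xi exprS /rho; field.
  have bet0 : b0 <= bet k.
    by rewrite /bet lerDl mulr_ge0 ?(ltW eta0).
  have q12 : q1%:R <= q2%:R :> R by rewrite ler_nat; case/andP: e2.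
  have nb (m : nat) : q1%:R <= m%:R :> R -> bet k * m%:R <= (bet k.+1 - xi) * (m + l)%:R - l%:R.
    move=> hm; rewrite betE natrD; have := ler_wpM2l (ltW xi0) hm.
    have : 0 <= bet k * l%:R by rewrite mulr_ge0 //; move: bet0 hb0 cr0 eta0; clear; lra.
    have : 0 <= xi * l%:R by rewrite mulr_ge0 // ltW.
    by clear -n2; lra.
  have S := @spread_step R T l e x0 es (bet k.+1) (bet k) xi (rho ^+ k) (kap k) (eta / 2) h q1 q2
    xi0 xi1 (ltW (rk0 k)) (rk1 k) e2.
  rewrite /= e1 in S.
  apply: (spread_paths_weaken (lexx (bet k.+1)) _ _ (S n1 n3 n4 n5 (nb _ (lexx _)) (nb _ q12) _ hh _ n6 _ (IH T e x0 es ei q1 r1) (IH T e x0 es ei q2 r2))).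
  - by rewrite !mulr_ge0 ?exprn_ge0 ?expR_ge0 //; move: (rk0 k) k00; clear; lra.
  - rewrite /kap -mulrA ler_wpM2l //.
    have -> : l.+1%:R * (16 * (1 - rho ^+ k.+1)) = l.+1%:R * (16 * (1 - rho ^+ k)) + rho ^+ k * l.+1%:R.
      by rewrite exprS /rho; field.
    rewrite expRD ler_wpM2l ?expR_ge0 // expRM_natr.
    by rewrite lerXn2r ?nnegrE ?expR_ge0 ?expR_ge1Dx //; move: (rk0 k); clear; lra.
  - by move: eta0; clear; lra.
  - by rewrite betE; move: hb0 bet0 xi0 eta0; clear; lra.
  apply: le_trans (kapge k); rewrite ler_nat leq_addl //.
exists (k0 * expR (l.+1%:R * 16)), M; split.
  rewrite -[leLHS]mulr1; apply: ler_pM => //.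
  by rewrite -[leLHS]expR0 ler_expR mulr_ge0.
move=> T e x0 es ei q hq.
have M0 : (0 < M)%N by rewrite (leq_trans _ (leq_maxr _ _)).
pose n := ((q + (l + l)) %/ M)%N.
have n0 : (0 < n)%N by rewrite divn_gt0 // (leq_trans hq) // leq_addr.
have /andP[hk1 hk2] := trunc_log_bounds (isT : (1 < 2)%N) n0.
set k := trunc_log 2 n in hk1 hk2.
apply: (spread_paths_weaken _ _ _ (main k T e x0 es ei q _)).
- by rewrite /bet lerD2l ler_piMr ?(ltW eta0) //; have := rk0 k; lra.
- exact: le_trans (kapge k).
- rewrite /kap ler_wpM2l //.
  by rewrite ler_expR ler_wpM2l //; have := rk0 k; lra.
apply/andP; split.
  by apply: leq_trans (leq_divM (q + (l + l)) M); rewrite mulnC leq_mul2r hk1 orbT.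
apply: ltnW; apply: (@leq_trans (n.+1 * M)); first by rewrite -ltn_divLR.
by rewrite mulnC leq_mul2l hk2 orbT.
Qed.

End Recursion.

(** Raising the base from N to N + 1 multiplies N^m by (1 + 1/N)^m, which is at most e for
    [m <= N]. *)
Lemma exp_le_ffact (R : realType) N m : (m <= N)%N ->
  (N ^ m)%:R <= expR 1 ^+ m * (N ^_ m)%:R :> R.
Proof.
elim: N m => [|N IH] [|m] // hm; rewrite ?expr0 ?mul1r //.
have e0 : 0 < expR 1 :> R by apply: expR_gt0.
rewrite ffactSS expnS !natrM mulrCA ler_wpM2l // exprS -mulrA.
apply: (@le_trans _ _ (expR 1 * (N ^ m)%:R)); last by rewrite ler_wpM2l ?(ltW e0) ?IH.
case: N {IH} hm => [|N] hm; first by move: hm; rewrite ltnS leqn0 => /eqP ->; rewrite !expn0 mulr1 -[leLHS]expR0 ler_expR.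
rewrite !natrX; have N0 : 0 < N.+1%:R :> R by [].
have -> : N.+2%:R = (1 + N.+1%:R^-1) * N.+1%:R :> R.
  by rewrite mulrDl mul1r mulVf ?gt_eqF // natr1.
rewrite exprMn ler_wpM2r ?exprn_ge0 //.
apply: (@le_trans _ _ (expR (N.+1%:R^-1) ^+ m)).
  by apply: lerXn2r; rewrite ?nnegrE ?expR_ge0 ?expR_ge1Dx // addr_ge0 // invr_ge0.
rewrite -expRM_natl ler_expR ler_pdivrMr // mul1r ler_nat; exact: hm.
Qed.

(** * Closing random paths to random cycles *)

Section CycleSpread.
Variables (R : realType) (l : nat).

(** A random power path [z] on 2l vertices is chosen, and a random path through all other vertices
    leads from its second half back to its first half. The cycle is read from [drop l z] on. *)
Lemma cycle_spread (eta b1 kappa : R) n0 : (0 < l)%N -> 0 < eta -> 0 <= b1 -> 1 <= kappa ->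
  crit R l + eta <= b1 ->
  (forall (T : finType) (e : rel T) (x0 : T), symmetric e -> irreflexive e ->
     forall q, (n0 <= q)%N -> spread_paths l e x0 b1 kappa q) ->
  exists (K : R) N0, 0 < K /\ forall (T : finType) (e : rel T) (x0 : T),
    symmetric e -> irreflexive e -> (N0 <= #|T|)%N ->
    (forall x, (b1 + eta) * #|T|%:R <= (dg e [set: T] x)%:R) ->
    exists2 d : seq (R * seq T),
      dist_on d (fun c => perm_eq c (enum T) /\ ppath l e (c ++ take l c)) &
      forall (D : seq nat) (y : nat -> T), uniq D -> all (fun i => i < #|T|)%N D ->
        pr d (agrees x0 y D) <= (K / #|T|%:R) ^+ size D.
Proof.
move=> l0 eta0 b10 kappa1 hb1 hsp.
have [h hh] := exists_nat_ge eta^-1.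
have h0 : (0 < h)%N by rewrite -(ltr_nat R); apply: lt_le_trans hh; rewrite invr_gt0.
have [m1 hm1] := @exists_nat_ge R ((l + l)%:R / eta).
pose G : R := ((2 * h) ^ (l + l))%:R.
have G1 : 1 <= G by rewrite ler1n expn_gt0 muln_gt0 h0.
have E1 : 1 <= expR 1 :> R by rewrite -[leLHS]expR0 ler_expR.
(* [G] is the constant for [z]. For the long path, n is at most twice the number N of its vertices,
   so n^m is at most (2e)^m N^_m. *)
pose K := G * (2 * expR 1 * kappa).
have k2 : 1 <= 2 * expR 1 * kappa.
  by rewrite -[leLHS]mulr1; apply: ler_pM => //; move: E1; clear; lra.
exists K, (maxn (maxn m1 (4 * h * l).+1) (n0 + 4 * l))%N; split.
  by rewrite /K mulr_gt0 //; lra.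
move=> T e x0 es ei; rewrite !geq_max => /andP[/andP[hm h4] hn] hdg.
set n := #|T| in hm h4 hn hdg *.
pose Js := nseq (l + l) [set: T].
have cT : #|[set: T]| = n by rewrite cardsT.
have sJs : size Js = (l + l)%N by rewrite size_nseq.
have h20 : (0 < 2 * h)%N by rewrite muln_gt0 h0.
have crit1 x : (crit R l + eta) * #|[set: T]|%:R <= (dg e [set: T] x)%:R.
  by rewrite cT; apply: le_trans (hdg x); rewrite ler_wpM2r //; move: hb1 eta0; clear; lra.
have [||s0 hsel] := @sel_spread R T l e x0 (2 * h) Js h20.
- by move=> J /nseqP[-> _]; rewrite cT (leq_ltn_trans _ h4).
- move=> J z /nseqP[-> _]; rewrite sJs cT => sz uz _.
  have hcom : (n <= h * #|common e setT (take l z)|)%N.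
    rewrite -cT; apply: (@common_crit R l eta h eta0 hh T e setT _ es).
      by rewrite size_take_min leqW ?geq_minl.
    by move=> x _; apply: crit1.
  have hc2 : (#|common e setT (take l z)| <= #|cand l e setT z| + size z)%N.
    rewrite -(cardsID [set x in z] (common e setT (take l z))) addnC leq_add //.
      by apply: subset_leq_card; apply/subsetP => x; rewrite !inE => /andP[-> ->].
    by apply: leq_trans (subset_leq_card (subsetIr _ _)) _; rewrite cardsE card_size.
  move: hcom hc2 sz h4; clear; nia.
pose Zq (z : seq T) := [/\ size z = (l + l)%N, uniq z & ppath l e z].
have dz : dist_on (dunif R (sel l e Js)) Zq.
  by apply: dist_unif => // z /mem_sel [z1 z2 z3 _]; split; rewrite // z1.
pose I (z : seq T) := ~: [set x in z].
have cI z : Zq z -> #|I z| = (n - (l + l))%N.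
  by case=> z1 z2 _; rewrite cardsCs setCK cardsE (card_uniqP z2) z1.
have ll4 : (l + l + (l + l) <= n)%N by apply: leq_trans hn; clear; lia.
have paths z : exists d : seq (R * seq T), Zq z ->
    dist_on d (fun w => perm_eq w (enum (I z)) /\ ppath l e (drop l z ++ w ++ take l z)) /\
    spread x0 kappa (n - (l + l)) d.
  have [[z1 z2 z3]|nz] := pselect (Zq z); last by exists [::].
  have [p1 p2] : ppath l e (take l z) /\ ppath l e (drop l z).
    by apply/andP; apply: ppath_cat; rewrite cat_take_drop.
  have zl : (l <= size z)%N by rewrite z1 leq_addr.
  have [s1 s2] : size (take l z) = l /\ size (drop l z) = l.
    by rewrite size_takel // size_drop z1 addnK.
  have [||d d1 d2] := hsp T e x0 es ei (n - (l + l))%N _ (I z) (drop l z) (take l z) (cI z (And3 z1 z2 z3)) s2 s1 p2 p1.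
  - by move: hn; clear; lia.
  - move=> x _; have hx := hdg x.
    have hd : (dg e [set: T] x <= dg e (I z) x + (l + l))%N.
      rewrite /dg -(cardsID [set x in z] [set y in [set: T] | e x y]) addnC leq_add //.
        by apply: subset_leq_card; apply/subsetP => u; rewrite !inE => /andP[-> ->].
      by apply: leq_trans (subset_leq_card (subsetIr _ _)) _; rewrite cardsE -z1 card_size.
    move: hd; rewrite -(ler_nat R) natrD => hd.
    have hln : (l + l)%:R <= eta * n%:R.
      have : m1%:R <= n%:R :> R by rewrite ler_nat.
      by move/(le_trans hm1); rewrite ler_pdivrMr // mulrC.
    rewrite natrB; last by apply: leq_trans ll4; rewrite leq_addr.
    have : 0 <= b1 * (l + l)%:R by rewrite mulr_ge0.
    move: hd hx hln; clear; lra.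
  by exists d.
have [dp Hdp] := choice paths.
pose dtot := dbind (dunif R (sel l e Js)) (fun z => dbind (dp z)
   (fun w => [:: (1 : R, drop l z ++ w ++ take l z)])).
pose valid (c : seq T) := perm_eq c (enum T) /\ ppath l e (c ++ take l c).
have validP z w : Zq z -> perm_eq w (enum (I z)) /\ ppath l e (drop l z ++ w ++ take l z) ->
    valid (drop l z ++ w ++ take l z) /\ size w = (n - (l + l))%N.
  move=> hz [w1 w2]; have [z1 z2 z3] := hz.
  have zl : (l <= size z)%N by rewrite z1 leq_addr.
  have [s1 s2] : size (take l z) = l /\ size (drop l z) = l.
    by rewrite size_takel // size_drop z1 addnK.
  split; last by rewrite (perm_size w1) -cardE cI.
  split.
    have : perm_eq (w ++ z) (enum T).
      apply: uniq_perm; rewrite ?enum_uniq //.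
        rewrite cat_uniq z2 (perm_uniq w1) enum_uniq andbT; apply/hasPn => x xz.
        by rewrite (perm_mem w1) mem_enum !inE xz.
      by move=> x; rewrite mem_cat (perm_mem w1) !mem_enum !inE orbC orbN.
    apply: perm_trans; rewrite perm_catC -catA perm_cat2l.
    by rewrite cat_take_drop.
  have -> : take l (drop l z ++ w ++ take l z) = drop l z by rewrite take_cat s2 ltnn subnn take0 cats0.
  by rewrite -!catA catA; apply: ppath_glue; rewrite ?s1 // -?catA // cat_take_drop.
exists dtot.
  apply: dist_bind dz _ => z hz; have [h1 _] := Hdp z hz.
  by apply: dist_bind h1 _ => w hw; apply: dist_dirac; have [] := validP z w hz hw.
move=> D y uD hD.
pose D1 := [seq i <- D | (l <= i < n - l)%N].
pose Dm := [seq (i - l)%N | i <- D1].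
pose Dz := [seq (i + l)%N | i <- D & (i < l)%N] ++ [seq (i - (n - l))%N | i <- D & (n - l <= i)%N].
(* Translates positions in [z] into positions on the cycle: the second half of [z] opens the cycle
   and the first half closes it. *)
pose yz j := if (l <= j)%N then y (j - l)%N else y (j + (n - l))%N.
have uDm : uniq Dm.
  rewrite map_inj_in_uniq ?filter_uniq // => i j; rewrite !mem_filter => /andP[/andP[hi _] _] /andP[/andP[hj _] _].
  by move: hi hj; clear; lia.
have aDm : all (fun i => i < n - (l + l))%N Dm.
  apply/allP => _ /mapP[i + ->]; rewrite mem_filter => /andP[/andP[h1 h2] _].
  by move: h1 h2; clear; lia.
have uDz : uniq Dz.
  rewrite cat_uniq; apply/and3P; split.
  - by rewrite map_inj_uniq ?filter_uniq // => i j; apply: addIn.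
  - apply/hasPn => _ /mapP[i + ->]; rewrite mem_filter => /andP[h1 /(allP hD) h2].
    by apply/mapP => -[j _]; move: h1 h2 ll4; clear; lia.
  rewrite map_inj_in_uniq ?filter_uniq // => i j; rewrite !mem_filter => /andP[hi _] /andP[hj _].
  by move: hi hj; clear; lia.
have aDz : all (fun i => i < size Js)%N Dz.
  rewrite sJs; apply/allP => x; rewrite mem_cat => /orP[] /mapP[i + ->]; rewrite mem_filter => /andP[h1 /(allP hD) h2].
    by move: h1; clear; lia.
  by move: h1 h2 ll4; clear; lia.
have sDs : (size Dz + size Dm = size D)%N.
  rewrite size_cat !size_map !size_filter -(count_predT D).
  rewrite (@count_addE predT (fun i => (i < l) || (n - l <= i))%N (fun i => l <= i < n - l)%N); last first.
    by move=> i _ /=; move: ll4; clear; lia.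
  rewrite (@count_addE (fun i => (i < l) || (n - l <= i))%N (fun i => i < l)%N (fun i => n - l <= i)%N) //.
  by move=> i _ /=; move: ll4; clear; lia.
pose bz : R := (G / n%:R) ^+ size Dz.
pose bm : R := kappa ^+ size Dm / ((n - (l + l)) ^_ size Dm)%:R.
have kap0 : 0 <= kappa by lra.
have bm0 : 0 <= bm by rewrite divr_ge0 ?exprn_ge0.
have n_0 : 0 < n%:R :> R by rewrite ltr0n (leq_ltn_trans _ h4).
have hbz : pr (dunif R (sel l e Js)) (agrees x0 yz Dz) <= bz.
  apply: le_trans (hsel Dz yz uDz aDz) _; rewrite sJs -/G /bz expr_div_n.
  rewrite (eq_big_seq (fun=> n)); last first.
    by move=> i /(allP aDz); rewrite sJs => hi; rewrite nth_nseq hi cT.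
  by rewrite big_const_seq count_predT iter_muln_1 natrX.
apply: (@le_trans _ _ (bz * bm)).
  apply: (@le_trans _ _ (pr (dunif R (sel l e Js)) (agrees x0 yz Dz) * bm)); last by rewrite ler_wpM2r.
  apply: pr_bind_le dz _ => z hz; have [h1 h2] := Hdp z hz.
  pose cz : R := if agrees x0 yz Dz z then 1 else 0.
  have cz0 : 0 <= cz by rewrite /cz; case: ifP.
  have -> : (if agrees x0 yz Dz z then bm else 0) = bm * cz.
    by rewrite /cz; case: ifP; rewrite ?mulr1 ?mulr0.
  apply: (@le_trans _ _ (pr (dp z) (agrees x0 (fun i => y (i + l)%N) Dm) * cz)).
    apply: pr_bind_le h1 _ => w hw; have [_ sw] := validP z w hz hw; have [z1 z2 z3] := hz.
    have s2 : size (drop l z) = l by rewrite size_drop z1 addnK.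
    rewrite /pr big_mkcond big_seq1 /=; case: ifP => [/allP hag|_]; last by case: ifP.
    rewrite ifT; last first.
      apply/allP => _ /mapP[i + ->]; rewrite mem_filter => /andP[/andP[k1 k3] iD].
      have := hag i iD; rewrite nth_cat s2 ltnNge k1 /= nth_cat sw subnK // ifT //.
      by move: k1 k3; clear; lia.
    rewrite /cz ifT //; apply/allP => x; rewrite mem_cat => /orP[] /mapP[i + ->].
      rewrite mem_filter => /andP[hi iD]; rewrite /yz leq_addl addnK.
      by have := hag i iD; rewrite nth_cat s2 hi nth_drop addnC.
    rewrite mem_filter => /andP[hi iD]; have hin := allP hD i iD.
    rewrite /yz ifF; last by move: hi hin ll4; clear; lia.
    rewrite subnK //; have := hag i iD; rewrite nth_cat s2 ifF; last by move: hi ll4; clear; lia.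
    rewrite nth_cat sw ifF; last by move: hi hin ll4; clear; lia.
    rewrite nth_take; last by move: hi hin ll4; clear; lia.
    by have -> : (i - l - (n - (l + l)) = i - (n - l))%N by move: hi ll4; clear; lia.
  by rewrite ler_wpM2r // h2.
rewrite /bz /K -sDs exprD; apply: ler_pM => //.
- by rewrite exprn_ge0 // divr_ge0 //; lra.
- have G0 : 0 <= G by lra.
  have GK : G <= G * (2 * expR 1 * kappa) by rewrite -[leLHS]mulr1 ler_wpM2l.
  apply: lerXn2r; rewrite ?nnegrE ?divr_ge0 ?(le_trans G0 GK) //.
  by rewrite ler_wpM2r ?invr_ge0.
have sDm : (size Dm <= n - (l + l))%N.
  rewrite -(size_iota 0 (n - (l + l))); apply: uniq_leq_size uDm _ => i /(allP aDm).
  by rewrite mem_iota.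
set m := size Dm in sDm *; set N := (n - (l + l))%N in sDm *.
have f0 : 0 < (N ^_ m)%:R :> R by rewrite ltr0n ffact_gt0.
apply: (@le_trans _ _ ((2 * expR 1 * kappa / n%:R) ^+ m)); last first.
  have k20 : 0 <= 2 * expR 1 * kappa by apply: le_trans k2.
  have GK : 2 * expR 1 * kappa <= G * (2 * expR 1 * kappa) by rewrite -[leLHS]mul1r ler_wpM2r.
  apply: lerXn2r; rewrite ?nnegrE ?divr_ge0 ?(le_trans k20 GK) //.
  by rewrite ler_wpM2r ?invr_ge0.
rewrite ler_pdivrMr // expr_div_n mulrAC ler_pdivlMr ?exprn_gt0 //.
rewrite exprMn [_ * kappa ^+ m]mulrC -mulrA ler_wpM2l ?exprn_ge0 //.
rewrite exprMn -mulrA.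
apply: (@le_trans _ _ (2 ^+ m * (N ^ m)%:R)); last by rewrite ler_wpM2l ?exprn_ge0 ?exp_le_ffact.
rewrite -!natrX -natrM ler_nat -expnMn; case: (m) => // k; rewrite leq_exp2r //.
by move: ll4; rewrite /N; clear; lia.
Qed.

End CycleSpread.

(** * Random subsets in two rounds *)

Section RandomSubset.
Variables (R : realFieldType) (X : finType).
Implicit Types (E W Z T U : {set X}).

Definition wt (p : R) E W : R := \prod_(x in E) (if x \in W then p else 1 - p).

Lemma wt_ge0 p E W : 0 <= p <= 1 -> 0 <= wt p E W.
Proof. by move=> /andP[p0 p1]; apply: prodr_ge0 => x _; case: ifP; lra. Qed.

Lemma wt_setU1 p E W x : x \notin E -> W \subset E ->
  wt p (x |: E) W = (1 - p) * wt p E W /\ wt p (x |: E) (x |: W) = p * wt p E W.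
Proof.
move=> xE WE; rewrite /wt !big_setU1 //= setU11 (contraNF (subsetP WE x) xE); split=> //.
by congr (_ * _); apply: eq_bigr => y yE; rewrite !inE; case: eqP => // yx; rewrite yx (negbTE xE) in yE.
Qed.

Lemma sum_subset_setU1 (F : {set X} -> R) E x : x \notin E ->
  \sum_(W : {set X} | W \subset x |: E) F W =
  \sum_(W : {set X} | W \subset E) F W + \sum_(W : {set X} | W \subset E) F (x |: W).
Proof.
move=> xE; rewrite (bigID (fun W : {set X} => x \in W)) /= addrC; congr (_ + _).
  apply: eq_bigl => W; apply/andP/idP => [[h1 h2]|h]; last first.
    by split; [apply: subset_trans h (subsetUr _ _)|apply: contraNN xE; apply: (subsetP h)].
  apply/subsetP => y yW; have := subsetP h1 y yW; rewrite !inE => /orP[/eqP yx|//].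
  by rewrite yx (negbTE h2) in yW.
rewrite (reindex_onto (fun W => x |: W) (fun W => W :\ x)) /=; last first.
  by move=> W /andP[_ xW]; rewrite setD1K.
apply: eq_bigl => W; rewrite setU11 andbT; apply/andP/idP => [[h1 /eqP h2]|h].
  apply/subsetP => y yW; have := subsetP h1 y (setU1r x yW); rewrite !inE => /orP[/eqP yx|//].
  by rewrite -h2 yx !inE eqxx in yW.
have xW : x \notin W by apply: contraNN xE; apply: (subsetP h).
by rewrite setUS // setU1K.
Qed.

Lemma set_ind (P : {set X} -> Prop) : P set0 ->
  (forall x E, x \notin E -> P E -> P (x |: E)) -> forall E, P E.
Proof.
move=> h0 hs E; move En : #|E| => n; elim: n E En => [|n IH] E En.
  by rewrite (cards0_eq En).
have [x xE] : exists x, x \in E by apply/card_gt0P; rewrite En.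
rewrite -(setD1K xE); apply: hs; first by rewrite !inE eqxx.
by apply: IH; have := cardsD1 x E; rewrite xE En => -[].
Qed.

Lemma sum_subset0 (F : {set X} -> R) : \sum_(W : {set X} | W \subset set0) F W = F set0.
Proof. by rewrite (eq_bigl (pred1 set0)) ?big_pred1_eq // => W; rewrite subset0. Qed.

Lemma sum_wt p E : \sum_(W : {set X} | W \subset E) wt p E W = 1.
Proof.
elim/set_ind: E => [|x E xE IH]; first by rewrite sum_subset0 /wt big_set0.
rewrite sum_subset_setU1 // (eq_bigr (fun W => (1 - p) * wt p E W)); last first.
  by move=> W WE; case: (wt_setU1 p xE WE).
rewrite [X in _ + X](eq_bigr (fun W => p * wt p E W)); last first.
  by move=> W WE; case: (wt_setU1 p xE WE).
by rewrite -!big_distrr /= IH; ring.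
Qed.

(** An element is missed by the union of two independent rounds with probability
    [(1 - p1) * (1 - p2)]; the induction exposes one element of [E] at a time. *)
Lemma wt_union p p1 p2 E (f : {set X} -> R) : 1 - p = (1 - p1) * (1 - p2) ->
  \sum_(W1 : {set X} | W1 \subset E) wt p1 E W1 *
     (\sum_(W2 : {set X} | W2 \subset E) wt p2 E W2 * f (W1 :|: W2)) =
  \sum_(W : {set X} | W \subset E) wt p E W * f W.
Proof.
move=> hp; have {}hp : p = 1 - (1 - p1) * (1 - p2) by rewrite -hp; ring.
elim/set_ind: E f => [|x E xE IH] f; first by rewrite !sum_subset0 /wt !big_set0 setU0 !mul1r.
have inner W1 : \sum_(W2 : {set X} | W2 \subset x |: E) wt p2 (x |: E) W2 * f (W1 :|: W2) =
    (1 - p2) * (\sum_(W2 : {set X} | W2 \subset E) wt p2 E W2 * f (W1 :|: W2)) +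
    p2 * (\sum_(W2 : {set X} | W2 \subset E) wt p2 E W2 * f (x |: (W1 :|: W2))).
  rewrite sum_subset_setU1 // !big_distrr /=; congr (_ + _); apply: eq_bigr => W WE.
    by case: (wt_setU1 p2 xE WE) => ->; rewrite mulrA.
  by case: (wt_setU1 p2 xE WE) => _ ->; rewrite mulrA setUCA.
rewrite (eq_bigr _ (fun W1 _ => congr1 (fun z => _ * z) (inner W1))).
rewrite !sum_subset_setU1 //.
rewrite (eq_bigr (fun W => (1 - p1) * (1 - p2) * (wt p1 E W * \sum_(W2 : {set X} | W2 \subset E) wt p2 E W2 * f (W :|: W2))
    + (1 - p1) * p2 * (wt p1 E W * \sum_(W2 : {set X} | W2 \subset E) wt p2 E W2 * f (x |: (W :|: W2))))); last first.
  by move=> W WE; case: (wt_setU1 p1 xE WE) => -> _; ring.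
rewrite [X in _ + X = _](eq_bigr (fun W => p1 * (wt p1 E W * \sum_(W2 : {set X} | W2 \subset E) wt p2 E W2 * f (x |: (W :|: W2))))); last first.
  move=> W WE; case: (wt_setU1 p1 xE WE) => _ ->.
  have e1 W2 : f (x |: W :|: W2) = f (x |: (W :|: W2)) by rewrite setUA.
  have e2 W2 : f (x |: (x |: W :|: W2)) = f (x |: (W :|: W2)) by rewrite -setUA setUA setUid.
  rewrite (eq_bigr _ (fun W2 _ => congr1 (fun z => _ * z) (e1 W2))).
  rewrite [X in _ * (_ + p2 * X)](eq_bigr _ (fun W2 _ => congr1 (fun z => _ * z) (e2 W2))).
  by ring.
rewrite big_split /= -!big_distrr /= (IH f) (IH (fun W => f (x |: W))).
rewrite [RHS](_ : _ = (1 - p) * (\sum_(W : {set X} | W \subset E) wt p E W * f W) +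
    p * (\sum_(W : {set X} | W \subset E) wt p E W * f (x |: W))).
  by rewrite hp; ring.
rewrite !big_distrr /=; congr (_ + _); apply: eq_bigr => W WE.
  by case: (wt_setU1 p xE WE) => -> _; rewrite mulrA.
by case: (wt_setU1 p xE WE) => _ ->; rewrite mulrA.
Qed.

Lemma sum_subset_pow (y : R) U : \sum_(T : {set X} | T \subset U) y ^+ #|T| = (1 + y) ^+ #|U|.
Proof.
elim/set_ind: U => [|x U xU IH]; first by rewrite sum_subset0 cards0 !expr0.
rewrite sum_subset_setU1 // cardsU1 xU exprS -IH mulrDl mul1r; congr (_ + _).
rewrite big_distrr /=; apply: eq_bigr => T TU; rewrite cardsU1.
by rewrite (_ : x \notin T) ?exprS //; apply: contraNN xU; apply: (subsetP TU).
Qed.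

(** The elements of [T] contribute factors at most 1 before and exactly [p] after they are added. *)
Lemma wt_add_le p E W T : 0 < p -> p <= 1 -> T \subset E -> [disjoint T & W] ->
  wt p E W <= wt p E (W :|: T) * (p ^+ #|T|)^-1.
Proof.
move=> p0 p1 TE dTW; rewrite /wt ler_pdivlMr ?exprn_gt0 //.
rewrite (big_setID T) /= [leRHS](big_setID T) /= (setIidPr TE).
have -> : \prod_(i in T) (if i \in W :|: T then p else 1 - p) = p ^+ #|T|.
  by rewrite -prodr_const; apply: eq_bigr => i iT; rewrite inE iT orbT.
have -> : \prod_(i in E :\: T) (if i \in W :|: T then p else 1 - p) =
    \prod_(i in E :\: T) (if i \in W then p else 1 - p).
  by apply: eq_bigr => i; rewrite !inE => /andP[/negbTE -> _]; rewrite orbF.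
have h1 : \prod_(i in T) (if i \in W then p else 1 - p) <= 1.
  rewrite -[leRHS](expr1n _ #|T|) -prodr_const; apply: ler_prod => i iT.
  by case: ifP => _; apply/andP; split; lra.
have h2 : 0 <= \prod_(i in E :\: T) (if i \in W then p else 1 - p).
  by apply: prodr_ge0 => i _; case: ifP; lra.
rewrite [leRHS]mulrC; apply: ler_wpM2r; first by rewrite exprn_ge0 // ltW.
by rewrite -[leRHS]mul1r ler_wpM2r.
Qed.

(** * Minimum fragments *)

Section Fragment.
Variables (O : finType) (mu : O -> R) (S : O -> {set X}) (Q : pred O) (E : {set X}) (p : R).
Hypotheses (mu0 : forall w, 0 <= mu w) (SE : forall w, S w \subset E) (p0 : 0 < p) (p1 : p <= 1).

(** A member of the family inside [S w :|: W] that has the fewest elements outside [W]; [w] itself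
    is a candidate when [Q w] holds. *)
Definition frag w W : O := [arg min_(w' < w | Q w' && (S w' \subset S w :|: W)) #|S w' :\: W|].

Definition fragment w W : {set X} := S (frag w W) :\: W.

Lemma fragP w W : Q w -> [/\ Q (frag w W), S (frag w W) \subset S w :|: W &
  forall w', Q w' -> S w' \subset S w :|: W -> (#|fragment w W| <= #|S w' :\: W|)%N].
Proof.
move=> qw; rewrite /fragment /frag; case: arg_minnP => [|w' /andP[h1 h2] h3].
  by rewrite qw subsetUl.
by split=> // w'' q s; apply: h3; rewrite q.
Qed.

Lemma fragment_sub w W : Q w -> fragment w W \subset S w.
Proof.
move=> qw; have [_ h _] := fragP W qw; apply/subsetP => x; rewrite inE => /andP[xW /(subsetP h)].
by rewrite inE (negbTE xW) orbF.
Qed.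

(* By minimality the fragment is contained in every member of the family that
   is contained in Z, so given Z there are few candidates for it. *)
Lemma fragment_sub_any w W w0 : Q w -> Q w0 -> S w0 \subset W :|: fragment w W ->
  fragment w W \subset S w0.
Proof.
move=> qw q0 h0; have [h1 h2 h3] := fragP W qw.
have h4 : S w0 :\: W \subset fragment w W.
  by apply/subsetP => x; rewrite inE => /andP[xW /(subsetP h0)]; rewrite inE (negbTE xW).
have h5 : S w0 \subset S w :|: W.
  by apply: subset_trans h0 _; rewrite setUC; apply: setUSS => //; apply: fragment_sub.
have /eqP <- : S w0 :\: W == fragment w W by rewrite eqEcard h4 h3.
exact: subsetDl.
Qed.

(** The pair (w, W) is encoded by [w], the union Z of [W] with its fragment T, and T. Trading the
    weight of [W] for that of Z costs p^-#|T|. Given Z, the set T lies inside one member of the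
    family chosen from Z alone, so the sum over T is at most [B]. *)
Lemma fragment_bound (h : {set X} -> R) B : (forall T, 0 <= h T) ->
  (forall w0, Q w0 -> \sum_(T : {set X} | T \subset S w0) h T * (p ^+ #|T|)^-1 *
      (\sum_(w | Q w && (T \subset S w)) mu w) <= B) -> 0 <= B ->
  \sum_(W : {set X} | W \subset E) wt p E W * (\sum_(w | Q w) mu w * h (fragment w W)) <= B.
Proof.
move=> h0 hB B0; have p01 : 0 <= p <= 1 by rewrite ltW.
(* A member inside Z that depends on Z only. One exists for every Z that occurs, since
   [S (frag w W)] lies in the union of [W] with the fragment. *)
pose chi (Z : {set X}) := [pick w0 | Q w0 && (S w0 \subset Z)].
pose ok (Z T : {set X}) := if chi Z is Some w0 then T \subset S w0 else false.
pose F (Z T : {set X}) := wt p E Z * (h T * (p ^+ #|T|)^-1).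
have F0 Z T : 0 <= F Z T.
  by rewrite /F mulr_ge0 ?wt_ge0 // mulr_ge0 // invr_ge0 exprn_ge0 // ltW.
have dfr w W : [disjoint fragment w W & W].
  by rewrite disjoints_subset; apply/subsetP => x; rewrite !inE => /andP[].
have step w : Q w -> \sum_(W : {set X} | W \subset E) wt p E W * h (fragment w W) <=
    \sum_(Z : {set X} | Z \subset E) \sum_(T : {set X} | ok Z T && (T \subset S w)) F Z T.
  move=> qw; pose phi W := (W :|: fragment w W, fragment w W).
  apply: (@le_trans _ _ (\sum_(W in [set W : {set X} | W \subset E]) F (phi W).1 (phi W).2)).
    rewrite [leRHS](eq_bigl (fun W : {set X} => W \subset E)); last by move=> W; rewrite inE.
    apply: ler_sum => W WE; rewrite /F /= [h _ * _]mulrC mulrA ler_wpM2r //.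
    apply: wt_add_le => //; apply: subset_trans (SE w); exact: fragment_sub.
  rewrite -(big_imset (fun z => F z.1 z.2)) /=; last first.
    move=> W W' _ _ [e1 e2].
    have r U : U = (U :|: fragment w U) :\: fragment w U.
      rewrite setDUl setDv setU0; apply/esym/setDidPl; rewrite disjoint_sym; exact: dfr.
    by rewrite (r W) (r W') e1 e2.
  rewrite pair_big_dep /= [leLHS]big_mkcond [leRHS]big_mkcond; apply: ler_sum => -[Z T] _ /=.
  case: ifP => [/imsetP[W]|_]; last by case: ifP.
  rewrite inE => WE [-> ->]; rewrite ifT //.
  have [qf sf _] := fragP W qw.
  rewrite fragment_sub // andbT subUset WE (subset_trans (fragment_sub W qw) (SE w)) /= /ok /chi.
  case: pickP => [w0 /andP[q0 s0]|/(_ (frag w W))]; first exact: fragment_sub_any.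
  rewrite qf /fragment /=; have -> // : S (frag w W) \subset W :|: S (frag w W) :\: W.
  by apply/subsetP => x xS; rewrite !inE xS andbT orbN.
have -> : \sum_(W : {set X} | W \subset E) wt p E W * (\sum_(w | Q w) mu w * h (fragment w W)) =
    \sum_(w | Q w) mu w * (\sum_(W : {set X} | W \subset E) wt p E W * h (fragment w W)).
  rewrite (eq_bigr (fun W => \sum_(w | Q w) mu w * (wt p E W * h (fragment w W)))); last first.
    by move=> W _; rewrite big_distrr /=; apply: eq_bigr => w _; rewrite mulrCA.
  by rewrite exchange_big /=; apply: eq_bigr => w _; rewrite big_distrr.
apply: (@le_trans _ _ (\sum_(w | Q w) mu w *
    \sum_(Z : {set X} | Z \subset E) \sum_(T : {set X} | ok Z T && (T \subset S w)) F Z T)).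
  by apply: ler_sum => w qw; rewrite ler_wpM2l // step.
apply: (@le_trans _ _ (\sum_(Z : {set X} | Z \subset E) wt p E Z * B)); last first.
  by rewrite -big_distrl /= sum_wt mul1r.
rewrite (eq_bigr (fun w => \sum_(Z : {set X} | Z \subset E)
   mu w * \sum_(T : {set X} | ok Z T && (T \subset S w)) F Z T)); last first.
  by move=> w _; rewrite big_distrr.
rewrite exchange_big /=; apply: ler_sum => Z ZE.
have -> : \sum_(w | Q w) mu w * (\sum_(T : {set X} | ok Z T && (T \subset S w)) F Z T) =
    wt p E Z * \sum_(T : {set X} | ok Z T) h T * (p ^+ #|T|)^-1 * (\sum_(w | Q w && (T \subset S w)) mu w).
  rewrite big_distrr /=.
  rewrite (eq_bigr (fun T => \sum_(w | Q w && (T \subset S w)) mu w * F Z T)); last first.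
    by move=> T _; rewrite -big_distrl /= mulrA mulrC.
  rewrite (exchange_big_dep Q) /=; last by move=> T w _ /andP[].
  by apply: eq_bigr => w qw; rewrite big_distrr /=; apply: eq_bigl => T; rewrite qw.
rewrite ler_wpM2l ?wt_ge0 // /ok /chi; case: pickP => [w0 /andP[q0 s0]|_]; first exact: hB.
by rewrite big_pred0_eq.
Qed.

End Fragment.

Section TwoRounds.
Variables (O : finType) (mu : O -> R) (S : O -> {set X}) (E : {set X}) (p p1 p2 B delta : R) (k : nat).

(** Both rounds use [fragment_bound]. The first bounds the probability of fragments with more than
    [k] elements by Markov's inequality; the second is applied to the remaining fragments as a new
    family and bounds the probability that something of them stays uncovered. *)
Lemma two_rounds : (forall w, 0 <= mu w) -> \sum_w mu w = 1 -> (forall w, S w \subset E) ->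
  0 < p1 -> p1 <= 1 -> 0 < p2 -> p2 <= 1 -> 1 - p = (1 - p1) * (1 - p2) ->
  (forall w0, \sum_w mu w * (1 + 2 / p1) ^+ #|S w0 :&: S w| <= B) ->
  (forall w0 (A : {set X}), A \subset S w0 -> (#|A| <= k)%N ->
      \sum_w mu w * (1 + p2^-1) ^+ #|A :&: S w| <= 1 + delta) -> 0 <= delta ->
  \sum_(W : {set X} | (W \subset E) && [forall w, ~~ (S w \subset W)]) wt p E W <= B / 2 ^+ k + delta.
Proof.
move=> mu0 mu1 SE p10 p11 p20 p21 hp hB hd d0.
have [w0 _] : exists w : O, true.
  case: (pickP (fun w : O => true)) => [w _|h]; first by exists w.
  by move: mu1; rewrite big_pred0 // => /eqP; rewrite eq_sym oner_eq0.
have B0 : 0 <= B.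
  apply: le_trans (hB w0); apply: sumr_ge0 => w _; rewrite mulr_ge0 // exprn_ge0 //.
  by rewrite addr_ge0 // divr_ge0 // ltW.
pose fail (W : {set X}) : R := if [forall w, ~~ (S w \subset W)] then 1 else 0.
have -> : \sum_(W : {set X} | (W \subset E) && [forall w, ~~ (S w \subset W)]) wt p E W =
    \sum_(W : {set X} | W \subset E) wt p E W * fail W.
  by rewrite big_mkcondr /=; apply: eq_bigr => W _; rewrite /fail; case: ifP; rewrite ?mulr1 ?mulr0.
rewrite -(wt_union E fail hp).
pose T1 := fragment S xpredT.
have sumT p' (c : R) (U A : {set X}) : \sum_(T : {set X} | (T \subset A) && (T \subset U)) c ^+ #|T| * (p' ^+ #|T|)^-1 =
    (1 + c / p') ^+ #|A :&: U|.
  rewrite -sum_subset_pow; apply: eq_big => [T|T _]; first by rewrite subsetI.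
  by rewrite expr_div_n.
(* The weight 2^(#|T| - k) is at least 1 on large fragments. Summed with p1^-#|T| over the subsets
   of an intersection, it gives the base [1 + 2 / p1]. *)
have r1 : \sum_(W : {set X} | W \subset E) wt p1 E W *
    (\sum_(w | xpredT w) mu w * (2 ^+ #|T1 w W| / 2 ^+ k)) <= B / 2 ^+ k.
  apply: (@fragment_bound O mu S xpredT E p1 mu0 SE p10 p11 (fun T => 2 ^+ #|T| / 2 ^+ k)).
  - by move=> T; rewrite divr_ge0 ?exprn_ge0.
  - move=> w1 _; apply: (@le_trans _ _ ((\sum_w mu w * (1 + 2 / p1) ^+ #|S w1 :&: S w|) / 2 ^+ k)); last first.
      by rewrite ler_wpM2r ?invr_ge0 ?exprn_ge0.
    rewrite (eq_bigr (fun T : {set X} => \sum_(w | T \subset S w)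
        mu w / 2 ^+ k * (2 ^+ #|T| * (p1 ^+ #|T|)^-1))); last first.
      by move=> T _; rewrite big_distrr /=; apply: eq_bigr => w _; ring.
    rewrite (exchange_big_dep xpredT) //= big_distrl /=; apply: ler_sum => w _.
    by rewrite -big_distrr /= sumT mulrAC.
  by rewrite divr_ge0 ?exprn_ge0.
(* With the indicator of nonempty fragments as weight, the empty set drops out of the sum. This
   leaves the moment minus 1, at most [delta]. *)
have r2 W1 : \sum_(W2 : {set X} | W2 \subset E) wt p2 E W2 *
    (\sum_(w | (#|T1 w W1| <= k)%N) mu w *
       (if fragment (fun w => T1 w W1) (fun w => (#|T1 w W1| <= k)%N) w W2 == set0 then 0 else 1)) <= delta.
  have TS w : T1 w W1 \subset S w by apply: fragment_sub.
  apply: (@fragment_bound O mu (fun w => T1 w W1) (fun w => (#|T1 w W1| <= k)%N) E p2 mu0 _ p20 p21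
    (fun T => if T == set0 then 0 else 1)) => //.
  - by move=> w; apply: subset_trans (TS w) (SE w).
  - by move=> T; case: ifP.
  move=> w1 hw1; set A := T1 w1 W1.
  have AS : A \subset S (frag S xpredT w1 W1) by apply: subsetDl.
  have hA := hd _ A AS hw1.
  apply: (@le_trans _ _ (\sum_w mu w * ((1 + p2^-1) ^+ #|A :&: S w| - 1))); last first.
    rewrite (eq_bigr (fun w => mu w * (1 + p2^-1) ^+ #|A :&: S w| - mu w)); last first.
      by move=> w _; rewrite mulrBr mulr1.
    by rewrite sumrB mu1; lra.
  have pV : 0 <= p2^-1 by rewrite invr_ge0 ltW.
  rewrite (eq_bigr (fun T : {set X} => \sum_(w | (#|T1 w W1| <= k)%N && (T \subset T1 w W1))
      mu w * ((if T == set0 then 0 else 1) * (p2 ^+ #|T|)^-1))); last first.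
    by move=> T _; rewrite big_distrr /=; apply: eq_bigr => w _; rewrite mulrC.
  rewrite (exchange_big_dep (fun w => #|T1 w W1| <= k)%N) /=; last by move=> T w _ /andP[].
  rewrite [leLHS]big_mkcond; apply: ler_sum => w _.
  have ge1 : 1 <= (1 + p2^-1) ^+ #|A :&: S w| by rewrite exprn_ege1 // lerDl.
  case: ifP => qw; last by rewrite mulr_ge0 // subr_ge0.
  rewrite -big_distrr /=; apply: ler_wpM2l => //.
  apply: (@le_trans _ _ ((1 + p2^-1) ^+ #|A :&: T1 w W1| - 1)); last first.
    by rewrite lerD2r ler_weXn2l ?lerDl // subset_leq_card // setIS.
  have := sumT p2 1 (T1 w W1) A; rewrite div1r => <-.
  rewrite [X in _ <= X - 1](bigD1 set0) ?sub0set //= cards0 !expr0 invr1 mulr1 addrAC subrr add0r.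
  rewrite [leLHS](eq_bigl (fun T : {set X} => (T \subset A) && (T \subset T1 w W1))); last first.
    by move=> T; rewrite qw.
  rewrite [leLHS](bigD1 (set0 : {set X})) ?sub0set //=.
  rewrite eqxx mul0r add0r; apply: ler_sum => T /andP[_ /negbTE ->].
  by rewrite expr1n.
apply: (@le_trans _ _ (\sum_(W1 : {set X} | W1 \subset E) wt p1 E W1 *
   (\sum_w mu w * (2 ^+ #|T1 w W1| / 2 ^+ k) + delta))); last first.
  rewrite (eq_bigr (fun W1 => wt p1 E W1 * (\sum_w mu w * (2 ^+ #|T1 w W1| / 2 ^+ k)) + wt p1 E W1 * delta)); last first.
    by move=> W _; rewrite mulrDr.
  by rewrite big_split /= -big_distrl /= sum_wt mul1r lerD2r.
apply: ler_sum => W1 W1E; apply: ler_wpM2l; first by rewrite wt_ge0 // ltW.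
set m1 := \sum_w _; apply: (@le_trans _ _ (m1 + \sum_(W2 : {set X} | W2 \subset E) wt p2 E W2 *
    (\sum_(w | (#|T1 w W1| <= k)%N) mu w *
       (if fragment (fun w => T1 w W1) (fun w => (#|T1 w W1| <= k)%N) w W2 == set0 then 0 else 1)))); last first.
  by rewrite lerD2l.
have em1 : m1 = \sum_(W2 : {set X} | W2 \subset E) wt p2 E W2 * m1.
  by rewrite -big_distrl /= sum_wt mul1r.
rewrite [X in _ <= X + _]em1 -big_split /=.
apply: ler_sum => W2 W2E; rewrite -mulrDr; apply: ler_wpM2l; first by rewrite wt_ge0 // ltW.
have m10 : 0 <= m1 by apply: sumr_ge0 => w _; rewrite mulr_ge0 // divr_ge0 ?exprn_ge0.
rewrite /fail; case: ifP => [/forallP hf|_]; last first.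
  by apply: addr_ge0 => //; apply: sumr_ge0 => w _; rewrite mulr_ge0 //; case: ifP.
(* If no member is covered, each [w] contributes at least [mu w]: through the first sum if its first
   fragment is large, and otherwise because its second fragment is nonempty. *)
rewrite -[X in X <= _]mu1 /m1 [X in _ <= _ + X]big_mkcond -big_split /=; apply: ler_sum => w _.
case: (leqP #|T1 w W1| k) => hw; last first.
  rewrite addr0 -[leLHS]mulr1 ler_wpM2l // ler_pdivlMr ?exprn_gt0 // mul1r.
  by rewrite ler_weXn2l ?ler1n // ltnW.
rewrite (_ : (fragment _ _ w W2 == set0) = false).
  by rewrite mulr1 lerDr mulr_ge0 // divr_ge0 ?exprn_ge0.
(* An empty second fragment means that [W2] covers the first fragment of some [w2], and then the
   member [w3] behind that fragment lies in the union of [W1] and [W2]. *)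
apply/negbTE/negP => /eqP f0.
set Q2 := fun w => (#|T1 w W1| <= k)%N in f0.
pose w2 := frag (fun w => T1 w W1) Q2 w W2; pose w3 := frag S xpredT w2 W1.
move: (hf w3); apply/negP; rewrite negbK.
apply/subsetP => x xS; rewrite inE; have [//|xW1] := boolP (x \in W1).
have xT : x \in T1 w2 W1 by rewrite /T1 /fragment inE xW1.
apply/negPn/negP => xW2; have : x \in fragment (fun w => T1 w W1) Q2 w W2 by rewrite /fragment inE xW2.
by rewrite f0 inE.
Qed.

End TwoRounds.
End RandomSubset.

(** * Sums over connected sets *)

Section ConnectedSets.
Variables (Y : finType) (g : rel Y).
Hypothesis gs : symmetric g.
Implicit Types (Q X : {set Y}).

(** Connectedness is expressed by cuts, since a covering walk is extended along an edge that leaves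
    the part visited so far. *)
Definition connected Q : bool := [forall r in Q, forall Q' : {set Y},
  (r \in Q') && (Q' \proper Q) ==> [exists x in Q', exists y in Q :\: Q', g x y]].

Fixpoint walks k (r : Y) : seq (seq Y) :=
  if k is k'.+1 then flatten [seq [seq q :: p | p <- walks k' q] | q <- enum (g r)]
  else [:: [::]].

Lemma mem_walks r p : path g r p -> p \in walks (size p) r.
Proof.
elim: p r => [|q p IH] r //= /andP[grq hp]; apply/flattenP.
exists [seq q :: p' | p' <- walks (size p) q]; last by rewrite map_f ?IH.
by apply/mapP; exists q; rewrite // mem_enum.
Qed.

Lemma size_walks D k r : (forall x, #|g x| <= D)%N -> (size (walks k r) <= D ^ k)%N.
Proof.
move=> hD; elim: k r => [|k IH] r //=; rewrite size_flatten /shape -map_comp sumnE big_map.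
apply: (@leq_trans (\sum_(q <- enum (g r)) D ^ k)).
  by apply: leq_sum => q _; rewrite /= size_map.
rewrite big_const_seq count_predT iter_addn_0 -cardE expnS mulnC leq_mul2r hD orbT //.
Qed.

(* A walk covering a set can be extended by a detour to a neighbour and back. *)
Lemma connected_walk Q r : connected Q -> r \in Q ->
  exists2 p, path g r p /\ size p = (#|Q|.-1 * 2)%N & Q = [set x in r :: p].
Proof.
move=> /forall_inP hQ rQ.
suff H k : (k < #|Q|)%N -> exists p, [/\ path g r p, size p = (k * 2)%N,
    [set x in r :: p] \subset Q & #|[set x in r :: p]| = k.+1].
  have Q0 : (0 < #|Q|)%N by apply/card_gt0P; exists r.
  have [|p [h1 h2 h3 h4]] := H #|Q|.-1; first by rewrite prednK.
  by exists p => //; apply/esym/eqP; rewrite eqEcard h3 h4 prednK /=.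
elim: k => [_|k IH hk].
  exists [::]; split=> //; first by apply/subsetP => x; rewrite !inE => /eqP ->.
  by rewrite (_ : [set x in [:: r]] = [set r]) ?cards1 //; apply/setP => x; rewrite !inE.
have [p [h1 h2 h3 h4]] := IH (ltnW hk).
have /forallP/(_ [set x in r :: p])/implyP := hQ r rQ.
have -> : (r \in [set x in r :: p]) && ([set x in r :: p] \proper Q).
  by rewrite inE mem_head properEcard h3 h4.
move=> /(_ isT)/existsP[x /andP[+ /existsP[y /andP[]]]]; rewrite in_setD inE => xp /andP[yp yQ] gxy.
have [p2 [k1 k2 k3]] : exists p2, [/\ path g r p2, size p2 = (size p).+2 & r :: p2 =i y :: r :: p].
  move: xp; rewrite inE => /orP[/eqP xr|xp].
    exists [:: y, r & p]; rewrite /= -xr gxy gs gxy xr h1; split=> //.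
    by move=> z; rewrite !inE; case: (z == r); case: (z == y).
  case/splitPr: xp h1 => pa pb; rewrite cat_path /= => /and3P[q1 q2 q3].
  exists (pa ++ [:: x, y, x & pb]); rewrite cat_path /= q1 q2 gxy gs gxy q3; split=> //.
    by rewrite !size_cat /= !addnS.
  move=> z; rewrite !inE !mem_cat !inE.
  by case: (z == r); case: (z == y); case: (z == x); rewrite ?orbT.
have e : [set z in r :: p2] = y |: [set z in r :: p].
  by apply/setP => z; rewrite !inE -in_cons k3 !inE.
exists p2; split=> //; first by rewrite k2 h2.
  by rewrite e subUset sub1set yQ.
by rewrite e cardsU1 h4 (_ : (y \notin [set z in r :: p]) = true) // .
Qed.

(** A connected set of size v through [r] is the trace of a walk of length 2(v - 1) from [r], and
    there are at most D^(2(v - 1)) of these. *)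
Lemma connected_sum (R : realFieldType) D r (w : nat -> R) (P : pred {set Y}) :
  (forall x, #|g x| <= D)%N -> (forall v, 0 <= w v) ->
  \sum_(Q : {set Y} | [&& connected Q, r \in Q & P Q]) w #|Q|
   <= \sum_(v < #|Y|.+1 | [exists Q : {set Y}, [&& connected Q, r \in Q, P Q & #|Q| == v]])
        (D ^ (v.-1 * 2))%:R * w v.
Proof.
move=> hD w0.
rewrite (partition_big (fun Q : {set Y} => inord #|Q| : 'I_#|Y|.+1)
  (fun v : 'I_#|Y|.+1 => [exists Q : {set Y}, [&& connected Q, r \in Q, P Q & #|Q| == v]])) /=; last first.
  move=> Q /and3P[h1 h2 h3]; apply/existsP; exists Q.
  by rewrite h1 h2 h3 inordK ?ltnS ?max_card /=.
apply: ler_sum => v _.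
rewrite (eq_bigr (fun=> w v)); last first.
  move=> Q /andP[_ /eqP <-]; congr w; rewrite inordK // ltnS max_card //.
rewrite sumr_const -[leLHS]mulr_natl ler_wpM2r // ler_nat.
apply: leq_trans (size_walks (v.-1 * 2) r hD).
rewrite -(size_map (fun p => [set x in r :: p])) cardE; apply: uniq_leq_size; first exact: enum_uniq.
move=> Q; rewrite mem_enum => /andP[/and3P[h1 h2 _] /eqP hv].
have hvn : #|Q| = v by rewrite -hv inordK // ltnS max_card.
have [p [k1 k2] k3] := connected_walk h1 h2.
by rewrite k3; apply/mapP; exists p => //; rewrite -hvn -k2; apply: mem_walks.
Qed.

Definition comp_rel X : rel Y := fun x y => [&& x \in X, y \in X & g x y].

Definition comps X : {set {set Y}} := equivalence_partition (connect (comp_rel X)) X.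

Lemma comps_equiv X : {in X & &, equivalence_rel (connect (comp_rel X))}.
Proof.
have cs : connect_sym (comp_rel X).
  by apply: sym_connect_sym => x y; rewrite /comp_rel gs andbCA.
move=> x y z _ _ _; split=> // h; apply/idP/idP; last exact: connect_trans.
by move=> h2; apply: connect_trans h2; rewrite cs.
Qed.

Lemma comps_partition X : partition (comps X) X.
Proof. exact: equivalence_partitionP (@comps_equiv X). Qed.

Lemma comps_same X Q x y : Q \in comps X -> x \in Q -> y \in X -> g x y -> y \in Q.
Proof.
move=> /imsetP[z zX ->]; rewrite !inE => /andP[xX hzx] yX gxy; rewrite yX /=.
by apply: connect_trans hzx (connect1 _); rewrite /comp_rel xX yX.
Qed.

Lemma comps_connected X Q : Q \in comps X -> connected Q.
Proof.
move=> hQ; apply/forall_inP => r rQ; apply/forallP => Q'; apply/implyP => /andP[rQ' pQ].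
apply: contraT; rewrite negb_exists => /forallP hn; exfalso.
have [_ [y yQ yQ']] := properP pQ.
have hry : connect (comp_rel X) r y.
  case/imsetP: hQ rQ yQ => z zX ->; rewrite !inE => /andP[rX h1] /andP[yX h2].
  have cs : connect_sym (comp_rel X).
    by apply: sym_connect_sym => u v; rewrite /comp_rel gs andbCA.
  by apply: connect_trans h2; rewrite cs.
case/connectP: hry => p; move: yQ'; elim: p r rQ rQ' => [|q p IH] r rQ rQ' /= yQ'.
  by move=> _ yr; rewrite yr rQ' in yQ'.
case/andP=> /and3P[rX qX grq] hp yl; apply: (IH q) => //.
  exact: comps_same hQ rQ qX grq.
have := hn r; rewrite rQ' /= negb_exists => /forallP/(_ q); rewrite grq andbT in_setD.
by rewrite (comps_same hQ rQ qX grq) andbT negbK.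
Qed.

(** Expanding the product gives one term for each collection of good sets. A member of [F] is
    determined by the collection of its components, so its term occurs, and the other terms are
    nonnegative. *)
Lemma polymer_sum (R : realFieldType) (F : {set {set Y}}) (good : pred {set Y}) (w : {set Y} -> R) :
  (forall Q, 0 <= w Q) -> (forall X Q, X \in F -> Q \in comps X -> good Q) ->
  \sum_(X in F) \prod_(Q in comps X) w Q <= \prod_(Q | good Q) (1 + w Q).
Proof.
move=> w0 hF.
have -> : \prod_(Q | good Q) (1 + w Q) =
    \sum_(J : {set {set Y}} | J \subset good) \prod_(Q in J) w Q.
  rewrite (big_mkcond good) /=.
  rewrite (eq_bigr (fun Q => (if good Q then w Q else 0) + 1)); last first.
    by move=> Q _; case: ifP => _; [rewrite addrC|rewrite add0r].
  rewrite bigA_distr [RHS]big_mkcond /=; apply: eq_bigr => J _; case: ifP => hJ.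
    rewrite [RHS]big_mkcond; apply: eq_bigr => Q _; case: ifP => // QJ.
    by rewrite (subsetP hJ Q QJ : good Q).
  have /subsetPn[Q QJ ng] : ~~ (J \subset good) by rewrite hJ.
  by rewrite (bigD1 Q) //= QJ (negbTE ng : good Q = false) mul0r.
have inj : {in F &, injective comps}.
  move=> X X' _ _ e; rewrite -(cover_partition (comps_partition X)) e.
  exact: cover_partition (comps_partition X').
rewrite -(big_imset (fun J : {set {set Y}} => \prod_(Q in J) w Q) inj) /=.
rewrite [leLHS]big_mkcond [leRHS]big_mkcond; apply: ler_sum => J _.
have J0 : 0 <= \prod_(Q in J) w Q by apply: prodr_ge0.
case: ifP => [/imsetP[X XF eJ]|_]; last by case: ifP.
by rewrite ifT //; apply/subsetP => Q; rewrite eJ => /(hF X Q XF).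
Qed.

End ConnectedSets.

(** * The number of common edges *)

Lemma near_irr n l a : (a < n)%N -> (l < n)%N -> near n l a a = false.
Proof.
move=> an ln; apply/hasP => -[d]; rewrite mem_iota orbb => /andP[d0 dl] /eqP h.
have : a + d = a %[mod n] by rewrite -h modn_small.
by move/eqP; rewrite -[X in _ == X %[mod n]]addn0 eqn_modDl mod0n modn_small; lia.
Qed.

Lemma geom_tail (R : realFieldType) (t : R) m : 0 <= t -> t <= 1 / 2 ->
  \sum_(v < m | (2 <= v)%N) t ^+ v <= t.
Proof.
move=> t0 t1; have H k : \sum_(v < k.+2 | (2 <= v)%N) t ^+ v + t ^+ k.+1 <= t.
  elim: k => [|k IH]; first by rewrite big_mkcond !big_ord_recr big_ord0 /= !add0r expr1.
  rewrite big_mkcond big_ord_recr -big_mkcond /=; apply: le_trans IH; rewrite -addrA lerD2l.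
  have : t ^+ k.+2 <= 1 / 2 * t ^+ k.+1 by rewrite exprS ler_wpM2r ?exprn_ge0.
  lra.
case: m => [|[|k]]; [by rewrite big_ord0|by rewrite big_mkcond big_ord_recr big_ord0 /= addr0|].
by apply: le_trans (H k); rewrite lerDl exprn_ge0.
Qed.

Section Estimate.
Variables (R : realType) (T : finType) (l : nat) (x0 : T).
Let n := #|T|.
Let Y := (T * 'I_n)%type.
Variables (c0 : seq T) (A : {set {set T}}).
Hypotheses (uc0 : uniq c0) (c0T : forall x, x \in c0) (ln : (l < n)%N) (l2 : (2 <= l)%N).
Hypothesis (A0 : A \subset cedges l c0).

(** A point of [Y] is a vertex together with a position on the random cycle. Points are joined if
    they are close both on the fixed cycle [c0] and on the random one. Keeping the position makes
    the number of neighbours bounded. *)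
Definition gam : rel Y := fun p q => near n l (index p.1 c0) (index q.1 c0) && near n l p.2 q.2.

Lemma gam_sym : symmetric gam.
Proof. by move=> p q; rewrite /gam near_sym (near_sym n l p.2). Qed.

Lemma gam_card p : (#|gam p| <= 4 * l ^ 2)%N.
Proof.
pose V1 := [set v | near n l (index p.1 c0) (index v c0)].
pose V2 := [set b : 'I_n | near n l p.2 b].
have c1 : (#|V1| <= 2 * l)%N.
  have ilt v : (index v c0 < n)%N by rewrite /n -(size_full uc0 c0T) index_mem.
  apply: leq_trans (near_card (ilt p.1) ln).
  pose f v : 'I_n := Ordinal (ilt v).
  rewrite -(card_in_imset (f := f)).
    apply: subset_leq_card; apply/subsetP => b /imsetP[v]; rewrite !inE => h ->.
    exact: h.
  move=> v v' _ _ /(congr1 val) /= e.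
  by rewrite -[v](nth_index x0 (c0T v)) e nth_index.
have c2 : (#|V2| <= 2 * l)%N by apply: near_card.
apply: (@leq_trans #|setX V1 V2|).
  by apply: subset_leq_card; apply/subsetP => -[u b]; rewrite !inE.
rewrite cardsX; apply: leq_trans (leq_mul c1 c2) _; lia.
Qed.

Definition proj (Q : {set Y}) : {set T} := [set p.1 | p in Q].

Definition einside (U : {set T}) : nat := #|[set E in cedges l c0 | E \subset U]|.

Definition good (Q : {set Y}) : bool :=
  [&& connected gam Q, (1 < #|Q|)%N, #|proj Q| == #|Q| & Q \subset [set p | p.1 \in cover A]].

(** The ends of the common edges with their positions on [c]. Their components under [gam] are the
    connected pieces of the common edges. *)
Definition spots (c : seq T) : {set Y} :=
  [set p : Y | (p.1 \in cover (A :&: cedges l c)) && (p.2 == index p.1 c :> nat)].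

Lemma cedges_near (c : seq T) (u v : T) : [set u; v] \in cedges l c -> near n l (index u c) (index v c) \/ u = v.
Proof.
rewrite inE => /existsP[u' /existsP[v' /andP[/eqP e h]]].
have [->|uv] := eqVneq u v; [by right|left].
have hu : u \in [set u'; v'] by rewrite -e !inE eqxx.
have hv : v \in [set u'; v'] by rewrite -e !inE eqxx orbT.
move: hu hv; rewrite !inE => /orP[/eqP eu|/eqP eu] /orP[/eqP ev|/eqP ev]; subst => //.
- by rewrite eqxx in uv.
- by rewrite near_sym.
by rewrite eqxx in uv.
Qed.

Lemma cedges_pair (c : seq T) (E : {set T}) : uniq c -> (forall x, x \in c) -> E \in cedges l c ->
  exists u v, [/\ E = [set u; v], u != v & near n l (index u c) (index v c)].
Proof.
move=> uc cT; rewrite inE => /existsP[u /existsP[v /andP[/eqP e h]]].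
exists u, v; split=> //; apply: contraTneq h => ->.
by rewrite near_irr // /n -(size_full uc cT) index_mem.
Qed.

Section Cycle.
Variable c : seq T.
Hypotheses (uc : uniq c) (cT : forall x, x \in c).

Let ilt v : (index v c < n)%N. Proof. by rewrite /n -(size_full uc cT) index_mem. Qed.
Let spot v : Y := (v, Ordinal (ilt v)).

Lemma spot_edge (u v : T) : [set u; v] \in A :&: cedges l c -> u != v ->
  [/\ spot u \in spots c, spot v \in spots c & gam (spot u) (spot v)].
Proof.
move=> hE uv; have hc : {subset [set u; v] <= cover (A :&: cedges l c)}.
  by move=> x hx; apply/bigcupP; exists [set u; v].
rewrite !inE /= !eqxx !andbT !hc ?inE ?eqxx ?orbT //; split=> //.
move: hE; rewrite inE => /andP[/(subsetP A0) h1 h2]; rewrite /gam /=.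
by case: (cedges_near h1) (cedges_near h2) => [->|e] [->|e'] //; rewrite ?e ?e' eqxx in uv.
Qed.

Lemma spots_spot p : p \in spots c -> p = spot p.1.
Proof. by case: p => u b; rewrite inE => /andP[_ /eqP /= h]; congr pair; apply: val_inj. Qed.

Lemma spots_good Q : Q \in comps gam (spots c) -> good Q.
Proof.
move=> hQ; have hP := comps_partition gam_sym (spots c).
have QX : Q \subset spots c.
  by rewrite -(cover_partition hP); apply: bigcup_sup.
apply/and4P; split.
- exact: (comps_connected gam_sym hQ).
- have : Q != set0 by apply: contraTneq hQ => ->; case/and3P: hP.
  case/set0Pn => p pQ; have pX := subsetP QX p pQ.
  have := pX; rewrite inE => /andP[/bigcupP[E hE pE] _].
  have := hE; rewrite inE => /andP[_ /(cedges_pair uc cT) [u [v [eE uv _]]]].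
  have hE' : [set u; v] \in A :&: cedges l c by rewrite -eE.
  have [su sv guv] := spot_edge hE' uv.
  rewrite (spots_spot pX) in pQ; move: pE; rewrite eE !inE => /orP[/eqP e|/eqP e].
    rewrite e in pQ; have vQ := comps_same hQ pQ sv guv.
    apply/card_gt1P; exists (spot u), (spot v); split=> //.
    by apply: contra uv => /eqP [->].
  rewrite e in pQ; rewrite gam_sym in guv; have uQ := comps_same hQ pQ su guv.
  apply/card_gt1P; exists (spot u), (spot v); split=> //.
  by apply: contra uv => /eqP [->].
- rewrite card_in_imset // => p q /(subsetP QX) /spots_spot -> /(subsetP QX) /spots_spot -> /= -> //.
apply/subsetP => p /(subsetP QX); rewrite !inE => /andP[/bigcupP[E]].
by rewrite inE => /andP[EA _] pE _; apply/bigcupP; exists E.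
Qed.

(** The two ends of a common edge are joined by [gam], hence lie in one component, whose projection
    contains the edge. *)
Lemma card_common : (#|A :&: cedges l c| <= \sum_(Q in comps gam (spots c)) einside (proj Q))%N.
Proof.
have hP := comps_partition gam_sym (spots c).
apply: (@leq_trans #|\bigcup_(Q in comps gam (spots c)) [set E in cedges l c0 | E \subset proj Q]|); last first.
  elim/big_rec2: _ => [|Q m S _ IH]; first by rewrite cards0.
  by rewrite cardsU (leq_trans (leq_subr _ _)) // leq_add2l.
apply: subset_leq_card; apply/subsetP => E hE.
have := hE; rewrite inE => /andP[/(subsetP A0) E0 /(cedges_pair uc cT) [u [v [eE uv _]]]].
have hE' : [set u; v] \in A :&: cedges l c by rewrite -eE.
  have [su sv guv] := spot_edge hE' uv.
have : spot u \in cover (comps gam (spots c)) by rewrite (cover_partition hP).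
case/bigcupP => Q hQ uQ; have vQ := comps_same hQ uQ sv guv.
apply/bigcupP; exists Q => //; rewrite inE E0 eE subUset !sub1set /proj /=; apply/andP; split.
  by apply/imsetP; exists (spot u).
by apply/imsetP; exists (spot v).
Qed.

End Cycle.

(** Here [d] is the random cycle, [a] is n^(1/l), [r] is sqrt n, and [theta] makes the base [z] a
    small multiple of [a]. The hypothesis [wrap] serves sets so large that their edges may go all
    the way around the cycle. *)
Variables (d : seq (R * seq T)) (K z theta a r : R).
Hypotheses (dd : dist_on d (fun c => perm_eq c (enum T))).
Hypothesis dspread : forall (D : seq nat) (y : nat -> T), uniq D -> all (fun i => i < n)%N D ->
        pr d (agrees x0 y D) <= (K / n%:R) ^+ size D.
Hypotheses (K0 : 0 < K) (z1 : 1 <= z) (th0 : 0 < theta) (th1 : theta <= 1)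
  (za : z <= theta ^+ 2 * a) (al : a ^+ l = n%:R) (a0 : 0 <= a) (ar : a <= r) (r0 : 0 < r)
  (rn : r ^+ 2 = n%:R) (wrap : forall v, (n <= l * v)%N -> theta ^+ v * (n%:R * r) <= 1)
  (t2 : (4 * l ^ 2)%:R ^+ 2 * (K * theta) <= 1 / 2).

Definition wgt (Q : {set Y}) : R := (K / n%:R) ^+ #|Q| * z ^+ einside (proj Q).

Let n0 : 0 < n%:R :> R. Proof. by rewrite -rn exprn_gt0. Qed.

Lemma wgt_ge0 Q : 0 <= wgt Q.
Proof. by rewrite mulr_ge0 ?exprn_ge0 ?divr_ge0 ?(ltW K0) ?(ltW n0) // (le_trans ler01). Qed.

(* As Q has v > 1 vertices, its edges number at most l(v - 2) + 1 instead of l v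
   (unless they wind around the cycle), which gains n^2 / a >= n r over
   z^(l v) <= theta^v n^v. *)
Lemma wgt_good Q : good Q -> wgt Q <= (K * theta) ^+ #|Q| / (n%:R * r).
Proof.
case/and4P=> _ Q1 /eqP pQ _; rewrite /wgt; set v := #|Q| in Q1 pQ *; set U := proj Q in pQ *.
have nr : 0 < n%:R * r by rewrite mulr_gt0.
have z0 : 0 <= z by apply: le_trans z1.
have q0 : 0 <= theta ^+ 2 * a by apply: le_trans za.
have main : z ^+ einside U <= theta ^+ v * (n%:R ^+ v / (n%:R * r)).
  have [hw|hw] := leqP n (l * v).
    have h1 : (einside U <= l * v)%N by rewrite -pQ; apply: cedges_le.
    apply: (@le_trans _ _ (z ^+ (l * v))); first by rewrite ler_weXn2l.
    apply: (@le_trans _ _ ((theta ^+ 2 * a) ^+ (l * v))); first by rewrite lerXn2r.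
    rewrite exprMn [a ^+ (l * v)]exprM al mulrA mulrAC ler_wpM2r ?exprn_ge0 ?(ltW n0) //.
    apply: (@le_trans _ _ (theta ^+ (v + v))).
      rewrite -exprM; apply: ler_wiXn2l => //; first exact: ltW.
      by move: l2; clear; nia.
    rewrite exprD ler_wpM2l ?exprn_ge0 ?(ltW th0) //.
    by rewrite -[leRHS]mul1r ler_pdivlMr ?wrap.
  have h1 : (einside U <= l * (v - 2) + 1)%N by rewrite -pQ; apply: cedges_gap_le; rewrite ?pQ.
  apply: (@le_trans _ _ (z ^+ (l * (v - 2) + 1))); first by rewrite ler_weXn2l.
  apply: (@le_trans _ _ ((theta ^+ 2 * a) ^+ (l * (v - 2) + 1))); first by rewrite lerXn2r.
  rewrite exprMn [a ^+ _]exprD expr1 [a ^+ (l * _)]exprM al -exprM.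
  have -> : n%:R ^+ v / (n%:R * r) = n%:R ^+ (v - 2) * r.
    have -> : n%:R ^+ v = n%:R ^+ (v - 2) * (n%:R * r ^+ 2) :> R.
      by rewrite rn -expr2 -exprD; congr (_ ^+ _); move: Q1; clear; lia.
    by field; rewrite (gt_eqF n0) (gt_eqF r0).
  apply: ler_pM; rewrite ?exprn_ge0 ?mulr_ge0 ?exprn_ge0 ?(ltW th0) ?(ltW n0) //.
    (* At v = 2 the exponents 2 (l (v - 2) + 1) and v are equal: a single edge needs the whole of
       [theta ^+ 2] in the bound for [z]. *)
    apply: ler_wiXn2l => //; first exact: ltW.
    by move: Q1 l2; clear; nia.
  by rewrite ler_wpM2l ?exprn_ge0 ?(ltW n0).
apply: (@le_trans _ _ ((K / n%:R) ^+ v * (theta ^+ v * (n%:R ^+ v / (n%:R * r))))).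
  by rewrite ler_wpM2l // exprn_ge0 // divr_ge0 ?(ltW K0) ?(ltW n0).
have nv : n%:R ^+ v != 0 :> R by rewrite expf_neq0 ?gt_eqF.
rewrite expr_div_n exprMn le_eqVlt; apply/orP; left; apply/eqP.
rewrite -[RHS]mulrA; move: nv; move: (n%:R ^+ v) (n%:R * r)^-1 (K ^+ v) (theta ^+ v) => N M k h N0; by field.
Qed.

(** Each good set is found from one of its points. The n #|cover A| possible roots bring a factor
    [n], which the denominator in [wgt_good] cancels, and the number of connected sets through a
    root goes into the geometric series in [t]. *)
Lemma sum_wgt : \sum_(Q | good Q) wgt Q <= #|cover A|%:R * ((4 * l ^ 2)%:R ^+ 2 * (K * theta)) / r.
Proof.
set t := (_ ^+ 2 * _); have t0 : 0 <= t by rewrite /t mulr_ge0 ?exprn_ge0 // mulr_ge0 ?ltW.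
have nr : 0 < n%:R * r by rewrite mulr_gt0.
pose VA := [set p : Y | p.1 \in cover A].
have cVA : #|VA| = (#|cover A| * n)%N.
  rewrite -[n in RHS]card_ord -cardsT -cardsX; apply: eq_card => p.
  by rewrite !inE andbT.
apply: (@le_trans _ _ (\sum_(p in VA) \sum_(Q : {set Y} | [&& connected gam Q, p \in Q & good Q]) wgt Q)).
  rewrite (exchange_big_dep good) /=; last by move=> p Q _ /and3P[].
  apply: ler_sum => Q gQ; have := gQ => /and4P[cQ Q1 _ QVA].
  have /card_gt0P[p pQ] := ltnW Q1.
  rewrite (bigD1 p) /=; last by rewrite (subsetP QVA) // cQ pQ gQ.
  by rewrite lerDl sumr_ge0 // => q _; apply: wgt_ge0.
apply: (@le_trans _ _ (\sum_(p in VA) t / (n%:R * r))); last first.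
  rewrite sumr_const cVA -[leLHS]mulr_natr natrM le_eqVlt; apply/orP; left; apply/eqP.
  by field; rewrite (gt_eqF n0) (gt_eqF r0).
apply: ler_sum => p _.
pose w v : R := (K * theta) ^+ v / (n%:R * r).
have w0 v : 0 <= w v by rewrite divr_ge0 ?(ltW nr) // exprn_ge0 // mulr_ge0 ?ltW.
apply: (@le_trans _ _ (\sum_(Q : {set Y} | [&& connected gam Q, p \in Q & good Q]) w #|Q|)).
  by apply: ler_sum => Q /and3P[_ _ /wgt_good].
apply: le_trans (connected_sum gam_sym p good gam_card w0) _.
apply: (@le_trans _ _ (\sum_(v < #|{: Y}|.+1 | (2 <= v)%N) t ^+ v / (n%:R * r))); last first.
  by rewrite -mulr_suml ler_wpM2r ?geom_tail ?invr_ge0 ?(ltW nr).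
rewrite [leLHS]big_mkcond [leRHS]big_mkcond; apply: ler_sum => v _.
case: ifP => [/existsP[Q /and4P[_ _ /and4P[_ Q1 _ _] /eqP hv]]|_]; last first.
  by case: ifP => // _; rewrite divr_ge0 ?exprn_ge0 ?(ltW nr).
rewrite -hv Q1 /w mulrA ler_wpM2r ?invr_ge0 ?(ltW nr) //.
rewrite /t [leRHS]exprMn ler_wpM2r ?exprn_ge0 ?mulr_ge0 ?(ltW K0) ?(ltW th0) //.
rewrite -natrX -natrX ler_nat -expnM leq_pexp2l //; last by clear; lia.
by rewrite muln_gt0 expn_gt0; move: l2; clear; lia.
Qed.

(** Knowing [spots c] fixes the positions of [#|X|] vertices; two points of [X] at one position make
    the event impossible. *)
Lemma pr_spots (X : {set Y}) : pr d (fun c => spots c == X) <= (K / n%:R) ^+ #|X|.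
Proof.
pose D := [seq nat_of_ord p.2 | p : Y <- enum X].
have sD : size D = #|X| by rewrite size_map -cardE.
have K1 : 0 <= K / n%:R by rewrite divr_ge0 ?(ltW K0) ?(ltW n0).
have pe c : perm_eq c (enum T) -> uniq c /\ forall x, x \in c.
  by move=> h; rewrite (perm_uniq h) enum_uniq; split=> // x; rewrite (perm_mem h) mem_enum.
have [uD|nD] := boolP (uniq D); last first.
  rewrite (pr_eq0 dd) ?exprn_ge0 // => c /pe [uc cT]; apply: contra nD => /eqP hX.
  rewrite map_inj_in_uniq ?enum_uniq // => p q; rewrite !mem_enum -hX !inE.
  case: p q => [u b] [v b'] /= /andP[_ /eqP e1] /andP[_ /eqP e2] e.
  have uv : u = v by rewrite -(nth_index x0 (cT u)) -e1 e e2 nth_index.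
  by congr pair => //; apply: val_inj.
pose y i := if [pick p in X | p.2 == i :> nat] is Some p then p.1 else x0.
rewrite -sD; apply: le_trans (dspread y uD _); last first.
  by apply/allP => _ /mapP[p _ ->]; apply: ltn_ord.
apply: pr_le dd _ => c /pe [uc cT] /eqP hX; apply/allP => _ /mapP[p pX ->].
rewrite mem_enum in pX; rewrite /y; case: pickP => [q /andP[qX /eqP e]|/(_ p)].
  move: qX; rewrite -hX inE => /andP[_ /eqP eq].
  by rewrite -e eq nth_index.
by rewrite pX eqxx.
Qed.

(** For a given set of spots, both its probability bound and the bound for the common edges are
    products over components. The sum becomes a product of factors 1 + wgt Q, at most the
    exponential of the total weight. *)
Lemma exp_moment : \sum_(x <- d) x.1 * z ^+ #|A :&: cedges l x.2|
  <= expR (#|cover A|%:R * ((4 * l ^ 2)%:R ^+ 2 * (K * theta)) / r).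
Proof.
have z0 : 0 <= z by apply: le_trans z1.
pose FX := [set X : {set Y} | [forall Q in comps gam X, good Q]].
pose W (X : {set Y}) : R := \prod_(Q in comps gam X) z ^+ einside (proj Q).
have W0 X : 0 <= W X by apply: prodr_ge0 => Q _; rewrite exprn_ge0.
have pe c : perm_eq c (enum T) -> uniq c /\ forall x, x \in c.
  by move=> h; rewrite (perm_uniq h) enum_uniq; split=> // x; rewrite (perm_mem h) mem_enum.
apply: (@le_trans _ _ (\sum_(X in FX) pr d (fun c => spots c == X) * W X)).
  rewrite (eq_bigr (fun X => \sum_(x <- d) (if spots x.2 == X then x.1 * W X else 0))); last first.
    by move=> X _; rewrite /pr big_distrl /= [LHS]big_mkcond.
  rewrite exchange_big /= !big_seq; apply: ler_sum => x xd.
  have [x_0 /pe [uc cT]] := dd.1 x xd.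
  rewrite (bigD1 (spots x.2)) /=; last first.
    by rewrite inE; apply/forall_inP => Q; apply: spots_good.
  rewrite eqxx -[leLHS]addr0; apply: lerD; last first.
    by apply: sumr_ge0 => X _; case: ifP => // _; rewrite mulr_ge0.
  by rewrite ler_wpM2l // /W prodrXr ler_weXn2l // card_common.
apply: (@le_trans _ _ (\sum_(X in FX) \prod_(Q in comps gam X) wgt Q)).
  apply: ler_sum => X _; rewrite big_split /=; apply: ler_wpM2r => //.
  apply: le_trans (pr_spots X) _; rewrite (card_partition (comps_partition gam_sym X)).
  by rewrite prodrXr.
apply: le_trans (polymer_sum gam_sym wgt_ge0 (good := good) _) _.
  by move=> X Q; rewrite inE => /forall_inP h /h.
apply: (@le_trans _ _ (\prod_(Q | good Q) expR (wgt Q))).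
  apply: ler_prod => Q _; rewrite addr_ge0 ?wgt_ge0 //= expR_ge1Dx //.
rewrite -expR_sum ler_expR; exact: sum_wgt.
Qed.

End Estimate.

Lemma ppath_index (T : eqType) l (e : rel T) c x y : ppath l e c -> x \in c -> y \in c ->
  (index x c < index y c)%N -> (index y c <= index x c + l)%N -> e x y.
Proof.
move=> pc xc yc h1 h2; have := ppathP _ _ x _ pc _ _ h1 h2.
by rewrite !nth_index // index_mem => /(_ yc).
Qed.

(* Extremal example: the complement of a clique on k + 1 of (l + 1) k vertices. *)
Lemma ham_path_bound_crit (R : realType) l (b : R) N0 : (0 < l)%N -> ham_path_bound l b N0 -> crit R l <= b.
Proof.
move=> l0 hb; rewrite leNgt; apply/negP => lt_b.
(* This makes (crit R l - b) n at least 1, which pays for the independent set having k + 1 vertices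
   instead of k. *)
have [m hm] := @exists_nat_ge R (crit R l - b)^-1.
pose k := (maxn N0 m).+1; pose n := (l.+1 * k)%N.
pose low (x : 'I_n) := (x <= k)%N.
pose e : rel 'I_n := fun x y => (x != y) && ~~ (low x && low y).
have es : symmetric e by move=> x y; rewrite /e eq_sym (andbC (low x)).
have ei : irreflexive e by move=> x; rewrite /e eqxx.
have kn : (k <= n)%N by rewrite /n mulSn leq_addr.
have [||c pc hc] := hb 'I_n e es ei setT.
- by rewrite cardsT card_ord (leq_trans _ kn) // /k (leq_trans (leq_maxl _ _) (leqnSn _)).
- move=> x _; rewrite cardsT card_ord.
  have h1 : b * n%:R <= (n - k.+1)%:R.
    have n1 : 1 <= (crit R l - b) * n%:R.
      rewrite mulrC -ler_pdivrMr ?subr_gt0 // mul1r; apply: le_trans hm _; rewrite ler_nat.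
      by rewrite (leq_trans _ kn) // /k (leq_trans (leq_maxr _ _) (leqnSn _)).
    have cn : crit R l * n%:R = (l * k)%:R.
      by rewrite /crit /n !natrM mulrA divfK ?pnatr_eq0.
    have -> : (n - k.+1 = l * k - 1)%N by rewrite /n; move: l0; clear; lia.
    rewrite natrB; last by move: l0; rewrite /k; clear; nia.
    by move: n1 cn; rewrite mulrBl; clear; lra.
  apply: le_trans h1 _; rewrite ler_nat /dg.
  pose J := if low x then [set y : 'I_n | low y] else [set x].
  have cJ : (#|J| <= k.+1)%N.
    rewrite /J; case: ifP => _; last by rewrite cards1.
    rewrite -[k.+1]card_ord -cardsT -(card_in_imset (f := fun y : 'I_n => inord y : 'I_k.+1)).
      exact/subset_leq_card/subsetT.
    move=> y y'; rewrite !inE => h h' /(congr1 val); rewrite /= !inordK //.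
    exact: val_inj.
  have -> : [set y in [set: 'I_n] | e x y] = ~: J.
    apply/setP => y; rewrite !inE /e /J /=; case: (boolP (low x)) => hx; last first.
      by rewrite !inE andbT eq_sym.
    by rewrite inE andb_idl // => h; apply: contraNneq h => <-.
  by rewrite leq_subLR -[X in (X <= _)%N]card_ord -(cardsC J) leq_add2r.
have k1n : (k.+1 <= n)%N by rewrite /n /k; move: l0; clear; nia.
have cT x : x \in c by rewrite (perm_mem pc) mem_enum inE.
have sc : size c = n by rewrite (perm_size pc) -cardE cardsT card_ord.
pose w (i : 'I_k.+1) : 'I_n := widen_ord k1n i.
(* The ordering falls into [k] blocks of [l.+1] consecutive vertices, each of them a clique; two of
   the [k.+1] pairwise non-adjacent vertices would share a block. *)
have block (i : 'I_k.+1) : (index (w i) c %/ l.+1 < k)%N.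
  by rewrite ltn_divLR // (_ : k * l.+1 = size c)%N ?index_mem // sc mulnC.
pose f i : 'I_k := Ordinal (block i).
have : ~~ injectiveb f.
  by apply/negP => /injectiveP /leq_card; rewrite !card_ord ltnn.
apply/negP; rewrite negbK; apply/injectiveP => i j /(congr1 val) /= fij.
have nij (i' j' : 'I_k.+1) : (index (w i') c %/ l.+1 = index (w j') c %/ l.+1)%N ->
    ~~ (index (w i') c < index (w j') c)%N.
  move=> q; apply/negP => h; have hl : (index (w j') c <= index (w i') c + l)%N.
    rewrite -ltnS -addnS (leq_trans (ltn_ceil _ (ltn0Sn l))) // -q mulSn addnC leq_add2r.
    exact: leq_trunc_div.
  have := ppath_index hc (cT _) (cT _) h hl.
  by rewrite /e /low /= -ltnS ltn_ord -ltnS ltn_ord andbF.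
have : index (w i) c = index (w j) c.
  by apply/eqP; rewrite eqn_leq leqNgt (nij j i (esym fij)) leqNgt (nij i j fij).
by move/(congr1 (nth (w i) c)); rewrite !nth_index // => /(congr1 val) h; apply: val_inj.
Qed.

Section CycleEdges.
Variables (T : finType) (l : nat) (e : rel T).

Lemma cedges_sub_adj c : symmetric e -> perm_eq c (enum T) -> (l <= #|T|)%N ->
  ppath l e (c ++ take l c) -> forall E : {set T}, E \in cedges l c ->
  exists u v, E = [set u; v] /\ e u v.
Proof.
move=> es pc ln hc.
have uc : uniq c by rewrite (perm_uniq pc) enum_uniq.
have cT x : x \in c by rewrite (perm_mem pc) mem_enum.
have sc : size c = #|T| by rewrite (perm_size pc) -cardE.
have key u v d : (0 < d)%N -> (d <= l)%N -> (index v c = (index u c + d) %% #|T|)%N -> e u v.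
  move=> d0 dl hv; have iu : (index u c < #|T|)%N by rewrite -sc index_mem.
  have sz : size (c ++ take l c) = (#|T| + l)%N by rewrite size_cat size_takel sc.
  have nu : nth u (c ++ take l c) (index u c) = u by rewrite nth_cat index_mem cT nth_index.
  have nv : nth u (c ++ take l c) (index u c + d) = v.
    rewrite -[RHS](nth_index u (cT v)) hv nth_cat sc.
    have [h|h] := ltnP (index u c + d) #|T|; first by rewrite modn_small.
    rewrite nth_take; last by lia.
    by rewrite -{2}(subnK h) modnDr modn_small //; lia.
  by rewrite -{1}nu -nv; apply: (ppathP _ _ u _ hc); lia.
move=> E; rewrite inE => /existsP[u /existsP[v /andP[/eqP -> /hasP[d]]]].
rewrite mem_iota => /andP[d0 dl] /orP[/eqP h|/eqP h].
  by exists u, v; split=> //; apply: (key u v d); rewrite // -ltnS.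
by exists u, v; split=> //; rewrite es; apply: (key v u d); rewrite // -ltnS.
Qed.

Lemma nth_rot_mod (x0 : T) (c : seq T) i j : (i <= size c)%N -> (j < size c)%N ->
  nth x0 (rot i c) j = nth x0 c ((i + j) %% size c).
Proof.
move=> ic jc; rewrite /rot nth_cat size_drop; case: ltnP => h.
  by rewrite nth_drop modn_small //; lia.
rewrite nth_take; last by lia.
have -> : (i + j = j - (size c - i) + size c)%N by lia.
by rewrite modnDr modn_small //; lia.
Qed.

Lemma window_cedges (c : seq T) i (x y : T) : uniq c -> (forall x, x \in c) -> (l < #|T|)%N ->
  x \in take l.+1 (rot i c) -> y \in take l.+1 (rot i c) -> x != y -> [set x; y] \in cedges l c.
Proof.
move=> uc cT ln.
wlog ic : i / (i <= size c)%N.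
  move=> H; have [|h] := leqP i (size c); first exact: H.
  by rewrite rot_oversize ?(ltnW h) //; have := H 0%N; rewrite rot0; apply.
have sc := size_full uc cT.
move=> /(nthP x) [j hj <-] /(nthP x) [j' hj' <-].
have bd k : (k < size (take l.+1 (rot i c)))%N -> (k < size c)%N /\ (k <= l)%N.
  by rewrite size_takel ?size_rot ?sc //; move: ln; clear; lia.
have [[jc jl] [jc' jl']] := (bd _ hj, bd _ hj').
rewrite !nth_take ?ltnS // !nth_rot_mod //; set u := nth _ _ _; set v := nth _ _ _ => uv.
have T0 : (0 < size c)%N by rewrite sc; move: ln; clear; lia.
rewrite inE; apply/existsP; exists u; apply/existsP; exists v; rewrite eqxx /=.
rewrite /u /v !index_uniq ?ltn_pmod // -sc.
have jj : j <> j' by move=> h; rewrite /u /v h eqxx in uv.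
apply/hasP; have [h|h] := leqP j j'.
  exists (j' - j)%N; first by rewrite mem_iota; lia.
  by rewrite modnDml -addnA subnKC // eqxx.
exists (j - j')%N; first by rewrite mem_iota; lia.
by apply/orP; right; rewrite modnDml -addnA subnKC // ltnW.
Qed.

Lemma ppath_windows c : uniq c ->
  (forall i, {in take l.+1 (rot i c) &, forall x y, x != y -> e x y}) -> ppath l e c.
Proof.
case: c => // x0 c0; set c := x0 :: c0 => uc h; apply/(ppathP _ _ x0) => i j ij jl js.
have win m : (m <= l)%N -> (i + m < size c)%N -> nth x0 c (i + m) \in take l.+1 (rot i c).
  move=> ml ms; have -> : nth x0 c (i + m) = nth x0 (take l.+1 (rot i c)) m.
    rewrite nth_take // nth_rot_mod ?modn_small //; last exact: leq_ltn_trans (leq_addl _ _) ms.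
    by apply: leq_trans (leq_addr m i) (ltnW ms).
  apply: mem_nth; rewrite size_take size_rot; case: ifP => // _.
  exact: leq_ltn_trans (leq_addl _ _) ms.
apply: (h i); last by rewrite nth_uniq ?(ltn_trans ij) // ltn_eqF.
  by rewrite -[X in nth _ _ X]addn0 win // addn0 (ltn_trans ij).
by rewrite -(subnKC (ltnW ij)) win ?subnKC // ?(ltnW ij) //; lia.
Qed.

End CycleEdges.

(** For sets whose edges may wind around the cycle: there [n <= l * v], so theta^v with
    [theta <= 1 / 2] outweighs n sqrt n. *)
Lemma pow2_ge_sqr l v : (64 * l ^ 2 + 4 <= v)%N -> ((l * v) ^ 2 <= 2 ^ v)%N.
Proof.
move=> hv; pose q := (v %/ 4)%N.
have vq : (v <= 4 * q.+1)%N by rewrite /q; move: hv; clear; lia.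
have qv : (4 * q <= v)%N by rewrite /q; clear; lia.
have lq : (16 * l ^ 2 <= q)%N by rewrite /q leq_divRL //; move: hv; clear; lia.
have q2 : (q < 2 ^ q)%N by apply: ltn_expl.
apply: (@leq_trans (2 ^ (4 * q))); last by rewrite leq_exp2l.
rewrite expnMn; apply: (@leq_trans (l ^ 2 * (4 * 2 ^ q) ^ 2)).
  rewrite leq_mul2l leq_exp2r //; apply/orP; right; apply: leq_trans vq _.
  by rewrite leq_mul2l.
have e4 : (2 ^ (4 * q) = 2 ^ q * 2 ^ q * (2 ^ q * 2 ^ q))%N by rewrite -!expnD; congr (2 ^ _)%N; lia.
rewrite e4; move: lq q2; move: (2 ^ q)%N => Q; clear => lq q2.
rewrite expnMn mulnA (_ : Q ^ 2 = Q * Q)%N; last by rewrite mulnn.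
rewrite leq_mul2r; apply/orP; right.
have QQ : (Q <= Q * Q)%N by nia.
have : (l ^ 2 * 4 ^ 2 <= q)%N by move: lq; clear; lia.
lia.
Qed.

Section Numerics.
Variable R : realType.

Lemma expR_le_inv (x : R) : x < 1 -> expR x <= (1 - x)^-1.
Proof.
move=> x1; have h : 1 - x <= expR (- x) by have := expR_ge1Dx (- x).
by rewrite -[leLHS]invrK -expRN lef_pV2 // posrE ?expR_gt0 // subr_gt0.
Qed.

Lemma expR_le_linear (x : R) : 0 <= x -> x <= 1 / 2 -> expR x <= 1 + 2 * x.
Proof.
move=> x0 x1; apply: le_trans (expR_le_inv _) _; first lra.
rewrite -[leLHS]mul1r ler_pdivrMr; [nra|lra].
Qed.

(** The fourth root of e is at most 4/3. This is how the factor 2^-k beats the moment of a whole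
    cycle. *)
Lemma expR_quarter k : expR (k%:R / 4 : R) / 2 ^+ k <= (2 / 3) ^+ k.
Proof.
rewrite expRM_natl -expr_div_n lerXn2r //.
- by rewrite nnegrE divr_ge0 ?expR_ge0.
- by rewrite nnegrE divr_ge0.
rewrite ler_pdivrMr //; apply: le_trans (expR_le_inv _) _; first lra.
rewrite -[leLHS]mul1r ler_pdivrMr; lra.
Qed.

Lemma two_thirds_small (eps : R) : 0 < eps -> exists k0, forall k, (k0 <= k)%N -> (2 / 3) ^+ k <= eps.
Proof.
move=> e0; have [k0 hk0] := @exists_nat_ge R (2 / eps); exists k0 => k hk.
have b (j : nat) : 1 + j%:R / 2 <= (3 / 2 : R) ^+ j.
  elim: j => [|j IH]; first by rewrite mul0r addr0.
  rewrite exprS -natr1; have := ler0n R j; move: IH; set X := _ ^+ _; set J := j%:R.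
  by clear; lra.
have -> : (2 / 3 : R) = (3 / 2)^-1 by rewrite invf_div.
rewrite exprVn -[leLHS]mul1r ler_pdivrMr ?exprn_gt0 ?divr_gt0 //.
apply: (@le_trans _ _ (eps * (1 + k%:R / 2))); last by rewrite ler_pM2l.
have : 2 <= k%:R * eps.
  by rewrite -ler_pdivrMr //; apply: le_trans hk0 _; rewrite ler_nat.
have : 0 <= eps by apply: ltW.
rewrite mulrDr; move: (k%:R) => J h1 h2; nra.
Qed.

End Numerics.

Lemma card_cover_pairs (T : finType) (A : {set {set T}}) :
  (forall E, E \in A -> (#|E| <= 2)%N) -> (#|cover A| <= 2 * #|A|)%N.
Proof.
move=> h; rewrite /cover mulnC -sum_nat_const.
apply: leq_trans (leq_card_cover _) _.
by apply: leq_sum.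
Qed.

(** * Choice of the constants for the two rounds *)

Section Percolation.
Variables (R : realType) (l : nat).

(* Two rounds of exposure: the first leaves at most about the square root of n
   edges of some random cycle uncovered, the second covers these. *)
Lemma percolation (K eps : R) : (2 <= l)%N -> 0 < K -> 0 < eps -> exists (C : R) N,
  forall (T : finType) (x0 : T) (d : seq (R * seq T)) (E : {set {set T}}) (a p : R),
  (N <= #|T|)%N -> dist_on d (fun c => perm_eq c (enum T) /\ cedges l c \subset E) ->
  (forall (D : seq nat) (y : nat -> T), uniq D -> all (fun i => i < #|T|)%N D ->
     pr d (agrees x0 y D) <= (K / #|T|%:R) ^+ size D) ->
  0 <= a -> a ^+ l = #|T|%:R -> p <= 1 -> C <= p * a ->
  \sum_(W : {set {set T}} | (W \subset E) &&
     [forall i : 'I_(size d), ~~ (cedges l (tnth (in_tuple d) i).2 \subset W)]) wt p E W <= eps.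
Proof.
move=> l2 K0 e0.
pose D : R := (4 * l ^ 2)%:R ^+ 2.
have D0 : 0 < D by rewrite exprn_gt0 // ltr0n; move: l2; clear; lia.
(* With t at most eps / 16 and 1 / 8, the second round fails with probability at most 8t <= eps / 2,
   the linear bound for exp(4t) applies, and r t stays below k / 4. *)
pose m : R := Num.min (1 / 8) (eps / 16).
have m0 : 0 < m by rewrite lt_min; apply/andP; split; lra.
pose theta : R := Num.min (1 / 2) (m / (D * K)).
have DK : 0 < D * K by rewrite mulr_gt0.
have th0 : 0 < theta by rewrite lt_min; apply/andP; split; [lra|apply: divr_gt0].
have thh : theta <= 1 / 2 by rewrite ge_min lexx.
have tm : D * (K * theta) <= m.
  by rewrite mulrA mulrC -ler_pdivlMr // ge_min lexx orbT.
set t := D * (K * theta) in tm; have t0 : 0 < t by rewrite mulr_gt0 // mulr_gt0.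
have t8 : t <= 1 / 8 by apply: le_trans tm _; rewrite ge_min lexx.
have te : t <= eps / 16 by apply: le_trans tm _; rewrite ge_min lexx orbT.
have [|k0 hk0] := @two_thirds_small R (eps / 2); first lra.
(* The summands give sqrt n >= k0, the size needed for [pow2_ge_sqr], and [l < n]. *)
pose N := (k0 ^ 2 + (l * (64 * l ^ 2 + 4)) + l.+1)%N.
exists (5 / theta ^+ 2), N => T x0 d E a p; set n := #|T| => nN dd hsp a0 al p1 hp.
have n0 : (0 < n)%N by move: nN; rewrite /N; clear; lia.
have ln : (l < n)%N by move: nN; rewrite /N; clear; lia.
have n1 : 1 <= n%:R :> R by rewrite (ler_nat R 1).
pose r : R := Num.sqrt n%:R.
have rn : r ^+ 2 = n%:R by rewrite sqr_sqrtr.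
have r1 : 1 <= r by rewrite -(ler_pXn2r (n := 2)) ?nnegrE ?sqrtr_ge0 // expr1n rn.
have r0 : 0 < r by apply: lt_le_trans r1.
have a1 : 1 <= a.
  rewrite leNgt; apply/negP => h; have : a ^+ l < 1 by rewrite exprn_ilt1 //; move: l2; clear; lia.
  by rewrite al ltNge n1.
have ar : a <= r.
  by rewrite -(ler_pXn2r (n := 2)) ?nnegrE ?sqrtr_ge0 // rn -al ler_weXn2l.
have a_gt0 : 0 < a by apply: lt_le_trans a1.
have p0 : 0 < p.
  rewrite -(pmulr_lgt0 _ a_gt0); apply: lt_le_trans hp.
  by rewrite divr_gt0 ?exprn_gt0.
(* Both rounds have probability at least p / 2. As p is at most 1, 5 / p dominates the two bases 1 +
   4 / p and 1 + 2 / p that occur. *)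
pose z : R := 5 / p.
have za : z <= theta ^+ 2 * a.
  by rewrite /z ler_pdivrMr // -mulrA -ler_pdivrMl ?exprn_gt0 // mulrC [a * p]mulrC.
have zp : 5 <= z by rewrite /z ler_pdivlMr //; move: p0 p1; clear; lra.
have z1 : 1 <= z by apply: le_trans zp; lra.
have wrap v : (n <= l * v)%N -> theta ^+ v * (n%:R * r) <= 1.
  move=> hv; have v0 : (64 * l ^ 2 + 4 <= v)%N.
    rewrite -(leq_pmul2l (m := l)); last by move: l2; clear; lia.
    by apply: leq_trans hv; move: nN; rewrite /N; clear; lia.
  have h1 : n%:R * r <= (2 ^ v)%:R.
    apply: (@le_trans _ _ ((n ^ 2)%:R)).
      rewrite natrX expr2 ler_wpM2l // -rn expr2 -[leLHS]mulr1 ler_wpM2l // ltW //.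
    by rewrite ler_nat (leq_trans _ (pow2_ge_sqr v0)) // leq_exp2r.
  apply: (@le_trans _ _ ((1 / 2) ^+ v * (2 ^ v)%:R)).
    apply: ler_pM; rewrite ?exprn_ge0 ?(ltW th0) //; last by rewrite lerXn2r // nnegrE ltW //; lra.
    by rewrite mulr_ge0 // ltW.
  by rewrite natrX -exprMn div1r mulVf ?expr1n // pnatr_eq0.
(* The lower bound on [k] lets 2^k beat exp(r t) in the first round; the upper bound makes [k] edges
   cover at most 4r vertices, with moment at most exp(4t). *)
have [k [kr k2 kk]] : exists k : nat, [/\ r <= k%:R, k%:R <= 2 * r & (k0 <= k)%N].
  have [k1 hk1] := @exists_nat_ge R r.
  have ex : exists k : nat, r <= k%:R by exists k1.
  case: (ex_minnP ex) => k hk kmin; exists k; split=> //.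
    case: k hk kmin => [|k] hk kmin; first by move: r0; clear; lra.
    have : k%:R < r by rewrite ltNge; apply/negP => /kmin; rewrite ltnn.
    by rewrite -natr1; move: r1; clear; lra.
  have : (k0 ^ 2)%:R <= r ^+ 2.
    by rewrite rn ler_nat; move: nN; rewrite /N; clear; lia.
  rewrite natrX ler_pXn2r ?nnegrE ?ler0n ?(ltW r0) // => h.
  by rewrite -(ler_nat R); apply: le_trans hk.
have pe : dist_on d (fun c => perm_eq c (enum T)).
  by case: dd => h1 h2; split=> // x /h1 [? [? ?]].
have t2 : (4 * l ^ 2)%:R ^+ 2 * (K * theta) <= 1 / 2 by move: t8; rewrite /t /D; clear; lra.
have th1 : theta <= 1 by move: thh; clear; lra.
(* The finite list [d] is indexed by its positions, which gives the finite type of members that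
   [two_rounds] asks for. *)
pose mu (i : 'I_(size d)) : R := (tnth (in_tuple d) i).1.
pose S (i : 'I_(size d)) := cedges l (tnth (in_tuple d) i).2.
have hi i : 0 <= mu i /\ (perm_eq (tnth (in_tuple d) i).2 (enum T) /\ S i \subset E).
  by apply: dd.1; apply: mem_tnth.
have pe2 c : perm_eq c (enum T) -> uniq c /\ forall x, x \in c.
  by move=> h; rewrite (perm_uniq h) enum_uniq; split=> // x; rewrite (perm_mem h) mem_enum.
have moment i (A : {set {set T}}) (y : R) : A \subset S i -> 1 <= y -> y <= z ->
    \sum_j mu j * y ^+ #|A :&: S j| <= expR (#|cover A|%:R * t / r).
  move=> AS y1 yz; have [_ [/pe2 [uc cT] _]] := hi i.
  apply: le_trans (exp_moment uc cT ln l2 AS pe hsp K0 z1 th0 th1 za al a0 ar r0 rn wrap t2).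
  rewrite [leRHS]big_tnth; apply: ler_sum => j _; rewrite ler_wpM2l ?(hi j).1 //.
  by rewrite lerXn2r // nnegrE; [apply: le_trans y1|apply: le_trans z1].
(* The solution of 1 - p = (1 - p / 2)(1 - p2); it is at least p / 2. *)
pose p2 := (p / 2) / (1 - p / 2).
have q0 : 0 < 1 - p / 2 by move: p1; clear; lra.
have p20 : 0 < p2 by rewrite divr_gt0 // divr_gt0.
have p2p : p / 2 <= p2.
  by rewrite ler_pdivlMr //; move: p0 p1; clear; nra.
have p21 : p2 <= 1 by rewrite ler_pdivrMr //; move: p1; clear; lra.
have ip : 1 <= p^-1 by rewrite invf_ge1.
have := @two_rounds R {set T} 'I_(size d) mu S E p (p / 2) p2 (expR (n%:R * t / r)) (8 * t) k.
move=> TR; apply: (le_trans (TR _ _ _ _ _ _ _ _ _ _ _)).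
- by move=> i; case: (hi i).
- by rewrite -(big_tnth _ _ _ predT (fun x => x.1)); case: dd.
- by move=> i; case: (hi i) => _ [].
- by rewrite divr_gt0.
- by move: p1; clear; lra.
- by [].
- by [].
- by rewrite /p2 mulrBr mulr1 [_ * (_ / _)]mulrC divfK ?gt_eqF //; clear; lra.
- move=> i; apply: le_trans (moment i (S i) _ (subxx _) _ _) _.
  + by rewrite lerDl divr_ge0 // divr_ge0 // ltW.
  + have -> : 2 / (p / 2) = 4 / p by field; rewrite gt_eqF.
    by rewrite /z; move: ip; clear; lra.
  rewrite ler_expR ler_wpM2r ?invr_ge0 ?(ltW r0) // ler_wpM2r ?(ltW t0) // ler_nat.
  exact: max_card.
- move=> i A AS Ak; apply: le_trans (moment i A _ AS _ _) _.
  + by rewrite lerDl invr_ge0 ltW.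
  + have : p2^-1 <= (p / 2)^-1 by rewrite lef_pV2 // posrE divr_gt0.
    by rewrite invf_div /z; move: ip; clear; lra.
  have cA : #|cover A|%:R <= 4 * r.
    have : (#|cover A| <= 2 * k)%N.
      apply: leq_trans (card_cover_pairs _) _; last by rewrite leq_mul2l.
      move=> F /(subsetP AS); rewrite inE => /existsP[u /existsP[v /andP[/eqP -> _]]].
      by rewrite cards2; case: (_ == _).
    by rewrite -(ler_nat R) natrM; move: k2; clear; lra.
  apply: (@le_trans _ _ (expR (4 * t))).
    rewrite ler_expR ler_pdivrMr // mulrAC ler_wpM2r // ltW //.
  apply: le_trans (expR_le_linear _ _) _; move: t0 t8; clear; lra.
- by rewrite mulr_ge0 // ltW.
have -> : n%:R * t / r = r * t by rewrite -rn; field; rewrite gt_eqF.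
have : expR (r * t) / 2 ^+ k <= eps / 2.
  apply: le_trans (hk0 k kk); apply: le_trans (expR_quarter _ _).
  rewrite ler_wpM2r ?invr_ge0 ?exprn_ge0 // ler_expR ler_pM ?(ltW r0) ?(ltW t0) //.
  by move: t8; clear; lra.
by move: te; clear; lra.
Qed.

End Percolation.

(** * Random subgraphs and the threshold *)

Section Graphs.
Variables (T : finType).
Implicit Types (G : sgraph T) (e : rel T).

Lemma adj_sym G : symmetric (adj G).
Proof. by move=> x y; rewrite /adj setUC. Qed.

Lemma edges_card2 G E : E \in edges G -> #|E| = 2.
Proof. by move=> h; have /forall_inP /(_ E h) /eqP := valP G. Qed.

Lemma adj_irr G : irreflexive (adj G).
Proof. by move=> x; apply/negP => /edges_card2; rewrite setUid cards1. Qed.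

Lemma degree_dg G x : degree G x = dg (adj G) [set: T] x.
Proof. by apply: eq_card => y; rewrite !inE. Qed.

Lemma min_degree_le G x : (min_degree G <= degree G x)%N.
Proof.
rewrite /min_degree; have : x \in index_enum T by rewrite mem_index_enum.
elim: (index_enum T) => // y s IH; rewrite inE big_cons geq_min => /orP[/eqP <-|/IH ->].
  by rewrite leqnn.
by rewrite orbT.
Qed.

Lemma min_degree_le_card G : (min_degree G <= #|T|)%N.
Proof.
rewrite /min_degree; elim/big_rec: _ => // x m _ h.
by rewrite geq_min h orbT.
Qed.

Section GraphOf.
Variable e : rel T.
Hypotheses (es : symmetric e) (ei : irreflexive e).

Let E := [set F : {set T} | [exists u, exists v, (F == [set u; v]) && e u v]].

Lemma graph_of_subproof : [forall F in E, #|F| == 2].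
Proof.
apply/forall_inP => F; rewrite inE => /existsP[u /existsP[v /andP[/eqP -> uv]]].
by rewrite cards2; case: (eqVneq u v) uv => // ->; rewrite ei.
Qed.

Definition graph_of : sgraph T := exist (fun E : {set {set T}} => is_true [forall e in E, #|e| == 2]) E graph_of_subproof.

Lemma adj_graph_of x y : adj graph_of x y = e x y.
Proof.
rewrite /adj /edges /= inE; apply/existsP/idP => [[u /existsP[v /andP[/eqP h uv]]]|xy]; last first.
  by exists x; apply/existsP; exists y; rewrite eqxx.
have : x \in [set u; v] by rewrite -h !inE eqxx.
have : y \in [set u; v] by rewrite -h !inE eqxx orbT.
have : u \in [set x; y] by rewrite h !inE eqxx.
have : v \in [set x; y] by rewrite h !inE eqxx orbT.
rewrite !inE => /orP[]/eqP hv /orP[]/eqP hu /orP[]/eqP hy /orP[]/eqP hx; subst; rewrite ?ei // in uv *.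
all: by rewrite ?ei // in uv *; rewrite // es.
Qed.
End GraphOf.

Lemma has_ham_power_ppath l G : has_ham_power l G ->
  exists2 c, perm_eq c (enum T) & ppath l (adj G) c.
Proof.
case=> C CG [c [uc cT hc]]; exists c.
  by apply: uniq_perm; rewrite ?enum_uniq // => x; rewrite cT mem_enum.
apply: (@sub_ppath _ _ (adj C)); first by move=> x y; apply: (subsetP CG).
by apply: ppath_windows => // i; apply: hc.
Qed.

Lemma cedges_has_ham_power l G c : perm_eq c (enum T) -> (l < #|T|)%N ->
  cedges l c \subset edges G -> has_ham_power l G.
Proof.
move=> pc ln /subsetP sub; exists G => //; exists c.
have uc : uniq c by rewrite (perm_uniq pc) enum_uniq.
have cT x : x \in c by rewrite (perm_mem pc) mem_enum.
by split=> // i x y xw yw xy; apply: sub; apply: (window_cedges uc cT ln xw yw xy).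
Qed.

Lemma prob_random_subgraph_fail (R : realType) G (p : R) (A : sgraph T -> Prop) (Q : pred {set {set T}}) :
  0 <= p <= 1 -> (forall H, edges H \subset edges G -> ~~ Q (edges H) -> A H) ->
  1 - \sum_(W : {set {set T}} | (W \subset edges G) && Q W) wt p (edges G) W
    <= prob_random_subgraph G p A.
Proof.
move=> p01 hA; rewrite lerBlDr -(sum_wt p (edges G)).
rewrite (bigID Q) /= addrC lerD2r.
pose good H := (edges H \subset edges G) && ~~ Q (edges H).
apply: (@le_trans _ _ (\sum_(H : sgraph T | good H) wt p (edges G) (edges H))); last first.
  rewrite /prob_random_subgraph [leLHS]big_mkcond [leRHS]big_mkcond /=; apply: ler_sum => H _.
  rewrite /good; case: (boolP (edges H \subset edges G)) => //= HG.
  case: (boolP (Q _)) => /= hQ; first by case: ifP => // _; apply: wt_ge0.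
  by rewrite asboolT //; apply: hA.
have sg (W : {set {set T}}) : W \subset edges G -> [forall e in W, #|e| == 2].
  by move=> /subsetP h; apply/forall_inP => F /h /edges_card2 ->.
pose mk (W : {set {set T}}) : sgraph T := insubd G W.
rewrite (reindex_onto (fun H => edges H) mk) /=; last first.
  by move=> W /andP[/sg WG _]; rewrite /edges /mk val_insubd WG.
rewrite le_eqVlt; apply/orP; left; apply/eqP; apply: eq_bigl => H.
by rewrite /good /mk /edges valKd eqxx andbT.
Qed.

End Graphs.

(** The induced subgraph on [H] becomes a graph on the subtype of [H], with the same degrees, and
    the path is mapped back. *)
Lemma ham_path_bound_of_graphs (R : realType) l (b : R) N :
  (forall n, (N <= n)%N -> forall T : finType, #|T| = n -> forall G : sgraph T,
     b * n%:R <= (min_degree G)%:R -> has_ham_power l G) ->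
  ham_path_bound l b N.
Proof.
move=> h T e es ei H NH hdg.
(* Covers the default value in the definition of the minimum degree. *)
have bH : b * #|H|%:R <= #|H|%:R.
  have [->|[x xH]] := set_0Vmem H; first by rewrite cards0 mulr0.
  apply: le_trans (hdg x xH) _; rewrite ler_nat subset_leq_card //.
  by apply/subsetP => y; rewrite inE => /andP[].
pose T' := {x : T | x \in H}.
pose e' : rel T' := relpre val e.
have es' : symmetric e' by move=> x y; apply: es.
have ei' : irreflexive e' by move=> x; apply: ei.
pose G := graph_of ei'.
have cT' : #|{: T'}| = #|H| by rewrite card_sig.
have dgG (x : T') : degree G x = dg e H (val x).
  rewrite /degree /dg -(card_imset _ val_inj); apply: eq_card => y.
  rewrite !inE; apply/imsetP/andP => [[z]|[yH xy]].
    by rewrite inE adj_graph_of // => h' ->; split=> //; apply: valP.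
  by exists (Sub y yH) => //; rewrite inE adj_graph_of.
have hG : b * #|H|%:R <= (min_degree G)%:R.
  rewrite /min_degree; elim/big_ind: _ => [|m1 m2 h1 h2|x _].
  - by rewrite cT'.
  - by rewrite /minn; case: ifP.
  - by rewrite dgG; apply: hdg; apply: valP.
have [c pc hc] := has_ham_power_ppath (h _ NH _ cT' G hG).
exists (map val c).
  apply: uniq_perm; rewrite ?enum_uniq //.
    by rewrite (map_inj_uniq val_inj) (perm_uniq pc) enum_uniq.
  move=> x; rewrite mem_enum; apply/mapP/idP => [[y _ ->]|xH]; first exact: valP.
  by exists (Sub x xH) => //; rewrite (perm_mem pc) mem_enum.
elim: c {pc} hc => //= x c IH /andP[h1 /IH ->]; rewrite andbT -map_take all_map.
by apply: sub_all h1 => y /=; rewrite adj_graph_of.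
Qed.

Lemma cycle_spread_of_bound (R : realType) l (eta b : R) N0 : (0 < l)%N -> 0 < eta -> eta <= 1 ->
  crit R l + eta <= b -> ham_path_bound l (b - eta / 4) N0 ->
  exists (K : R) N, 0 < K /\ forall (T : finType) (e : rel T) (x0 : T),
    symmetric e -> irreflexive e -> (N <= #|T|)%N ->
    (forall x, (b + eta + eta) * #|T|%:R <= (dg e [set: T] x)%:R) ->
    exists2 d : seq (R * seq T),
      dist_on d (fun c => perm_eq c (enum T) /\ ppath l e (c ++ take l c)) &
      forall (D : seq nat) (y : nat -> T), uniq D -> all (fun i => i < #|T|)%N D ->
        pr d (agrees x0 y D) <= (K / #|T|%:R) ^+ size D.
Proof.
move=> l0 eta0 eta1 hb hbound.
have cr0 : 0 <= crit R l by rewrite /crit divr_ge0.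
have [q0 hq] := ham_connected eta0 eta1 hb hbound.
have [kappa [n0 [k1 hsp]]] := spread_recursion l0 eta0 eta1 hb hq.
by apply: (cycle_spread l0 eta0 _ k1 _ hsp); lra.
Qed.

(** Here [b] stands for the threshold and [a] for n^(1/l). The existence of power paths above [b]
    enters twice: in the absorption, and through the extremal example, which yields
    [crit R l <= b]. *)
Lemma ham_power_random_subgraph (R : realType) l (b mu eps : R) : (2 <= l)%N ->
  (forall nu, 0 < nu -> exists N0, ham_path_bound l (b + nu) N0) -> 0 < mu -> 0 < eps ->
  exists (C : R) N, forall (T : finType) (G : sgraph T) (a p : R), (N <= #|T|)%N ->
    (b + mu) * #|T|%:R <= (min_degree G)%:R -> 0 <= a -> a ^+ l = #|T|%:R -> 0 <= p <= 1 ->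
    C <= p * a -> 1 - eps <= prob_random_subgraph G p (@has_ham_power T l).
Proof.
move=> l2 hb mu0 e0; have l0 : (0 < l)%N by apply: ltnW.
have bc : crit R l <= b.
  apply/ler_addgt0Pr => nu /hb [N0]; exact: ham_path_bound_crit.
(* The degree excess is shared out: mu / 4 to exceed the threshold, eta / 4 for reservoir and
   absorber, and one [eta] each for the recursion and for closing the cycle; the total is below
   [mu]. *)
pose eta := Num.min 1 (mu / 8).
have eta0 : 0 < eta by rewrite lt_min ltr01 divr_gt0.
have eta1 : eta <= 1 by rewrite ge_min lexx.
have eta8 : eta <= mu / 8 by rewrite ge_min lexx orbT.
have [|N0] := hb (mu / 4); first by rewrite divr_gt0.
have -> : b + mu / 4 = b + mu / 4 + eta / 4 - eta / 4 by rewrite addrK.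
case/(cycle_spread_of_bound l0 eta0 eta1); first by lra.
move=> K [N1 [K0 hsp]]; have [C [N2 hperc]] := percolation l2 K0 e0.
exists C, (maxn l.+1 (maxn N1 N2)) => T G a p.
rewrite !geq_max => /and3P[ln n1 n2] hG a0 al p01 Cp.
have [x0 _] : exists x : T, x \in T by apply/card_gt0P; apply: leq_ltn_trans ln.
have [d [dd1 dd2] hd] : exists2 d : seq (R * seq T),
    dist_on d (fun c => perm_eq c (enum T) /\ ppath l (adj G) (c ++ take l c)) &
    forall (D : seq nat) (y : nat -> T), uniq D -> all (fun i => i < #|T|)%N D ->
      pr d (agrees x0 y D) <= (K / #|T|%:R) ^+ size D.
  apply: hsp => //; [exact: adj_sym|exact: adj_irr|move=> x].
  apply: (@le_trans _ _ (min_degree G)%:R); last by rewrite -degree_dg ler_nat min_degree_le.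
  by apply: le_trans hG; rewrite ler_wpM2r //; lra.
have dd : dist_on d (fun c => perm_eq c (enum T) /\ cedges l c \subset edges G).
  split=> // x /dd1 [x_0 [pc hc]]; split=> //; split=> //; apply/subsetP => E.
  by case/(cedges_sub_adj (@adj_sym _ G) pc (ltnW ln) hc) => u [v [-> ]].
have p1 : p <= 1 by case/andP: p01.
pose Q (W : {set {set T}}) := [forall i : 'I_(size d), ~~ (cedges l (tnth (in_tuple d) i).2 \subset W)].
apply: le_trans (prob_random_subgraph_fail (A := @has_ham_power T l) (Q := Q) p01 _); last first.
  move=> H HG /forallPn /= [i]; rewrite negbK; apply: cedges_has_ham_power => //.
  by have [_ []] := dd.1 _ (mem_tnth i (in_tuple d)).
by rewrite lerD2l lerN2; apply: (hperc T x0 d (edges G) a p).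
Qed.

From mathcomp Require Import all_classical all_analysis.
Import numFieldNormedType.Exports.
Local Open Scope classical_set_scope.
Local Open Scope ring_scope.

(** The infimum may not be attained, but some admissible [d] lies below it plus [nu]. The value 1 is
    admissible because no nonempty graph has minimum degree above its number of vertices, so the
    infimum is over a nonempty set. *)
Lemma ham_path_bound_threshold (R : realType) (l : nat) (nu : R) : (2 <= l)%N -> 0 < nu ->
  exists N0, ham_path_bound l (ham_power_threshold R l + nu) N0.
Proof.
move=> l2 nu0; rewrite /ham_power_threshold; set S := [set d : R | _].
have S1 : S 1.
  split; first by rewrite ler01 lexx.
  move=> mu mu0; exists 1%N => // n /= n1 T cT G.
  rewrite leNgt => /negP[]; apply: (@le_lt_trans _ _ n%:R).
    by rewrite ler_nat -cT min_degree_le_card.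
  by rewrite mulrDl mul1r ltrDl mulr_gt0 // ltr0n.
have hS : has_inf S by split; [exists 1|exists 0 => d [/andP[]]].
have [d [/andP[d0 d1] hd] dlt] := inf_adherent nu0 hS.
have [] : exists N, forall n, (N <= n)%N -> forall T : finType, #|T| = n -> forall G : sgraph T,
    (inf S + nu) * n%:R <= (min_degree G)%:R -> has_ham_power l G.
  have [|N _ hN] := hd (inf S + nu - d); first by rewrite subr_gt0.
  by exists N => n nN T cT G hG; apply: (hN n nN T cT G); rewrite addrCA subrr addr0.
by move=> N /ham_path_bound_of_graphs hN; exists N.
Qed.

Theorem theorem2p3 (R : realType) (l : nat) (mu : R) (p : nat -> R) :
  (2 <= l)%N ->
  0 < mu ->
  (forall n : nat, 0 <= p n <= 1) ->
  p n / n%:R `^ (- l%:R^-1) @[n --> \oo] --> +oo ->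
  forall eps : R, 0 < eps ->
  exists n0 : nat, forall n : nat, (n0 <= n)%N ->
  forall T : finType, #|T| = n ->
  forall G : sgraph T,
    (ham_power_threshold R l + mu) * n%:R <= (min_degree G)%:R ->
    1 - eps <= prob_random_subgraph G (p n) (@has_ham_power T l).
Proof.
move=> l2 mu0 p01 plim eps e0.
have [C [N hN]] := ham_power_random_subgraph l2
  (fun nu nu0 => ham_path_bound_threshold l2 nu0) mu0 e0.
have [M _ hM] : \forall n \near \oo, C <= p n / n%:R `^ (- l%:R^-1).
  by move/cvgryPge : plim; apply.
exists (maxn N M) => n; rewrite geq_max => /andP[nN nM] T cT G hG.
apply: (hN T G (n%:R `^ l%:R^-1) (p n)); rewrite ?cT //.
- by rewrite -powR_mulrn ?powR_ge0 // -powRrM mulVf ?powRr1 // pnatr_eq0 -lt0n ltnW.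
by have := hM n nM; rewrite /= powRN invrK.
Qed.
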